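(* Suppose that $$\int_1^\infty g^{-1/m}(\zeta)\,\zeta^{1/m-1}\,d\zeta<\infty \qquad\text{and}\qquad \int_{\Omega\setminus S}\gamma\left(\frac{1}{f(x)}\right)dx<\infty ,$$ and, moreover, that $\partial S$ has finite $k$-dimension. If $$\limsup_{r\to+0} r^{\,n-k-m}\,G^{-1}\left(C\,r\,\operatorname{ess\,inf}_{S_r\setminus S} f^{1/m}\right)<\infty$$ and $$\liminf_{r\to+0} r^m\,\mu\left(C r^{m-n+k}\right)\operatorname{ess\,inf}_{S_r\setminus S} f>0$$ for all real numbers $C>0$, where $G^{-1}$ is the inverse function to $$G(t)=\int_t^\infty g^{-1/m}(\zeta)\,\zeta^{1/m-1}\,d\zeta ,$$ then the singular set $S$ is removable for any weak solution $u$ of the inequality $$\sum_{|\alpha|=m}\partial^\alpha a_\alpha(x,u)\ge f(x)\,g(|u|)\quad\text{in }\Omega\setminus S .$$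
   Context: Setting. $m,n\ge1$ are integers, $\Omega\subset\mathbb R^n$ is a bounded domain, $S$ is a compact subset of $\Omega$. For each multi-index $\alpha$ with $|\alpha|=m$, $a_\alpha:\Omega\times\mathbb R\to\mathbb R$ is a Caratheodory function, and there is a constant $A>0$ with $|a_\alpha(x,\zeta)|\le A|\zeta|$ for almost all $x\in\Omega$ and all $\zeta\in\mathbb R$. $f:\Omega\to[0,\infty)$ is measurable. $g:[0,\infty)\to[0,\infty)$ is twice continuously differentiable, $g(0)=0$, and $g(\zeta)>0$, $g'(\zeta)>0$, $g''(\zeta)>0$ for all $\zeta\in(0,\infty)$. Notation. For $\omega\subset\mathbb R^n$ and $r>0$, $\omega_r$ is the set of points of $\mathbb R^n$ whose distance to $\omega$ is less than $r$. $\operatorname{mes}$ is Lebesgue measure on $\mathbb R^n$. Weak solution. $u$ is a weak solution of $\sum_{|\alpha|=m}\partial^\alpha a_\alpha(x,u)\ge f(x)g(|u|)$ in $\Omega\setminus S$ if $u\in L_1(\Omega\setminus S_r)$ and $f(x)g(|u|)\in L_1(\Omega\setminus S_r)$ for any $r>0$, and $$\int_\Omega\sum_{|\alpha|=m}(-1)^m a_\alpha(x,u)\,\partial^\alpha\varphi\,dx\ge\int_\Omega f(x)g(|u|)\varphi\,dx\qquad( * )$$ for any non-negative $\varphi\in C_0^\infty(\Omega\setminus S)$. Removability. The singular set $S$ is removable (for $u$) if $u\in L_1(\Omega)$, $f(x)g(|u|)\in L_1(\Omega)$, and $( * )$ holds for all non-negative $\varphi\in C_0^\infty(\Omega)$;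 here $u$ is extended by zero to $S$. The functions $\gamma$ and $\mu$. The Legendre transformation of $g$ is $g^*(\xi)=\int_{g'(0)}^{\xi}(g')^{-1}(\zeta)\,d\zeta$ for $\xi>g'(0)$ and $g^*(\xi)=0$ for $\xi\le g'(0)$, where $(g')^{-1}$ is the inverse function to $g'$. For $\xi>0$, $\gamma(\xi)=g^*(\xi)/\xi$ and $\mu(\xi)=\inf_{t\ge\xi}g(t)/t$. Conventions: $\gamma(1/f(x))=+\infty$ where $f(x)=0$, and $G^{-1}(0)=+\infty$. Finite $k$-dimension. For a real number $k$, a bounded set $\omega\subset\mathbb R^n$ has finite $k$-dimension if $\limsup_{r\to+0}\operatorname{mes}\omega_r/r^{n-k}<\infty$. *)

(* Defs.v *)
From HB Require Import structures.
From mathcomp Require Import all_boot all_order all_algebra.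
From mathcomp Require Import all_classical all_reals all_analysis.
From mathcomp Require Import ess_sup_inf.

Set Implicit Arguments.
Unset Strict Implicit.
Unset Printing Implicit Defensive.

Import Order.TTheory GRing.Theory Num.Theory.
Import numFieldNormedType.Exports.

Local Open Scope classical_set_scope.
Local Open Scope ring_scope.

(** The product (equivalently, Borel) sigma-algebra on R^n, generated by the
    preimages of the Borel sets of the line under the coordinates. *)
Definition rV_cylinder (R : realType) (n : nat) : set (set 'rV[R]_n) :=
  [set A | exists (i : 'I_n) (B : set (measurableTypeR R)),
     measurable B /\ A = [set x : 'rV[R]_n | B (x ord0 i)]].

Definition rV_borel (R : realType) (n : nat) : measurableType _ :=
  g_sigma_algebraType (@rV_cylinder R n).

Definition rV_cons (R : realType) (n : nat)
    (p : rV_borel R n * measurableTypeR R) : rV_borel R n.+1 :=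
  row_mx (p.2%:M : 'rV[R]_1) (p.1 : 'rV[R]_n).

Lemma measurable_rV_cons (R : realType) (n : nat) :
  measurable_fun [set: rV_borel R n * measurableTypeR R] (@rV_cons R n).
Proof.
apply: (@measurability _ _ _ (rV_borel R n.+1) _ _ (@rV_cylinder R n.+1)) => //.
move=> _ [_ [i [B [mB ->]] <-]]; rewrite setTI.
case: (@split_ordP 1 n i) => j ->.
  rewrite (_ : _ @^-1` _ = snd @^-1` B).
    by rewrite -[X in measurable X]setTI; exact: measurable_snd.
  apply/funext => p; rewrite /preimage /rV_cons /=.
  by rewrite (row_mxEl (p.2%:M : 'rV[R]_1) p.1) [j]ord1 mxE mulr1n.
rewrite (_ : _ @^-1` _ =
    fst @^-1` ([set x : 'rV[R]_n | B (x ord0 j)] : set (rV_borel R n))).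
  rewrite -[X in measurable X]setTI; apply: measurable_fst => //.
  by apply: sub_sigma_algebra; exists j, B.
apply/funext => p; rewrite /preimage /rV_cons /=.
by rewrite (row_mxEr (p.2%:M : 'rV[R]_1) p.1).
Qed.

Definition rV_prod_measure (R : realType) (n : nat)
    (nu : {measure set (rV_borel R n) -> \bar R}) :
    set (rV_borel R n.+1) -> \bar R :=
  pushforward (nu \x @lebesgue_measure R)%E (@rV_cons R n).

Section rV_prod_measure_is_measure.
Variables (R : realType) (n : nat).
Variable nu : {measure set (rV_borel R n) -> \bar R}.

Let rV_prod_measure0 : rV_prod_measure nu set0 = 0%E.
Proof. by apply: measure0; exact: measurable_rV_cons. Qed.

Let rV_prod_measure_ge0 A : (0 <= rV_prod_measure nu A)%E.
Proof. by apply: measure_ge0; exact: measurable_rV_cons. Qed.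

Let rV_prod_measure_sigma_additive :
  semi_sigma_additive (rV_prod_measure nu).
Proof.
by apply: measure_semi_sigma_additive; exact: measurable_rV_cons.
Qed.

HB.instance Definition _ := isMeasure.Build _ _ _ (rV_prod_measure nu)
  rV_prod_measure0 rV_prod_measure_ge0 rV_prod_measure_sigma_additive.

End rV_prod_measure_is_measure.

Fixpoint lebesgue_rV_borel (R : realType) (n : nat) :
    {measure set (rV_borel R n) -> \bar R} :=
  match n with
  | 0 => @dirac _ (rV_borel R 0) (0 : 'rV[R]_0) R
  | n'.+1 => rV_prod_measure (lebesgue_rV_borel R n')
  end.

(** Lebesgue measure is the completion of that product: the points of
    [rV_leb] are row vectors, and its measurable sets are the Lebesgue
    measurable ones. *)
Definition rV_leb (R : realType) (n : nat) : measurableType _ :=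
  caratheodory_type ((lebesgue_rV_borel R n)^*)%mu.

Definition mes (R : realType) (n : nat) :
    {measure set (rV_leb R n) -> \bar R} :=
  @completed_measure_extension _ _ _ (lebesgue_rV_borel R n).

Arguments mes {R n}.

(** The norm that the library puts on ['rV_n] is the sup norm, hence the
    explicit Euclidean distance. *)
Definition euclid_dist (R : realType) (n : nat) (x y : 'rV[R]_n) : R :=
  Num.sqrt (\sum_(i < n) (x ord0 i - y ord0 i) ^+ 2).

Definition euclid_dist_set (R : realType) (n : nat) (w : set 'rV[R]_n)
    (x : 'rV[R]_n) : \bar R :=
  ereal_inf [set (euclid_dist x y)%:E | y in w].

Definition tube (R : realType) (n : nat) (w : set 'rV[R]_n) (r : R) :
    set 'rV[R]_n :=
  [set x | (euclid_dist_set w x < r%:E)%E].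

Definition boundary (T : topologicalType) (w : set T) : set T :=
  closure w `\` interior w.

Definition bounded_domain (R : realType) (n : nat) (Omega : set 'rV[R]_n) :=
  [/\ Omega !=set0, open Omega, connected Omega & bounded_set Omega].

Definition finite_dimension (R : realType) (n : nat) (k : R)
    (w : set 'rV[R]_n) :=
  (limf_esup (fun r => mes (tube w r) * ((r `^ (n%:R - k))^-1)%:E) 0^'+
     < +oo)%E.

(** Off [D] the function is given the value [+oo], which does not affect the
    essential infimum. *)
Definition essinf_on (R : realType) (n : nat) (D : set (rV_leb R n))
    (f : rV_leb R n -> R) : \bar R :=
  ess_inf mes (patch (fun=> +oo%E) D (EFin \o f)).

(** The components of a multi-index of order [m] are at most [m]. *)
Definition multi_index (m n : nat) := {ffun 'I_n -> 'I_m.+1}.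

Definition mi_order (m n : nat) (alpha : multi_index m n) : nat :=
  (\sum_(i < n) alpha i)%N.

Definition partial (R : realType) (n : nat) (i : 'I_n)
    (h : 'rV[R]_n -> R) : 'rV[R]_n -> R :=
  'D_(delta_mx ord0 i) h.

Definition mpartial (R : realType) (m n : nat) (alpha : multi_index m n)
    (h : 'rV[R]_n -> R) : 'rV[R]_n -> R :=
  foldr (fun i => iter (alpha i) (partial i)) h (enum 'I_n).

Definition smooth (R : realType) (n : nat) (h : 'rV[R]_n -> R) :=
  forall s : seq 'I_n, let h_s := foldr (@partial R n) h s in
    continuous h_s /\ forall i x, derivable h_s x (delta_mx ord0 i).

(** [C_0^oo(U)], its members being extended by zero to R^n. *)
Definition test_function (R : realType) (n : nat) (U : set 'rV[R]_n)
    (phi : 'rV[R]_n -> R) :=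
  let supp := closure [set x | phi x != 0] in
  [/\ smooth phi, compact supp & supp `<=` U].

(** Derivative relative to [[0, +oo)], i.e. one-sided at 0. *)
Definition dquot (R : realType) (g : R -> R) (x : R) : R -> R :=
  fun y => (g y - g x) / (y - x).

Definition derivable_ge0 (R : realType) (g : R -> R) (x : R) :=
  cvg (dquot g x @ within (fun y : R => 0 <= y) x^').

Definition derive_ge0 (R : realType) (g : R -> R) (x : R) : R :=
  lim (dquot g x @ within (fun y : R => 0 <= y) x^').

Definition C2_ge0 (R : realType) (g : R -> R) :=
  [/\ forall x, 0 <= x -> derivable_ge0 g x,
      forall x, 0 <= x -> derivable_ge0 (derive_ge0 g) x
    & {within `[0, +oo[, continuous (derive_ge0 (derive_ge0 g))}].

Definition nonlinearity (R : realType) (g : R -> R) :=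
  [/\ C2_ge0 g, forall z, 0 <= z -> 0 <= g z, g 0 = 0
    & forall z, 0 < z ->
        [/\ 0 < g z, 0 < derive_ge0 g z & 0 < derive_ge0 (derive_ge0 g) z]].

(** ['pinv_] is the inverse of a function restricted to a set; the default
    value 0 is taken outside of the image of that set. *)
Definition legendre (R : realType) (g : R -> R) (xi : R) : \bar R :=
  if derive_ge0 g 0 < xi then
    (\int[lebesgue_measure]_(z in `[derive_ge0 g 0, xi])
       ('pinv_(fun=> 0) `[0, +oo[ (derive_ge0 g) z)%:E)%E
  else 0%E.

Definition gamma (R : realType) (g : R -> R) (xi : R) : \bar R :=
  (legendre g xi * (xi^-1)%:E)%E.

(** [gamma (1 / y)], with value [+oo] at [y = 0]. *)
Definition gamma_inv (R : realType) (g : R -> R) (y : R) : \bar R :=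
  if y == 0 then +oo%E else gamma g y^-1.

(** The infimum is meant for [0 < xi]. *)
Definition mu (R : realType) (g : R -> R) (xi : R) : R :=
  inf [set g t / t | t in `[xi, +oo[].

Definition G (R : realType) (m : nat) (g : R -> R) (t : R) : \bar R :=
  (\int[lebesgue_measure]_(z in `]t, +oo[)
     (g z `^ (- m%:R^-1) * z `^ (m%:R^-1 - 1))%:E)%E.

(** [Ginv] at 0 is [+oo] by convention. Its value at [+oo] is the default 0 of
    ['pinv_] as soon as [G] is finite on the positive half-line; the argument
    [+oo] only occurs for an empty singular set. *)
Definition Ginv (R : realType) (m : nat) (g : R -> R) (y : \bar R) : \bar R :=
  if y == 0%E then +oo%E else ('pinv_(fun=> 0) `]0, +oo[ (G m g) y)%:E.

Definition caratheodory_function (R : realType) (n : nat)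
    (Omega : set 'rV[R]_n) (a : 'rV[R]_n -> R -> R) :=
  (forall z, measurable_fun (Omega : set (rV_leb R n)) (a ^~ z)) /\
  {ae @mes R n, forall x, Omega x -> continuous (a x)}.

Definition weak_inequality (R : realType) (m n : nat)
    (Omega : set 'rV[R]_n) (a : multi_index m n -> 'rV[R]_n -> R -> R)
    (f : 'rV[R]_n -> R) (g : R -> R) (U : set 'rV[R]_n) (u : 'rV[R]_n -> R) :=
  forall phi : 'rV[R]_n -> R, test_function U phi ->
    (forall x, 0 <= phi x) ->
    (\int[@mes R n]_(x in Omega)
        (\sum_(alpha : multi_index m n | mi_order alpha == m)
           (-1) ^+ m * a alpha x (u x) * mpartial alpha phi x)%:E
     >= \int[@mes R n]_(x in Omega) (f x * g `|u x| * phi x)%:E)%E.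

Definition L1 (R : realType) (n : nat) (D : set 'rV[R]_n)
    (h : 'rV[R]_n -> R) :=
  (@mes R n).-integrable D (EFin \o h).

Definition weak_solution (R : realType) (m n : nat) (Omega S : set 'rV[R]_n)
    (a : multi_index m n -> 'rV[R]_n -> R -> R)
    (f : 'rV[R]_n -> R) (g : R -> R) (u : 'rV[R]_n -> R) :=
  (forall r, 0 < r -> L1 (Omega `\` tube S r) u /\
     L1 (Omega `\` tube S r) (fun x => f x * g `|u x|)) /\
  weak_inequality Omega a f g (Omega `\` S) u.

(** Here [u \_ (~` S)] is [u] extended by zero to [S]. *)
Definition removable (R : realType) (m n : nat) (Omega S : set 'rV[R]_n)
    (a : multi_index m n -> 'rV[R]_n -> R -> R)
    (f : 'rV[R]_n -> R) (g : R -> R) (u : 'rV[R]_n -> R) :=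
  let u0 := u \_ (~` S) in
  [/\ L1 Omega u0, L1 Omega (fun x => f x * g `|u0 x|)
    & weak_inequality Omega a f g Omega u0].

(* Main.v *)
(* Write J(r) for the integral of f g(|u|) over S_R \ S_r.  Testing the weak
   inequality with differences of cutoffs of the tubes around S gives
     J(r2) <= K (r2 - r1)^{-m} int_{S_{r2} \ S_{r1}} |u| + K0.
   The shell lies in a tube around the boundary of S, so its measure is at most
   D r^{n-k}, and Jensen's inequality for g bounds the integral of |u| over it by
   the increment of J.  Iterating with s doubled at each step along the levels
   J = F^m M g(s), the function J would be infinite at a positive radius unless
   G(s / 2) >= c r F, where F^m is the essential infimum of f; the first limit
   condition thus bounds J, so f g(|u|) is integrable.  Young's inequality with
   the weight gamma(1 / f) then makes u integrable, and the second limit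
   condition, again with Jensen, gives int_{S_r \ S} |u| = o(r^m), which kills the
   terms produced by the derivatives of the cutoff of a shrinking tube. *)
Require Import Defs.
From HB Require Import structures.
From mathcomp Require Import all_boot all_order all_algebra.
From mathcomp Require Import all_classical all_reals all_analysis.
From mathcomp Require Import measurable_realfun ess_sup_inf ring lra.
Set Implicit Arguments.
Unset Strict Implicit.
Unset Printing Implicit Defensive.

Import Order.TTheory GRing.Theory Num.Theory.
Import numFieldNormedType.Exports.

Local Open Scope classical_set_scope.
Local Open Scope ring_scope.

(** A priori [u] is controlled only away from [S], so test functions must vanish near [S], and the
    iteration runs inwards: a large value of J at one radius would force a blow-up at a positive
    radius, where J is known to be finite. Passing from level s to level 2 s costs a radius of order
    (s / g(s))^(1/m) / F. The integrand of [G] is (z / g(z))^(1/m) / z, which decreases, so the sum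
    of these costs over the dyadic levels is comparable with [G]; this is where [G] comes from. The
    convergence of [G] has a second effect: it makes g' unbounded, so that its inverse is defined on
    all of [g'(0), +oo[ and Young's inequality holds for every argument. The cutoffs need bounds on
    derivatives of every order that scale with the width of the shell and depend neither on [S] nor
    on the radii. The distance to [S] is merely Lipschitz, so they are assembled from translates of
    an explicit bump. Degenerate essential infima are treated apart: the value 0 contradicts the
    first limit condition through the convention for [Ginv], and the value +oo forces the shells to
    be null. *)

(** * Flat functions at the origin and derivatives of all orders on the line *)

Lemma is_derive_quadratic (R : realType) (f : R -> R) (x C : R) :
  (forall h, `|f (h + x) - f x| <= C * h ^+ 2) -> is_derive x 1 f 0.
Proof.
move=> fC.
have C0 : 0 <= C by have := le_trans (normr_ge0 _) (fC 1); rewrite expr1n mulr1.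
have lim0 : (fun h : R => h^-1 *: (f (h *: 1 + x) - f x)) @ 0^' --> (0 : R).
  apply/norm_cvg0P.
  have : (fun h : R => C * `|h|) @ 0^' --> (0 : R).
    rewrite -[X in _ --> X](mulr0 C); apply: cvgM; first exact: cvg_cst.
    rewrite -[X in _ --> X](normr0 R).
    apply: cvg_within_filter; apply: (@norm_continuous R R^o 0).
  apply: squeeze_cvgr (cvg_cst 0).
  near=> h; rewrite normr_ge0/=.
  have h0 : h != 0 by near: h; exact: nbhs_dnbhs_neq.
  rewrite normrZ normfV ler_pdivrMl ?normr_gt0// mulrCA -normrM -expr2.
  rewrite ger0_norm ?sqr_ge0//.
  by have := fC h; rewrite [h *: 1]mulr1.
apply: DeriveDef; first exact: cvgP lim0.
exact: cvg_lim lim0.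
Unshelve. all: by end_near. Qed.

Lemma expRN_horner_bounded (R : realType) (p : {poly R}) :
  exists C, forall s : R, 0 <= s -> `|p.[s] * expR (- s)| <= C.
Proof.
exists (\sum_(i < size p) `|p`_i| * (i.+1)`!%:R) => s s0.
rewrite horner_coef mulr_suml; apply: (le_trans (ler_norm_sum _ _ _)).
apply: ler_sum => i _; rewrite -mulrA normrM ler_wpM2l//.
rewrite ger0_norm ?mulr_ge0 ?exprn_ge0 ?expR_ge0//.
rewrite expRN ler_pdivrMr ?expR_gt0//.
case: i => -[|i] /= _.
  rewrite expr0 mul1r; have := expR_ge1Dx s; lra.
have := expR_ge1Dxn i s0.
have f1 : (1 : R) <= (i.+1)`!%:R by rewrite ler1n fact_gt0.
have f0 : (0 : R) < (i.+1)`!%:R by rewrite (lt_le_trans ltr01).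
move=> h; have {h} : s ^+ i.+1 / (i.+1)`!%:R <= expR s by lra.
rewrite ler_pdivrMr// mulrC => /le_trans; apply.
by rewrite ler_wpM2r ?expR_ge0// ler_nat leq_pmull.
Qed.

(** Keeping [p] general makes the class closed under differentiation, [p] being replaced by X^2 (p -
    p'). With [p = 1] alone the induction on the order of the derivative would not close. *)
Definition expRNV (R : realType) (p : {poly R}) (t : R) : R :=
  if 0 < t then p.[t^-1] * expR (- t^-1) else 0.

Lemma is_derive_expRNV (R : realType) (p : {poly R}) (t : R) :
  is_derive t 1 (expRNV p) (expRNV ('X^2 * (p - p^`())) t).
Proof.
have [t0|t0|->] := ltgtP t 0.
- rewrite [X in is_derive _ _ _ X]/expRNV ltNge (ltW t0)/=.
  apply: (@near_eq_is_derive _ _ _ (cst 0)).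
  near=> s; rewrite /expRNV ltNge ltW//=.
  by near: s; exact: lt_nbhsl.
- rewrite [X in is_derive _ _ _ X]/expRNV t0.
  have pE : \near t, p.[t^-1] * expR (- t^-1) = expRNV p t.
    near=> s; rewrite /expRNV ifT//.
    by near: s; exact: lt_nbhsr.
  have dV : is_derive t 1 (fun s : R => s^-1) (- t ^- 2).
    have := @is_deriveV _ id t 1 1 (lt0r_neq0 t0) (is_derive_id _ _).
    by rewrite /= [_ *: _]mulr1.
  have dp := @is_derive1_comp _ (horner p) _ t _ _ (is_derive_poly _ _) dV.
  have de := @is_derive1_comp _ (fun x => expR (- x)) _ t _ _
    (@is_derive1_comp _ expR -%R _ _ _ (is_derive_expR _) (is_deriveNid _ _)) dV.
  have := is_deriveM dp de; rewrite /= !hornerE/= => d.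
  apply: (near_eq_is_derive pE); apply: is_derive_eq d _; rewrite /GRing.scale/=.
  rewrite exprVn; ring.
- rewrite [X in is_derive _ _ _ X]/expRNV ltxx.
  (* The factor ['X^2] absorbs a division by [h ^+ 2], so the uniform bound becomes the quadratic
     decay that makes the derivative vanish at 0. *)
  have [C CP] := expRN_horner_bounded ('X^2 * p).
  apply: (@is_derive_quadratic _ _ _ C) => h.
  rewrite /expRNV ltxx subr0 addr0.
  case: ifPn => [h0|_]; last first.
    rewrite normr0 mulr_ge0 ?sqr_ge0//.
    exact: le_trans (normr_ge0 _) (CP 0 (lexx _)).
  have := CP h^-1; rewrite invr_ge0 (ltW h0) => /(_ isT).
  rewrite hornerM hornerXn -mulrA normrM ger0_norm ?sqr_ge0// exprVn.
  by rewrite ler_pdivrMl ?exprn_gt0// [_ * C]mulrC.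
Unshelve. all: by end_near. Qed.

(** Finite orders make the closure properties below inductions on [n]; smoothness is the statement
    for every [n]. *)
Fixpoint nderivable (R : realType) (n : nat) (h : R -> R) : Prop :=
  if n is n'.+1 then (forall x, derivable h x 1) /\ nderivable n' h^`()%classic
  else True.

(** * A smooth bump function *)

Section nderivable_theory.
Variable R : realType.
Implicit Types (f g : R -> R) (n : nat).

Lemma nderivableS n f : nderivable n.+1 f -> nderivable n f.
Proof. by elim: n f => [//|n IH] f [df /IH]. Qed.

Lemma nderivable_derive n f g : (forall x, is_derive (x : R) 1 f (g x)) ->
  nderivable n g -> nderivable n.+1 f.
Proof.
move=> fg ng; split=> [x|]; first by have [] := fg x.
rewrite (_ : f^`()%classic = g)//; apply/funext => x; rewrite derive1E.
by have [] := fg x.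
Qed.

Lemma nderivable_is_derive n f (x : R) : nderivable n.+1 f ->
  is_derive x 1 f (f^`()%classic x).
Proof. by case=> df _; apply: DeriveDef => //; rewrite derive1E. Qed.

Lemma nderivable_cst n (c : R) : nderivable n (cst c).
Proof.
elim: n c => [//|n IH] c; by apply: (@nderivable_derive _ _ (cst 0)).
Qed.

Lemma nderivableD n f g : nderivable n f -> nderivable n g ->
  nderivable n (f \+ g).
Proof.
elim: n f g => [//|n IH] f g nf ng.
apply: (@nderivable_derive _ _ (f^`()%classic \+ g^`()%classic)); last exact: IH nf.2 ng.2.
by move=> x; exact: (is_deriveD (nderivable_is_derive x nf) (nderivable_is_derive x ng)).
Qed.

Lemma nderivableM n f g : nderivable n f -> nderivable n g ->
  nderivable n (f \* g).
Proof.
elim: n f g => [//|n IH] f g nf ng.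
apply: (@nderivable_derive _ _ ((f \* g^`()%classic) \+ (g \* f^`()%classic))).
  by move=> x; exact: (is_deriveM (nderivable_is_derive x nf) (nderivable_is_derive x ng)).
apply: nderivableD; apply: IH; by [exact: nderivableS|case: nf|case: ng].
Qed.

Lemma nderivableV n f : (forall x, f x != 0) -> nderivable n f ->
  nderivable n (fun x => (f x)^-1).
Proof.
move=> f0; elim: n f f0 => [//|n IH] f f0 nf.
have nV := IH _ f0 (nderivableS nf).
apply: (@nderivable_derive _ _ (fun x => (-1 * ((f x)^-1 * (f x)^-1)) * f^`()%classic x)).
  move=> x; have := is_deriveV (f0 x) (nderivable_is_derive x nf).
  by move/is_derive_eq; apply; rewrite /GRing.scale/= mulN1r -invfM.
apply: (@nderivableM _ (fun x => _)) nf.2.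
apply: (@nderivableM _ (cst (-1)) (fun x => _)); first exact: nderivable_cst.
exact: (@nderivableM _ (fun x => _) (fun x => _)).
Qed.

Lemma nderivable_affine n f (a b : R) : nderivable n f ->
  nderivable n (fun x => f (a * x + b)).
Proof.
elim: n f => [//|n IH] f nf.
apply: (@nderivable_derive _ _ (fun x => a * f^`()%classic (a * x + b))).
  move=> x; have da : is_derive x 1 (fun y : R => a * y + b) a.
    apply: is_derive_eq; rewrite /GRing.scale/=; ring.
  have := @is_derive1_comp _ f _ x _ _ (nderivable_is_derive _ nf) da.
  by move/is_derive_eq; apply; rewrite mulrC.
apply: (@nderivableM _ (cst a) (fun x => _)); first exact: nderivable_cst.
exact: IH nf.2.
Qed.

Lemma nderivable_expRNV n (p : {poly R}) : nderivable n (expRNV p).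
Proof.
elim: n p => [//|n IH] p.
by apply: nderivable_derive (IH _) => x; exact: is_derive_expRNV.
Qed.

Lemma nderivable_derive1n n f (x : R) : (forall k, nderivable k f) ->
  is_derive x 1 f^`(n)%classic (f^`(n.+1)%classic x).
Proof.
move=> sf; rewrite derive1nS; apply: (@nderivable_is_derive 0).
elim: n f sf => [|n IH] f sf; first exact: sf.
by rewrite derive1Sn; apply: IH => k; exact: (sf k.+1).2.
Qed.

End nderivable_theory.

Definition smooth_step (R : realType) (t : R) : R :=
  expRNV 1 t / (expRNV 1 t + expRNV 1 (1 - t)).

Lemma expRNV1_ge0 (R : realType) (t : R) : 0 <= expRNV 1 t.
Proof. by rewrite /expRNV; case: ifP => // _; rewrite hornerE mul1r expR_ge0. Qed.

Lemma smooth_step_denom (R : realType) (t : R) :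
  0 < expRNV 1 t + expRNV 1 (1 - t).
Proof.
have [t0|t0] := ltP 0 t.
  by rewrite ltr_wpDr ?expRNV1_ge0// /expRNV t0 hornerE mul1r expR_gt0.
rewrite ltr_wpDl ?expRNV1_ge0// /expRNV ifT; last lra.
by rewrite hornerE mul1r expR_gt0.
Qed.

Lemma nderivable_smooth_step (R : realType) n : nderivable n (@smooth_step R).
Proof.
have e := nderivable_expRNV n (1 : {poly R}).
apply: (@nderivableM _ _ (expRNV 1) (fun x => _)) => //.
apply: (@nderivableV _ _ (fun x => _)).
  by move=> x; rewrite gt_eqF// smooth_step_denom.
apply: (@nderivableD _ _ (expRNV 1) (fun x => _)) => //.
rewrite (_ : (fun x : R => _) = fun x => expRNV 1 (-1 * x + 1)).
  exact: nderivable_affine.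
by apply/funext => x; congr expRNV; ring.
Qed.

Lemma smooth_step0 (R : realType) (t : R) : t <= 0 -> smooth_step t = 0.
Proof. by move=> t0; rewrite /smooth_step /expRNV ltNge t0/= mul0r. Qed.

Lemma smooth_step1 (R : realType) (t : R) : 1 <= t -> smooth_step t = 1.
Proof.
move=> t1; have := smooth_step_denom t; rewrite /smooth_step.
rewrite [X in _ + X]/expRNV ifF; last by apply/negbTE; rewrite -leNgt; lra.
by rewrite addr0 => /lt0r_neq0 /divff.
Qed.

Lemma smooth_step_itv (R : realType) (t : R) : 0 <= smooth_step t <= 1.
Proof.
have d := smooth_step_denom t.
have h := expRNV1_ge0 t; have h' := expRNV1_ge0 (1 - t).
rewrite /smooth_step divr_ge0 ?(ltW d)//= ler_pdivrMr// mul1r; lra.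
Qed.

(** As a difference of two steps at distance 1, it has integer translates that telescope, which
    yields a partition of unity without normalisation. The factor [1 *] gives the argument the shape
    expected by [nderivable_affine]. *)
Definition bump (R : realType) (t : R) : R :=
  smooth_step (1 * t + 1) - smooth_step t.

Lemma nderivable_bump (R : realType) n : nderivable n (@bump R).
Proof.
apply: (@nderivableD _ _ (fun x => _) (fun x => _)).
  exact/nderivable_affine/nderivable_smooth_step.
rewrite (_ : (fun x : R => _) = fun x => -1 * smooth_step x).
  apply: (@nderivableM _ _ (cst (-1)) (fun x => _)) => //.
  - exact: nderivable_cst.
  - exact: nderivable_smooth_step.
by apply/funext => x; rewrite mulN1r.
Qed.

Lemma bump_ge0 (R : realType) (t : R) : 0 <= bump t.
Proof.
rewrite /bump mul1r; have [t0|t0] := leP t 0.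
  by rewrite (smooth_step0 t0) subr0; case/andP: (smooth_step_itv (t + 1)).
rewrite (@smooth_step1 _ (t + 1)); last lra.
by have := smooth_step_itv t; lra.
Qed.

Lemma bump_out (R : realType) (t : R) : 1 <= `|t| -> bump t = 0.
Proof.
rewrite /bump mul1r ler_normr => /orP[t1|t1].
  by rewrite !smooth_step1 ?subrr//; lra.
by rewrite !smooth_step0 ?subrr//; lra.
Qed.

Lemma bump_derive_out (R : realType) k (t : R) : 1 < `|t| -> (@bump R)^`(k)%classic t = 0.
Proof.
elim: k t => [|k IH] t t1; first by rewrite derive1n0 bump_out// ltW.
rewrite derive1nS derive1E (@near_eq_derive _ _ _ _ (cst 0)) ?derive_cst//.
have : (fun s : R => `|s|) @ t --> `|t| by exact: (@norm_continuous R R^o).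
move/cvgr_gt => /(_ _ t1); apply: filterS => s; exact: IH.
Qed.

Lemma bump_derive_bounded (R : realType) k :
  exists C, forall t : R, `|(@bump R)^`(k)%classic t| <= C.
Proof.
have cb : continuous (@bump R)^`(k)%classic.
  move=> x; apply/differentiable_continuous/derivable1_diffP.
  by have [] := nderivable_derive1n k x (@nderivable_bump R).
have cn : {within `[(-1 : R), 1], continuous (fun t => `|(@bump R)^`(k)%classic t|)}.
  apply: continuous_subspaceT => x.
  apply: (continuous_comp (cb x)); exact: (@norm_continuous R R^o).
have le11 : (-1 : R) <= 1 by lra.
have [c _ cP] := EVT_max le11 cn.
exists (`|(@bump R)^`(k)%classic c|) => t; have [t1|t1] := leP `|t| 1.
  by apply: cP; rewrite in_itv/= -ler_norml.
by rewrite bump_derive_out// normr0.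
Qed.

Lemma sum_bump (R : realType) (N : nat) (y : R) :
  \sum_(z < N) bump (y - z%:R) = smooth_step (y + 1) - smooth_step (y + 1 - N%:R).
Proof.
elim: N => [|N IH]; first by rewrite big_ord0 subr0 subrr.
rewrite big_ord_recr/= IH /bump mul1r.
have -> : y - N%:R + 1 = y + 1 - N%:R by ring.
have -> : y - N%:R = y + 1 - N.+1%:R by rewrite -natr1; ring.
ring.
Qed.

(* The indicator of [-1, 1] is dominated by the increment over a unit step of
   the clamp of t + 1 to [0, 3], so the sum below telescopes. *)
Lemma sum_translates_le3 (R : realType) (N : nat) (y : R) (h : R -> R) (C : R) :
  0 <= C -> (forall t, `|h t| <= C) -> (forall t, 1 < `|t| -> h t = 0) ->
  \sum_(z < N) `|h (y - z%:R)| <= C * 3.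
Proof.
move=> C0 hC h0.
pose L (t : R) := Num.min 3 (Num.max 0 (t + 1)).
have hL t : `|h t| <= C * (L (t + 1) - L t).
  have [t1|t1] := ltP 1 `|t|.
    rewrite h0// normr0 mulr_ge0// subr_ge0 /L.
    rewrite /Num.min /Num.max; repeat case: ifPn; lra.
  apply: (le_trans (hC t)); rewrite -[leLHS]mulr1 ler_wpM2l//.
  move: t1; rewrite ler_norml /L /Num.min /Num.max; repeat case: ifPn; lra.
apply: (@le_trans _ _ (C * (L (y + 1) - L (y + 1 - N%:R)))).
  elim: N => [|N IH]; first by rewrite big_ord0 subr0 subrr mulr0.
  rewrite big_ord_recr/=; have := hL (y - N%:R).
  have -> : y - N%:R + 1 = y + 1 - N%:R by ring.
  have -> : y - N%:R = y + 1 - N.+1%:R by rewrite -natr1; ring.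
  move: IH; rewrite !mulrBr; lra.
apply: ler_wpM2l => //; rewrite /L /Num.min /Num.max; repeat case: ifPn; lra.
Qed.

(** * Iterated partial derivatives along words of directions *)

Section iterated_partial.
Variables (R : realType) (n : nat).
Implicit Types (h f g : 'rV[R]_n -> R) (s : seq 'I_n).

(** Indexing derivatives by words of directions makes each rule an induction on one more letter;
    [mpartialE] converts a multi-index into such a word. *)
Definition partials s h : 'rV[R]_n -> R := foldr (@partial R n) h s.

Lemma smooth_continuous h s : smooth h -> continuous (partials s h).
Proof. by case/(_ s). Qed.

Lemma smooth_is_derive h s i x : smooth h ->
  is_derive x (delta_mx ord0 i) (partials s h) (partials (i :: s) h x).
Proof. by case/(_ s) => _ /(_ i x) dh; exact: (DeriveDef dh erefl). Qed.

(** Smoothness by guessing all derivatives at once: a continuous family indexed by words and closed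
    under one more derivative is the family of iterated partials. The rules for sums, products and
    tensor products below are instances. *)
Lemma smooth_of_partials h (d : seq 'I_n -> 'rV[R]_n -> R) :
  d [::] = h -> (forall s, continuous (d s)) ->
  (forall s i x, is_derive x (delta_mx ord0 i) (d s) (d (i :: s) x)) ->
  smooth h /\ forall s, partials s h = d s.
Proof.
move=> dh dc dd.
have E s : partials s h = d s.
  elim: s => [//|i s IH]; apply/funext => x; rewrite /= IH /partial.
  by have [_ ->] := dd s i x.
split=> // s h_s; rewrite /h_s -/(partials s h) E; split => //.
Qed.

Lemma is_derive_sumr (V : normedModType R) (I : Type) (r : seq I) (P : pred I)
    (F : I -> V -> R) (dF : I -> R) (x v : V) :
  (forall i, P i -> is_derive x v (F i) (dF i)) ->
  is_derive x v (fun y => \sum_(i <- r | P i) F i y) (\sum_(i <- r | P i) dF i).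
Proof.
move=> dP; elim: r => [|i r IH].
  rewrite big_nil (_ : (fun _ => _) = cst 0); first exact: is_derive_cst.
  by apply/funext => y; rewrite big_nil.
rewrite big_cons; case: ifPn => Pi.
  rewrite (_ : (fun _ => _) = F i \+ (fun y => \sum_(i <- r | P i) F i y)).
    exact: (is_deriveD (dP i Pi) IH).
  by apply/funext => y; rewrite big_cons Pi.
rewrite (_ : (fun _ => _) = (fun y => \sum_(i <- r | P i) F i y))//.
by apply/funext => y; rewrite big_cons (negbTE Pi).
Qed.

Lemma continuous_sumr (V : topologicalType) (I : Type) (r : seq I) (P : pred I)
    (F : I -> V -> R) :
  (forall i, P i -> continuous (F i)) ->
  continuous (fun y => \sum_(i <- r | P i) F i y).
Proof.
move=> cF x; elim: r => [|i r IH].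
  rewrite (_ : (fun _ => _) = cst 0); first exact: cst_continuous.
  by apply/funext => y; rewrite big_nil.
have [Pi|Pi] := boolP (P i).
  rewrite (_ : (fun _ => _) = F i \+ (fun y => \sum_(i <- r | P i) F i y)).
    apply: cvgD; [exact: cF|exact: IH].
  by apply/funext => y; rewrite big_cons Pi.
rewrite (_ : (fun _ => _) = (fun y => \sum_(i <- r | P i) F i y))//.
by apply/funext => y; rewrite big_cons (negbTE Pi).
Qed.

Lemma smooth_sumr (I : Type) (r : seq I) (P : pred I)
    (F : I -> 'rV[R]_n -> R) : (forall i, P i -> smooth (F i)) ->
  smooth (fun x => \sum_(i <- r | P i) F i x) /\
  forall s, partials s (fun x => \sum_(i <- r | P i) F i x) =
    (fun x => \sum_(i <- r | P i) partials s (F i) x).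
Proof.
move=> sF; apply: (@smooth_of_partials _
  (fun s x => \sum_(i <- r | P i) partials s (F i) x)) => // s.
  by apply: continuous_sumr => i Pi; exact: smooth_continuous (sF i Pi).
move=> i x; apply: is_derive_sumr => j Pj; exact: smooth_is_derive (sF j Pj).
Qed.

(** All ways of distributing the letters of [s] over two factors, counted with multiplicity: the
    terms of the Leibniz rule, where repetitions replace the binomial coefficients. *)
Fixpoint splits s : seq (seq 'I_n * seq 'I_n) :=
  if s is i :: s' then
    [seq (i :: p.1, p.2) | p <- splits s'] ++
    [seq (p.1, i :: p.2) | p <- splits s']
  else [:: ([::], [::])].

Lemma smoothM f g : smooth f -> smooth g ->
  smooth (fun x => f x * g x) /\
  forall s, partials s (fun x => f x * g x) =
    (fun x => \sum_(p <- splits s) partials p.1 f x * partials p.2 g x).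
Proof.
move=> sf sg; apply: (@smooth_of_partials _ (fun s x =>
    \sum_(p <- splits s) partials p.1 f x * partials p.2 g x)).
- by apply/funext => x; rewrite big_seq1.
- move=> s; apply: continuous_sumr => p _ x.
  exact: cvgM (@smooth_continuous _ p.1 sf x) (@smooth_continuous _ p.2 sg x).
- move=> s i x; rewrite big_cat/= !big_map/= -big_split/=.
  apply: is_derive_sumr => p _.
  have := is_deriveM (@smooth_is_derive _ p.1 i x sf) (@smooth_is_derive _ p.2 i x sg).
  by move/is_derive_eq; apply; rewrite addrC /GRing.scale/=; congr (_ + _); rewrite mulrC.
Qed.

Lemma smoothD f g : smooth f -> smooth g ->
  smooth (fun x => f x + g x) /\
  forall s, partials s (fun x => f x + g x) =
    (fun x => partials s f x + partials s g x).
Proof.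
move=> sf sg; apply: (@smooth_of_partials _ (fun s x =>
    partials s f x + partials s g x)) => // s.
  by move=> x; exact: cvgD (@smooth_continuous _ s sf x) (@smooth_continuous _ s sg x).
move=> i x; exact: (is_deriveD (@smooth_is_derive _ s i x sf) (@smooth_is_derive _ s i x sg)).
Qed.

Lemma smoothN f : smooth f ->
  smooth (fun x => - f x) /\
  forall s, partials s (fun x => - f x) = (fun x => - partials s f x).
Proof.
move=> sf; apply: (@smooth_of_partials _ (fun s x => - partials s f x)) => // s.
  by move=> x; exact: cvgN (@smooth_continuous _ s sf x).
move=> i x; exact: (is_deriveN (@smooth_is_derive _ s i x sf)).
Qed.

Lemma smooth_cst (c : R) : smooth (fun _ : 'rV[R]_n => c) /\
  forall s, partials s (fun _ : 'rV[R]_n => c) =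
    (fun _ => if s is [::] then c else 0).
Proof.
apply: (@smooth_of_partials _ (fun s _ => if s is [::] then c else 0)) => // s.
exact: cst_continuous.
Qed.

Lemma partials_eq_open (U : set 'rV[R]_n) f g s x : open U ->
  (forall y, U y -> f y = g y) -> U x -> partials s f x = partials s g x.
Proof.
move=> oU fg; elim: s x => [|i s IH] x Ux; first exact: fg.
apply: near_eq_derive; near=> y; apply: IH; near: y.
exact: open_nbhs_nbhs.
Unshelve. all: by end_near. Qed.

Definition mi_seq (m : nat) (alpha : multi_index m n) : seq 'I_n :=
  flatten [seq nseq (alpha i) i | i <- enum 'I_n].

Lemma mpartialE m (alpha : multi_index m n) h :
  mpartial alpha h = partials (mi_seq alpha) h.
Proof.
rewrite /mpartial /partials /mi_seq.
elim: (enum 'I_n) => [//|i r IH] /=; rewrite IH foldr_cat.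
by elim: (nat_of_ord (alpha i)) => [//|k IHk] /=; rewrite IHk.
Qed.

Lemma size_mi_seq m (alpha : multi_index m n) :
  size (mi_seq alpha) = mi_order alpha.
Proof.
rewrite /mi_seq /mi_order size_flatten /shape -map_comp sumnE big_map.
by rewrite big_enum/=; apply: eq_bigr => i _; rewrite size_nseq.
Qed.

Lemma size_splits s p : p \in splits s -> (size p.1 + size p.2 = size s)%N.
Proof.
elim: s p => [|i s IH] p /=; first by rewrite inE => /eqP->.
by rewrite mem_cat => /orP[] /mapP[q /IH <- ->]/=; rewrite ?addnS.
Qed.

End iterated_partial.

(** * Products of functions of single coordinates *)

Section tensor.
Variables (R : realType) (n : nat).

Definition tensor (h : 'I_n -> R -> R) (x : 'rV[R]_n) : R :=
  \prod_i h i (x ord0 i).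

Lemma is_derive_tensor (h dh : 'I_n -> R -> R) (j : 'I_n)
    (x : 'rV[R]_n) :
  is_derive (x ord0 j) 1 (h j) (dh j (x ord0 j)) ->
  is_derive x (delta_mx ord0 j) (tensor h)
    (tensor (fun i => if i == j then dh i else h i) x).
Proof.
move=> dhj; set P := \prod_(i | i != j) h i (x ord0 i).
have -> : tensor (fun i => if i == j then dh i else h i) x = P * dh j (x ord0 j).
  rewrite /tensor (bigD1 j)//= eqxx mulrC; congr (_ * _).
  by apply: eq_bigr => i /negbTE ->.
have E : (fun t : R => t^-1 *: (tensor h (t *: delta_mx ord0 j + x) - tensor h x)) =
    (fun t => P * (t^-1 *: (h j (t *: 1 + x ord0 j) - h j (x ord0 j)))).
  apply/funext => t; rewrite /GRing.scale/= mulrCA; congr (_ * _).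
  rewrite /tensor (bigD1 j)//= [X in _ - X](bigD1 j)//= !mxE !eqxx/=.
  rewrite (eq_bigr (fun i => h i (x ord0 i))); last first.
    by move=> i ij; rewrite !mxE eqxx/= (negbTE ij) mulr0 add0r.
  by rewrite -/P mulrBr !(mulrC P).
have c : (fun t : R => t^-1 *: (tensor h (t *: delta_mx ord0 j + x) - tensor h x)) @ 0^'
    --> P * dh j (x ord0 j).
  rewrite E; apply: cvgMl_tmp; have [d1 d2] := dhj.
  by move: d1 => /cvgP; rewrite -d2.
by apply: DeriveDef; [exact: cvgP c|exact: cvg_lim c].
Qed.

Lemma continuous_tensor (h : 'I_n -> R -> R) :
  (forall i, continuous (h i)) -> continuous (tensor h).
Proof.
move=> hc x; rewrite /tensor; elim: (index_enum _) => [|i r IH].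
  rewrite (_ : (fun _ => _) = cst 1); first exact: cst_continuous.
  by apply/funext => y; rewrite big_nil.
rewrite (_ : (fun _ => _) =
    (fun y : 'rV[R]_n => h i (y ord0 i) * \prod_(i <- r) h i (y ord0 i))).
  have ci : {for x, continuous (fun y : 'rV[R]_n => h i (y ord0 i))}.
    apply: (@continuous_comp _ _ _ (fun y : 'rV[R]_n => y ord0 i) (h i)).
      exact: coord_continuous.
    exact: hc.
  exact: cvgM ci IH.
by apply/funext => y; rewrite big_cons.
Qed.

Lemma smooth_tensor (h : 'I_n -> R -> R) :
  (forall i k, nderivable k (h i)) ->
  smooth (tensor h) /\ forall s, partials s (tensor h) =
    tensor (fun i => (h i)^`(count_mem i s)%classic).
Proof.
move=> sh; apply: smooth_of_partials => // s.
  apply: continuous_tensor => i x; apply/differentiable_continuous.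
  by apply/derivable1_diffP; have [] := nderivable_derive1n (count_mem i s) x (sh i).
move=> j x; have d := nderivable_derive1n (count_mem j s) (x ord0 j) (sh j).
have := is_derive_tensor
  (dh := fun i => (h i)^`((count_mem i s).+1)%classic)
  (h := fun i => (h i)^`(count_mem i s)%classic) d.
move/is_derive_eq; apply; apply: eq_bigr => i _ /=.
by rewrite eq_sym; case: eqVneq => _.
Qed.
End tensor.

Lemma derive1n_affine (R : realType) (f : R -> R) (a b : R) k :
  (forall k, nderivable k f) ->
  (fun x => f (a * x + b))^`(k)%classic =
  (fun x => a ^+ k * f^`(k)%classic (a * x + b)).
Proof.
move=> sf; elim: k => [|k IH].
  by apply/funext => x; rewrite expr0 mul1r.
rewrite derive1nS IH; apply/funext => x; rewrite derive1E.
have da : is_derive x 1 (fun y : R => a * y + b) a.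
  apply: is_derive_eq; rewrite /GRing.scale/=; ring.
have d := @is_derive1_comp _ (f^`(k))%classic _ x _ _
  (nderivable_derive1n k _ sf) da.
have [_ ->] := is_deriveZ (a ^+ k) d.
by rewrite /GRing.scale/= exprSr; ring.
Qed.

(** * Cutoffs of tubular neighbourhoods *)

Section euclid.
Variables (R : realType) (n : nat).
Implicit Types (x y z : 'rV[R]_n) (w S : set 'rV[R]_n).

Lemma tubeP w (r : R) x : tube w r x <-> exists2 y, w y & euclid_dist x y < r.
Proof.
rewrite /tube /euclid_dist_set /=; split.
  by move/ereal_inf_lt => [_ [y wy <-]]; rewrite lte_fin; exists y.
move=> [y wy xy]; apply: (@le_lt_trans _ _ (euclid_dist x y)%:E).
  by apply: ereal_inf_lbound; exists y.
by rewrite lte_fin.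
Qed.

Lemma tubeS w (r1 r2 : R) : r1 <= r2 -> tube w r1 `<=` tube w r2.
Proof. by move=> r12 x /tubeP[y wy xy]; apply/tubeP; exists y => //; lra. Qed.

Lemma euclid_dist_ge0 x y : 0 <= euclid_dist x y.
Proof. exact: sqrtr_ge0. Qed.

Lemma sumsq_ge0 x y : 0 <= \sum_(i < n) (x ord0 i - y ord0 i) ^+ 2.
Proof. by apply: sumr_ge0 => i _; exact: sqr_ge0. Qed.

Lemma sqr_euclid_dist x y :
  euclid_dist x y ^+ 2 = \sum_(i < n) (x ord0 i - y ord0 i) ^+ 2.
Proof. by rewrite sqr_sqrtr ?sumsq_ge0. Qed.

Lemma euclid_distC x y : euclid_dist x y = euclid_dist y x.
Proof.
congr Num.sqrt; apply: eq_bigr => i _.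
by rewrite -opprB sqrrN.
Qed.

Lemma euclid_distxx x : euclid_dist x x = 0.
Proof.
by rewrite /euclid_dist big1 ?sqrtr0// => i _; rewrite subrr expr0n.
Qed.

Lemma subset_tube w (r : R) : 0 < r -> w `<=` tube w r.
Proof. by move=> r0 x wx; apply/tubeP; exists x => //; rewrite euclid_distxx. Qed.

Lemma coord_le_euclid_dist x y i : `|x ord0 i - y ord0 i| <= euclid_dist x y.
Proof.
rewrite -sqrtr_sqr ler_sqrt ?sumsq_ge0// (bigD1 i)//= lerDl.
by apply: sumr_ge0 => j _; exact: sqr_ge0.
Qed.

(** The crude factor [n] in place of its square root lets the mesh constant of the cutoffs be a
    natural number. *)
Lemma euclid_dist_le x y (e : R) :
  (forall i, `|x ord0 i - y ord0 i| <= e) -> euclid_dist x y <= n%:R * e.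
Proof.
move=> xye; case: (posnP n) => [n0|n_gt0].
  rewrite /euclid_dist big1; first by rewrite sqrtr0 n0 mul0r.
  by move=> i _; have := ltn_ord i; rewrite {2}n0.
have e0 : 0 <= e by exact: le_trans (xye (Ordinal n_gt0)).
rewrite -(@ler_pXn2r _ 2)// ?nnegrE ?euclid_dist_ge0 ?mulr_ge0//.
rewrite sqr_euclid_dist exprMn.
apply: (@le_trans _ _ (\sum_(i < n) e ^+ 2)).
  apply: ler_sum => i _; rewrite -real_normK ?num_real//.
  by rewrite ler_pXn2r ?nnegrE.
rewrite sumr_const card_ord -[leLHS]mulr_natl; apply: ler_wpM2r; first exact: sqr_ge0.
by rewrite -natrX ler_nat expnS expn1 leq_pmulr.
Qed.

Lemma euclid_dist_triangle x y z :
  euclid_dist x z <= euclid_dist x y + euclid_dist y z.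
Proof.
(* The weights [b / a] and [a / b] used below require both distances to be nonzero; a zero distance
   means equal coordinates. *)
have [xy0|xy0] := eqVneq (euclid_dist x y) 0.
  have E i : x ord0 i = y ord0 i.
    have := coord_le_euclid_dist x y i; rewrite xy0 normr_le0 subr_eq0.
    by move/eqP.
  rewrite xy0 add0r le_eqVlt; apply/orP; left; apply/eqP; congr Num.sqrt.
  by apply: eq_bigr => i _; rewrite E.
have [yz0|yz0] := eqVneq (euclid_dist y z) 0.
  have E i : y ord0 i = z ord0 i.
    have := coord_le_euclid_dist y z i; rewrite yz0 normr_le0 subr_eq0.
    by move/eqP.
  rewrite yz0 addr0 le_eqVlt; apply/orP; left; apply/eqP; congr Num.sqrt.
  by apply: eq_bigr => i _; rewrite E.
have a0 : 0 < euclid_dist x y by rewrite lt_neqAle eq_sym xy0 euclid_dist_ge0.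
have b0 : 0 < euclid_dist y z by rewrite lt_neqAle eq_sym yz0 euclid_dist_ge0.
rewrite -(@ler_pXn2r _ 2)// ?nnegrE ?addr_ge0 ?euclid_dist_ge0//.
set a := euclid_dist x y in a0 xy0 *; set b := euclid_dist y z in b0 yz0 *.
(* AM-GM: [2 p q <= p^2 b / a + q^2 a / b] *)
apply: (@le_trans _ _ (\sum_(i < n) ((1 + b / a) * (x ord0 i - y ord0 i) ^+ 2 +
    (1 + a / b) * (y ord0 i - z ord0 i) ^+ 2))).
  rewrite sqr_euclid_dist; apply: ler_sum => i _.
  set p := x ord0 i - y ord0 i; set q := y ord0 i - z ord0 i.
  have -> : x ord0 i - z ord0 i = p + q by rewrite /p /q; ring.
  rewrite -subr_ge0.
  have -> : (1 + b / a) * p ^+ 2 + (1 + a / b) * q ^+ 2 - (p + q) ^+ 2 =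
      (b * p - a * q) ^+ 2 / (a * b) by field; rewrite xy0 yz0.
  by rewrite divr_ge0 ?sqr_ge0 ?mulr_ge0 ?ltW.
rewrite big_split/= -!mulr_sumr -!sqr_euclid_dist -/a -/b.
rewrite le_eqVlt; apply/orP; left; apply/eqP; field; by rewrite xy0 yz0.
Qed.

Lemma continuous_euclid_dist y : continuous (fun x : 'rV[R]_n => euclid_dist x y).
Proof.
move=> x; apply: (@continuous_comp _ _ _ (fun x : 'rV[R]_n =>
  \sum_(i < n) (x ord0 i - y ord0 i) ^+ 2) Num.sqrt); last exact: (@sqrt_continuous R).
apply: continuous_sumr => i _ {}x.
have c : {for x, continuous (fun x : 'rV[R]_n => x ord0 i - y ord0 i)}.
  exact: (@cvgB _ R^o _ _ _ _ _ _ _ (@coord_continuous _ _ _ ord0 i x) (cvg_cst _)).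
exact: (cvgM c c).
Qed.

Lemma open_tube w (r : R) : open (tube w r).
Proof.
rewrite openE => x /tubeP[y wy xy].
have := @continuous_euclid_dist y x => /cvgr_lt /(_ _ xy).
by apply: filterS => z zy; apply/tubeP; exists y.
Qed.

Lemma compact_coord_bounded S : compact S ->
  exists M, forall y i, S y -> `|y ord0 i| <= M.
Proof.
move=> cS; have [S0|S0] := pselect (S !=set0); last first.
  by exists 0 => y i Sy; case: S0; exists y.
have /choice[b bP] : forall i : 'I_n, exists b, forall y, S y -> `|y ord0 i| <= b.
  move=> i; have c : {within S, continuous (fun y : 'rV[R]_n => `|y ord0 i|)}.
    apply: continuous_subspaceT => y.
    apply: (@continuous_comp _ _ _ (fun y : 'rV[R]_n => y ord0 i) Num.norm).
      exact: coord_continuous.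
    exact: (@norm_continuous R R^o).
  have [z _ zP] := compact_EVT_max S0 cS c.
  by exists `|z ord0 i| => y Sy; apply: zP; rewrite inE.
exists (\sum_i `|b i|) => y i Sy; apply: (le_trans (bP i y Sy)).
apply: (le_trans (ler_norm _)); rewrite (bigD1 i)//= lerDl.
exact: sumr_ge0.
Qed.

End euclid.

Section cutoff.
Variables (R : realType) (n : nat).

(* The partition of unity given by the products of integer translates of [bump],
   rescaled to a mesh comparable to [r2 - r1] and restricted to the cells that
   meet the inner tube. *)
Lemma smooth_cutoff : exists C : seq 'I_n -> R, (forall s, 0 <= C s) /\
  forall (S : set 'rV[R]_n) (r1 r2 M : R),
    (forall y i, S y -> `|y ord0 i| <= M) -> r1 < r2 ->
    exists chi : 'rV[R]_n -> R,
    [/\ smooth chi, forall x, 0 <= chi x <= 1,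
        forall x, tube S r1 x -> chi x = 1,
        forall s x, ~ tube S r2 x -> partials s chi x = 0
      & forall s x, `|partials s chi x| <= C s / (r2 - r1) ^+ size s].
Proof.
have /choice[B BP] := @bump_derive_bounded R.
have B0 k : 0 <= B k by exact: le_trans (BP k 0).
(* At scale [a = c / (r2 - r1)], two points of one cell differ by at most [2 / a] in each
   coordinate, hence lie within [n%:R * 2 / c * (r2 - r1)] of each other. As [c] exceeds [2 n], a
   cell that meets the inner tube stays in the outer one. *)
pose c : R := (3 * n.+1)%:R.
have c0 : 0 < c by rewrite ltr0n muln_gt0.
(* One factor [c / (r2 - r1)] comes from each differentiation of the rescaled bumps; in each
   coordinate [B * 3] bounds the sum over all translates by [sum_translates_le3]. *)
exists (fun s => c ^+ size s * \prod_(i < n) (B (count_mem i s) * 3)); split.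
  move=> s; rewrite mulr_ge0 ?exprn_ge0 ?(ltW c0)//.
  by apply: prodr_ge0 => i _; rewrite mulr_ge0.
move=> S r1 r2 M SM r12.
have d0 : 0 < r2 - r1 by rewrite subr_gt0.
pose a := c / (r2 - r1); have a0 : 0 < a by rewrite divr_gt0.
(* On the inner tube [a * x ord0 i] lies in [[- b, b]]. The shift by [b] moves this range to
   [[0, 2 b]], where the translates with index below [N >= 2 b + 1] sum to 1. *)
pose b := a * (M + r1).
pose N := (Num.bound `|b + b + 1|).+1.
have NP : b + b + 1 <= N%:R.
  apply: (le_trans (ler_norm _)); apply: ltW.
  apply: (lt_trans (archi_boundP (normr_ge0 _))).
  by rewrite ltr_nat.
pose h (z : {ffun 'I_n -> 'I_N}) i (t : R) := bump (a * t + (b - (z i)%:R)).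
have nh z i k : nderivable k (h z i).
  exact/nderivable_affine/nderivable_bump.
have hE z i k : (h z i)^`(k)%classic =
    fun t => a ^+ k * (@bump R)^`(k)%classic (a * t + (b - (z i)%:R)).
  by rewrite derive1n_affine//; exact: nderivable_bump.
pose psi z := tensor (h z).
have spsi z := smooth_tensor (nh z).
pose P (z : {ffun 'I_n -> 'I_N}) := `[< exists2 y, tube S r1 y &
  forall i, `|a * y ord0 i + b - (z i)%:R| <= 1 >].
have [schi dchi] := @smooth_sumr R n _ (index_enum {ffun 'I_n -> 'I_N}) P psi
  (fun z _ => (spsi z).1).
have psi0 s (z : {ffun 'I_n -> 'I_N}) (x : 'rV[R]_n) i :
    1 < `|a * x ord0 i + b - (z i)%:R| -> partials s (psi z) x = 0.
  move=> x1; rewrite (spsi z).2 /tensor (bigD1 i)//= hE.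
  by rewrite bump_derive_out ?mulr0 ?mul0r// addrA.
have psi_ge0 (z : {ffun 'I_n -> 'I_N}) (x : 'rV[R]_n) : 0 <= psi z x.
  by apply: prodr_ge0 => i _; exact: bump_ge0.
have sum1 (x : 'rV[R]_n) : \sum_z psi z x = \prod_i (smooth_step (a * x ord0 i + b + 1) -
    smooth_step (a * x ord0 i + b + 1 - N%:R)).
  rewrite /psi /tensor /h.
  rewrite -(bigA_distr_bigA (fun (i : 'I_n) (z : 'I_N) =>
    bump (a * x ord0 i + (b - z%:R)))).
  by apply: eq_bigr => i _; rewrite -sum_bump; apply: eq_bigr => z _; rewrite addrA.
exists (fun x => \sum_(z | P z) psi z x); split => //.
- move=> x; rewrite sumr_ge0//=.
  apply: (@le_trans _ _ (\sum_z psi z x)).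
    by rewrite [leRHS](bigID P)/= lerDl sumr_ge0.
  rewrite sum1; apply: prodr_ile1 => i _.
  have -> : smooth_step (a * x ord0 i + b + 1) -
      smooth_step (a * x ord0 i + b + 1 - N%:R) =
      \sum_(z < N) bump (a * x ord0 i + b - z%:R) by rewrite sum_bump.
  rewrite sumr_ge0 => [/=|z _]; last exact: bump_ge0.
  rewrite sum_bump.
  have := smooth_step_itv (a * x ord0 i + b + 1).
  have := smooth_step_itv (a * x ord0 i + b + 1 - N%:R); lra.
- move=> x Sx; rewrite (_ : \sum_(z | P z) psi z x = \sum_z psi z x).
    rewrite sum1 big1// => i _.
    have /andP[xl xr] : - (M + r1) <= x ord0 i <= M + r1.
      rewrite -ler_norml; move/tubeP : Sx => [y Sy xy].
      have := SM y i Sy; have := coord_le_euclid_dist x y i.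
      have := ler_normD (x ord0 i - y ord0 i) (y ord0 i); rewrite subrK; lra.
    have yl : - b <= a * x ord0 i by rewrite /b -mulrN ler_pM2l.
    have yr : a * x ord0 i <= b by rewrite /b ler_pM2l.
    rewrite smooth_step1; last lra.
    by rewrite smooth_step0 ?subr0//; lra.
  (* A cell that contributes at [x] has [x] itself as a witness of [P], so restricting to [P] loses
     nothing here. *)
  rewrite [RHS](bigID P)/= [X in _ = _ + X]big1 ?addr0// => z /asboolPn nP.
  apply: contrapT => /eqP psi_neq0; apply: nP; exists x => // i.
  by rewrite leNgt; apply/negP => /(psi0 [::]) /eqP; apply/negP.
- move=> s x Sx; rewrite dchi big1// => z /asboolP[y Sy yz].
  apply: contrapT => /eqP psi_neq0; apply: Sx.
  have xz i : `|a * x ord0 i + b - (z i)%:R| <= 1.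
    by rewrite leNgt; apply/negP => /(psi0 s) /eqP; apply/negP.
  move/tubeP : Sy => [y' Sy' yy']; apply/tubeP; exists y' => //.
  apply: (le_lt_trans (euclid_dist_triangle x y y')).
  suff : euclid_dist x y <= r2 - r1 by lra.
  apply: (@le_trans _ _ (n%:R * (2 / a))).
    apply: euclid_dist_le => i; rewrite ler_pdivlMr// mulrC.
    rewrite -[X in X * _](gtr0_norm a0) -normrM.
    have := xz i; have := yz i; rewrite !ler_norml mulrBr; lra.
  have -> : n%:R * (2 / a) = n%:R * 2 / c * (r2 - r1).
    by rewrite /a; field; rewrite !gt_eqF.
  rewrite -[leRHS]mul1r ler_wpM2r ?(ltW d0)// ler_pdivrMr// mul1r /c -natrM ler_nat.
  by rewrite mulnC leq_mul.
- move=> s x; rewrite dchi.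
  apply: (le_trans (ler_norm_sum _ _ _)).
  apply: (@le_trans _ _ (\sum_z `|partials s (psi z) x|)).
    by rewrite [leRHS](bigID P)/= lerDl sumr_ge0.
  rewrite (eq_bigr (fun z : {ffun 'I_n -> 'I_N} => \prod_i `|a ^+ count_mem i s *
      (@bump R)^`(count_mem i s)%classic (a * x ord0 i + b - (z i)%:R)|)); last first.
    move=> z _; rewrite (spsi z).2 /tensor normr_prod.
    by apply: eq_bigr => i _; rewrite hE addrA.
  (* Summing over all cells, rather than those in [P], makes the bound factor into one-dimensional
     sums over the coordinates. *)
  rewrite -(bigA_distr_bigA (fun (i : 'I_n) (z : 'I_N) => `|a ^+ count_mem i s *
      (@bump R)^`(count_mem i s)%classic (a * x ord0 i + b - z%:R)|)).
  apply: (@le_trans _ _ (\prod_i (a ^+ count_mem i s * (B (count_mem i s) * 3)))).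
    apply: ler_prod => i _; rewrite sumr_ge0//=.
    under eq_bigr do rewrite normrM (ger0_norm (exprn_ge0 _ (ltW a0))).
    rewrite -mulr_sumr ler_wpM2l ?exprn_ge0 ?(ltW a0)//.
    apply: sum_translates_le3 => // t; exact: bump_derive_out.
  rewrite big_split/= prodrXr.
  rewrite (_ : (\sum_(i < n) count_mem i s)%N = size s); last first.
    elim: s => [|j s IH] /=; first by rewrite big1.
    by rewrite big_split/= IH (bigD1 j)//= eqxx big1// => i /negbTE; rewrite eq_sym => ->.
  by rewrite /a exprMn exprVn mulrAC.
Qed.

End cutoff.

(** * Measurability for the completed Lebesgue measure *)

Section rV_leb_measurability.
Variables (R : realType) (n : nat).
Local Notation T := (rV_leb R n).

Lemma mes_complete : measure_is_complete (@mes R n).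
Proof. exact: measure_is_complete_caratheodory. Qed.

Lemma measurable_cylinder (i : 'I_n) (B : set (measurableTypeR R)) :
  measurable B -> measurable ([set x | B (x ord0 i)] : set T).
Proof.
move=> mB; apply: caratheodory_measurable_mu_ext.
by apply: sub_sigma_algebra; exists i, B.
Qed.

(** An open set is the countable union of the boxes with rational centres and sides of the form 2 /
    (k + 1) that it contains, and a box is a finite intersection of cylinders. *)
Lemma open_measurable_rV_leb (U : set 'rV[R]_n) : open U -> measurable (U : set T).
Proof.
move=> oU.
pose box (p : 'rV[rat]_n * nat) : set T :=
  \bigcap_(i in [set: 'I_n]) [set x | ball (ratr (p.1 ord0 i) : R) (p.2.+1%:R^-1) (x ord0 i)].
have mbox p : measurable (box p).
  apply: fin_bigcap_measurable => // i _.
  by apply: measurable_cylinder; exact: measurable_ball.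
pose F (p : 'rV[rat]_n * nat) : set T := if `[< box p `<=` U >] then box p else set0.
have -> : U = \bigcup_(p in [set: 'rV[rat]_n * nat]) F p.
  apply/seteqP; split => [x Ux|x [p _]]; last first.
    by rewrite /F; case: ifPn => // /asboolP; exact.
  have : nbhs x U by exact: open_nbhs_nbhs.
  move=> /nbhs_ballP[e /= e0 xeU].
  pose k := Num.bound (2 / e).
  pose c : R := k.+1%:R^-1.
  have k0 : 0 < c by rewrite invr_gt0 ltr0n.
  have ke : 2 * c < e.
    rewrite ltr_pdivrMr ?ltr0n// mulrC -ltr_pdivrMr//.
    have := archi_boundP (divr_ge0 (ler0n R 2) (ltW e0)).
    by move=> /lt_trans; apply; rewrite ltr_nat.
  have /choice[q qP] : forall i, exists q : rat,
      `|ratr q - x ord0 i| < c.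
    move=> i; have : x ord0 i - c < x ord0 i + c by lra.
    move/rat_in_itvoo => [q]; rewrite in_itv/= => qi; exists q.
    by rewrite ltr_norml; lra.
  have xbox : box (\row_i q i, k) x.
    by move=> i _; rewrite /= mxE; exact: qP.
  exists (\row_i q i, k) => //; rewrite /F ifT//; apply/asboolP => y ybox.
  apply: xeU; split=> // i j; rewrite ord1.
  have := ybox j I; rewrite /= mxE /ball/= -/c => yj.
  have := qP j; rewrite distrC; have := ler_normD (x ord0 j - ratr (q j)) (ratr (q j) - y ord0 j).
  by rewrite distrC addrA subrK; lra.
apply: countable_bigcupT_measurable => [|p]; first exact: countableP.
by rewrite /F; case: ifP.
Qed.

Lemma continuous_measurable_rV_leb (h : 'rV[R]_n -> R) (D : set T) :
  continuous h -> measurable_fun D (h : T -> R).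
Proof.
move=> /continuousP ch; apply: measurable_funTS.
apply: (measurability _ (RGenOpens.measurableE R)).
move=> _ [_ [a [b ->] <-]]; rewrite setTI.
exact/open_measurable_rV_leb/ch/interval_open.
Qed.

(** Rounding [u] down to multiples of 1 / (k + 1) leaves countably many values, so the composition
    with the rounded function is measurable by the hypothesis for constant second argument.
    Continuity passes to the limit off the exceptional set [N], and on [N] completeness of the
    measure suffices. *)
Lemma measurable_caratheodory_comp (Omega : set 'rV[R]_n)
    (a : 'rV[R]_n -> R -> R) (u : 'rV[R]_n -> R) :
  measurable (Omega : set T) -> caratheodory_function Omega a ->
  measurable_fun (Omega : set T) (u : T -> R) ->
  measurable_fun (Omega : set T) ((fun x => a x (u x)) : T -> R).
Proof.
move=> mO [ma [N [mN N0 aN]]] mu_.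
pose v (k : nat) (x : T) : R := (Num.floor (u x * k.+1%:R))%:~R / k.+1%:R.
have vu x k : `|v k x - u x| <= k.+1%:R^-1.
  have k0 : (0 : R) < k.+1%:R by rewrite ltr0n.
  rewrite /v; have -> : (Num.floor (u x * k.+1%:R))%:~R / k.+1%:R - u x =
      ((Num.floor (u x * k.+1%:R))%:~R - u x * k.+1%:R) / k.+1%:R.
    by field; rewrite addrC natr1 lt0r_neq0.
  rewrite normrM [X in _ * X]ger0_norm ?invr_ge0 ?(ltW k0)//.
  rewrite -[leRHS]mul1r ler_wpM2r ?invr_ge0 ?(ltW k0)//.
  have := floor_itv (u x * k.+1%:R); rewrite intrD ler_norml; lra.
have mv k : measurable_fun (Omega : set T) ((fun x => a x (v k x)) : T -> R).
  move=> _ B mB.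
  have -> : Omega `&` (fun x => a x (v k x)) @^-1` B =
      \bigcup_(z in [set: int]) (Omega `&` (u @^-1` [set r | Num.floor (r * k.+1%:R) = z])
        `&` (Omega `&` (a ^~ (z%:~R / k.+1%:R)) @^-1` B)).
    apply/seteqP; split => [x [Ox Bx]|x [z _ [[Ox /= zx] [_ Bx]]]].
      by exists (Num.floor (u x * k.+1%:R)) => //; split.
    by split => //=; rewrite /v zx.
  apply: countable_bigcupT_measurable => [|z]; first exact: countableP.
  apply: measurableI; last exact: ma.
  apply: mu_ => //.
  have -> : [set r : R | Num.floor (r * k.+1%:R) = z] =
      `[z%:~R / k.+1%:R, (z + 1)%:~R / k.+1%:R[%classic.
    apply/seteqP; split => r /=; rewrite in_itv/= ler_pdivrMr ?ltr0n// ltr_pdivlMr ?ltr0n//.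
      by move=> <-; exact: floor_itv.
    by move=> h; apply/floor_def.
  exact: measurable_itv.
have ON : Omega = (Omega `\` N) `|` (Omega `&` N) by rewrite setUC setUIDK.
rewrite ON; apply/measurable_funU; [exact: measurableD|exact: measurableI|split].
  pose F k : T -> R := fun x => a x (v k x).
  apply: (@measurable_fun_cvg _ T R _ F).
    move=> k; apply: measurable_funS (mv k) => //; exact: subDsetl.
  move=> x [Ox Nx].
  have ca : continuous (a x).
    by apply: contrapT => nca; apply: Nx; apply: aN => /(_ Ox).
  apply: (@continuous_cvg _ _ _ _ _ (v ^~ x) (a x)); first exact: ca.
  apply/cvgrPdist_le => e e0; near=> k.
  rewrite distrC (le_trans (vu x k))//.
  by near: k; have := near_infty_natSinv_lt (PosNum e0); apply: filterS => k /ltW.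
move=> mON B mB; apply: mes_complete.
exists N; split => //; apply: subset_trans (@subIsetl _ _ _) _; exact: subIsetr.
Unshelve. all: by end_near. Qed.

End rV_leb_measurability.

(** * Complements on integrals of nonnegative functions *)

Section integral_lemmas.
Context d (T : measurableType d) (R : realType) (mu : {measure set T -> \bar R}).

(** Monotone convergence is applied to the increasing complements [F i]. If every tail kept mass
    [e], their integrals would stay below the limit by [e], which is absurd because the limit is
    finite. *)
Lemma integral_shrinking_lt (h : T -> \bar R) (E : (set T)^nat) (e : R) :
  (forall i, measurable (E i)) -> (forall i j, (i <= j)%N -> E j `<=` E i) ->
  \bigcap_i E i = set0 -> measurable_fun (E 0%N) h ->
  (forall x, E 0%N x -> (0 <= h x)%E) ->
  (\int[mu]_(x in E 0%N) h x < +oo)%E -> 0 < e ->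
  exists i, (\int[mu]_(x in E i) h x < e%:E)%E.
Proof.
move=> mE dE E0 mh h0 hoo e0.
pose F i := E 0%N `\` E i.
have mF i : measurable (F i) by exact: measurableD.
have FE i : F i `<=` E 0%N by exact: subDsetl.
have UF : \bigcup_i F i = E 0%N.
  apply/seteqP; split=> [x [i _ /FE]//|x E0x].
  apply: contrapT => nx; have : (\bigcap_i E i) x.
    by move=> i _; apply: contrapT => nEx; apply: nx; exists i.
  by rewrite E0.
have cF := @ge0_nondecreasing_set_cvg_integral _ _ _ F h mu _ mF
  (fun i => measurable_funS (mE 0%N) (@FE i) mh) (fun i x Fx => h0 x (FE i x Fx)).
have {cF} := cF _; rewrite UF.
have ndF : nondecreasing_seq F.
  by move=> i j ij; apply/subsetPset => x [E0x nx]; split => //; move/(dE _ _ ij).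
move=> /(_ ndF) cF.
have I0 i : (0 <= \int[mu]_(x in F i) h x)%E.
  by apply: integral_ge0 => x /FE; exact: h0.
have fin : (\int[mu]_(x in E 0%N) h x)%E \is a fin_num.
  by rewrite ge0_fin_numE// integral_ge0.
have lt : ((\int[mu]_(x in E 0%N) h x)%E - e%:E < \int[mu]_(x in E 0%N) h x)%E.
  by rewrite lteBlDr// lteDl.
apply: contrapT => nlt; move: lt; rewrite ltNge => /negP; apply.
apply: (cvge_to_le cF); apply: nearW => i.
have Ei : (e%:E <= \int[mu]_(x in E i) h x)%E.
  by rewrite leNgt; apply/negP => lt; apply: nlt; exists i.
have EQ : E 0%N = E i `|` F i by rewrite /F setDUK//; exact: dE.
rewrite [in leRHS]EQ ge0_integral_setU// -?EQ//; last by rewrite disj_set2E setDIK.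
by rewrite leeBrDr// addeC; exact: leeD2l.
Qed.

(** The integral of a nonnegative function is a supremum over the simple functions below it, so
    monotonicity follows from the definition. This serves integrands such as [gamma_inv g (f x)],
    whose measurability is not established. *)
Lemma ge0_le_integral_nonmeasurable (D : set T) (f1 f2 : T -> \bar R) :
  (forall x, D x -> (0 <= f1 x)%E) ->
  (forall x, D x -> (f1 x <= f2 x)%E) ->
  (\int[mu]_(x in D) f1 x <= \int[mu]_(x in D) f2 x)%E.
Proof.
move=> f10 f12; rewrite !(integral_mkcond D) !ge0_integralTE; last 2 first.
- by move=> x; apply: erestrict_ge0 => y Dy; exact: le_trans (f10 y Dy) (f12 y Dy).
- by move=> x; exact: erestrict_ge0.
apply: ereal_sup_le => _ [h hP <-]; exists h => // x.
by apply: (le_trans (hP x)); exact: lee_restrict.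
Qed.

Lemma ge0_subset_integral_nonmeasurable (A B : set T) (h : T -> \bar R) :
  A `<=` B -> (forall x, B x -> (0 <= h x)%E) ->
  (\int[mu]_(x in A) h x <= \int[mu]_(x in B) h x)%E.
Proof.
move=> AB h0; rewrite integral_mkcond [leRHS]integral_mkcond.
apply: ge0_le_integral_nonmeasurable => x _.
  by apply: erestrict_ge0 => y /AB; exact: h0.
rewrite !patchE; case: ifPn => [|_]; last first.
  by case: ifPn => //; rewrite inE; exact: h0.
by rewrite inE => /AB Bx; rewrite mem_set.
Qed.

End integral_lemmas.

(** * Convex nonlinearities *)

Section one_sided_derivative.
Variables (R : realType) (g : R -> R).

Lemma dquotP (x e : R) : derivable_ge0 g x -> 0 < e ->
  exists2 d, 0 < d & forall y, 0 <= y -> y != x -> `|y - x| < d ->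
    `|(g y - g x) / (y - x) - derive_ge0 g x| < e.
Proof.
move=> dg e0.
have /cvgrPdist_lt/(_ e e0)/nbhs_ballP[d /= d0 dP] :
  dquot g x y @[y --> within (fun y => 0 <= y) x^'] --> derive_ge0 g x by exact: dg.
exists d => // y y0 yx xyd; rewrite distrC; apply: dP => //.
by rewrite /ball/= distrC.
Qed.

Lemma derivable_ge0_is_derive (x : R) : 0 < x -> derivable_ge0 g x ->
  is_derive x 1 g (derive_ge0 g x).
Proof.
move=> x0 dg.
have c : (fun h : R => h^-1 *: (g (h *: 1 + x) - g x)) @ 0^' --> derive_ge0 g x.
  apply/cvgrPdist_lt => e e0; have [d d0 dP] := dquotP dg e0.
  near=> h.
  have h0 : h != 0 by near: h; exact: nbhs_dnbhs_neq.
  have hd : `|h| < Num.min d x.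
    near: h; apply: dnbhs0_lt; by rewrite lt_min d0.
  move: hd; rewrite lt_min => /andP[hd hx].
  have := dP (h + x); rewrite addrK => /(_ _ _ hd).
  rewrite [h *: 1]mulr1 /GRing.scale/= mulrC distrC; apply.
    by move: hx; rewrite ltr_norml; lra.
  by rewrite -subr_eq0 addrK.
by apply: DeriveDef; [exact: cvgP c|exact: cvg_lim c].
Unshelve. all: by end_near. Qed.

Lemma derivable_ge0_continuous (a b : R) : 0 <= a ->
  (forall x, 0 <= x -> derivable_ge0 g x) -> {within `[a, b], continuous g}.
Proof.
move=> a0 dg; apply/subspace_continuousP => x /=; rewrite in_itv/= => /andP[ax xb].
have x0 : 0 <= x by exact: le_trans ax.
have [d d0 dP] := dquotP (dg x x0) ltr01.
pose l := `|derive_ge0 g x| + 1.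
have l0 : 0 < l by rewrite ltr_wpDl.
apply/cvgrPdist_lt => e e0; apply/nbhs_ballP.
exists (Num.min d (e / l)); first by rewrite /= lt_min d0 divr_gt0.
move=> y; rewrite /ball/= lt_min => /andP[xyd xye]; rewrite in_itv/= => /andP[ay _].
have [->|yx] := eqVneq y x; first by rewrite subrr normr0.
have := dP y (le_trans a0 ay) yx; rewrite distrC => /(_ xyd) q.
rewrite distrC -(@divfK _ (y - x) _ (g y - g x)) ?subr_eq0// normrM.
have ql : `|(g y - g x) / (y - x)| <= l.
  have := ler_normD ((g y - g x) / (y - x) - derive_ge0 g x) (derive_ge0 g x).
  by rewrite subrK /l; lra.
apply: (le_lt_trans (ler_wpM2r (normr_ge0 _) ql)).
by rewrite mulrC -ltr_pdivlMr// distrC.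
Qed.

End one_sided_derivative.

Section nonlinearity_theory.
Variables (R : realType) (g : R -> R).
Hypothesis hg : nonlinearity g.
Local Notation g' := (derive_ge0 g).

Lemma nonlinearity0 : g 0 = 0. Proof. by case: hg. Qed.

Lemma nonlinearity_gt0 z : 0 < z -> 0 < g z.
Proof. by case: hg => _ _ _ /[apply] -[]. Qed.

Lemma nonlinearity_ge0 z : 0 <= z -> 0 <= g z.
Proof. by case: hg => _ /(_ z). Qed.

Lemma derive_nonlinearity_lt s t : 0 <= s -> s < t -> g' s < g' t.
Proof.
case: hg => -[_ d2 _] _ _ pos s0 st.
have st0 x : x \in `]s, t[ -> 0 < x.
  by rewrite in_itv/= => /andP[sx _]; exact: le_lt_trans sx.
have [c cst E] := MVT st (fun x xst =>
    derivable_ge0_is_derive (st0 x xst) (d2 x (ltW (st0 x xst))))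
  (derivable_ge0_continuous s0 d2).
rewrite -subr_gt0 E mulr_gt0 ?subr_gt0//.
by have [] := pos c (st0 c cst).
Qed.

Lemma derive_nonlinearity_le s t : 0 <= s -> s <= t -> g' s <= g' t.
Proof.
move=> s0; rewrite le_eqVlt => /orP[/eqP-> //|st].
by rewrite ltW// derive_nonlinearity_lt.
Qed.

Lemma derive_nonlinearity_gt0 z : 0 < z -> 0 < g' z.
Proof. by case: hg => _ _ _ /[apply] -[]. Qed.

(** Convexity in the form used below: monotonicity of [g z / z], Young's inequality and Jensen's
    inequality are all read off from the tangent at [t], the one-sided tangent at 0 included. *)
Lemma nonlinearity_tangent s t : 0 <= s -> 0 <= t ->
  g t + g' t * (s - t) <= g s.
Proof.
case: hg => -[d1 _ _] _ _ _.
have mvt a b : 0 <= a -> a < b -> exists2 c, c \in `]a, b[ & g b - g a = g' c * (b - a).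
  move=> a0 ab; apply: MVT => //; last exact: derivable_ge0_continuous.
  move=> x; rewrite in_itv/= => /andP[ax _].
  have x0 : 0 < x by exact: le_lt_trans ax.
  by apply: derivable_ge0_is_derive => //; apply: d1; exact: ltW.
move=> s0 t0; have [st|ts|->] := ltgtP s t.
- have [c] := mvt _ _ s0 st; rewrite in_itv/= => /andP[sc ct] E.
  have := derive_nonlinearity_le (ltW (le_lt_trans s0 sc)) (ltW ct).
  move=> /(ler_wpM2r (_ : 0 <= t - s)); rewrite subr_ge0 (ltW st) => /(_ isT).
  rewrite -E; lra.
- have [c] := mvt _ _ t0 ts; rewrite in_itv/= => /andP[tc cs] E.
  have := derive_nonlinearity_le t0 (ltW tc).
  move=> /(ler_wpM2r (_ : 0 <= s - t)); rewrite subr_ge0 (ltW ts) => /(_ isT).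
  rewrite -E; lra.
- by rewrite subrr mulr0 addr0.
Qed.

Lemma nonlinearity_le_derive t : 0 <= t -> g t <= t * g' t.
Proof.
move=> t0; have := nonlinearity_tangent (lexx 0) t0; rewrite nonlinearity0; lra.
Qed.

Lemma nonlinearity_ratio s t : 0 < s -> s <= t -> g s / s <= g t / t.
Proof.
move=> s0 st; have t0 : 0 < t by exact: lt_le_trans st.
have tan := nonlinearity_tangent (ltW t0) (ltW s0).
have := nonlinearity_le_derive (ltW s0) => le'.
rewrite ler_pdivrMr// mulrAC ler_pdivlMr//.
have := ler_wpM2r (_ : 0 <= t - s) le'; rewrite subr_ge0 => /(_ st) h1.
have := ler_wpM2r (ltW s0) tan; lra.
Qed.

Lemma nonlinearity_lt s t : 0 <= s -> s < t -> g s < g t.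
Proof.
rewrite le_eqVlt => /orP[/eqP<-|s0] st; first by rewrite nonlinearity0 nonlinearity_gt0.
have := nonlinearity_tangent (ltW (lt_trans s0 st)) (ltW s0).
have := mulr_gt0 (derive_nonlinearity_gt0 s0) (_ : 0 < t - s); rewrite subr_gt0 => /(_ st); lra.
Qed.

(** Gives the geometric growth of the levels that contradicts the finiteness of J at the end of the
    iteration. *)
Lemma nonlinearity_pow2 s j : 0 <= s -> 2 ^+ j * g s <= g (2 ^+ j * s).
Proof.
move=> s0; elim: j => [|j IH]; first by rewrite !mul1r.
have x0 : 0 <= 2 ^+ j * s by rewrite mulr_ge0 ?exprn_ge0.
rewrite !exprS -!mulrA; apply: (@le_trans _ _ (2 * g (2 ^+ j * s))).
  by rewrite ler_wpM2l.
move: x0; rewrite le_eqVlt => /orP[/eqP<-|x0]; first by rewrite mulr0 nonlinearity0 mulr0.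
have := nonlinearity_ratio x0 (_ : 2 ^+ j * s <= 2 * (2 ^+ j * s)).
set x := 2 ^+ j * s in x0 *.
have -> : x <= 2 * x by lra.
move=> /(_ isT); rewrite ler_pdivrMr//.
have -> : g (2 * x) / (2 * x) * x = g (2 * x) / 2 by field; rewrite gt_eqF.
lra.
Qed.

Lemma measurable_nonlinearity : measurable_fun (`]0%R, +oo[%classic : set (measurableTypeR R)) g.
Proof.
apply: open_continuous_measurable_fun => //.
move=> x; rewrite inE/= in_itv/= andbT => x0.
apply/differentiable_continuous/derivable1_diffP.
have [[d1 _ _] _ _ _] := hg.
by have [] := derivable_ge0_is_derive x0 (d1 x (ltW x0)).
Qed.

(* The integrand of [G]. *)
Definition tail_density (m : nat) (z : R) : R :=
  g z `^ (- m%:R^-1) * z `^ (m%:R^-1 - 1).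

(** Up to a constant, the radius spent by the iteration at level [z]. By [tail_densityE], [G]
    integrates this function against dz / z, for which all dyadic intervals have the same mass. *)
Definition growth_ratio (m : nat) (z : R) : R := (z / g z) `^ m%:R^-1.

Variable m : nat.
Local Notation h := (tail_density m).
Local Notation q := (growth_ratio m).

Lemma tail_densityE z : 0 < z -> h z = q z / z.
Proof.
move=> z0; have gz := nonlinearity_gt0 z0.
rewrite /tail_density /growth_ratio powRM ?(ltW z0) ?invr_ge0 ?(ltW gz)//.
rewrite powRB; last by rewrite [z == 0]gt_eqF//= implybT.
rewrite powRr1 ?(ltW z0)// mulrA; congr (_ / _); rewrite mulrC; congr (_ * _).
by rewrite -mulN1r powRrM powR_inv1 ?(ltW gz).
Qed.

Lemma growth_ratio_gt0 z : 0 < z -> 0 < q z.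
Proof. by move=> z0; rewrite powR_gt0// divr_gt0// nonlinearity_gt0. Qed.

Lemma growth_ratio_le s t : 0 < s -> s <= t -> q t <= q s.
Proof.
move=> s0 st; have t0 := lt_le_trans s0 st.
have gs := nonlinearity_gt0 s0; have gt := nonlinearity_gt0 t0.
apply: ge0_ler_powR; rewrite ?invr_ge0 ?nnegrE ?divr_ge0 ?(ltW s0) ?(ltW t0) ?(ltW gs) ?(ltW gt)//.
by rewrite -lef_pV2 ?posrE ?divr_gt0// !invf_div; apply: nonlinearity_ratio.
Qed.

Lemma tail_density_gt0 z : 0 < z -> 0 < h z.
Proof. by move=> z0; rewrite tail_densityE// divr_gt0// growth_ratio_gt0. Qed.

Lemma tail_density_le s t : 0 < s -> s <= t -> h t <= h s.
Proof.
move=> s0 st; have t0 := lt_le_trans s0 st.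
rewrite !tail_densityE//; apply: ler_pM.
- exact/ltW/growth_ratio_gt0.
- by rewrite invr_ge0 ltW.
- exact: growth_ratio_le.
- by rewrite lef_pV2.
Qed.

Lemma measurable_tail_density : measurable_fun (`]0%R, +oo[%classic : set (measurableTypeR R)) h.
Proof.
apply: measurable_funM.
  apply: (measurableT_comp (measurable_powR _)); exact: measurable_nonlinearity.
apply: measurable_funTS; exact: measurable_powR.
Qed.

Hypothesis hgint : (\int[lebesgue_measure]_(z in `[1%R, +oo[)
  (g z `^ (- m%:R^-1) * z `^ (m%:R^-1 - 1))%:E < +oo)%E.

Let mh (D : set (measurableTypeR R)) : D `<=` `]0, +oo[ ->
  measurable_fun D (EFin \o h).
Proof.
move=> D0; apply/measurable_EFinP; apply: measurable_funS D0 measurable_tail_density.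
exact: measurable_itv.
Qed.

Let h0 z : z \in `]0, +oo[ -> (0 <= (h z)%:E)%E.
Proof. by rewrite in_itv/= andbT => z0; rewrite lee_fin ltW// tail_density_gt0. Qed.

Lemma integral_tail_density_itv s t : 0 < s -> s <= t ->
  ((h t * (t - s))%:E <= \int[lebesgue_measure]_(z in `]s, t]) (h z)%:E
     <= (h s * (t - s))%:E)%E.
Proof.
move=> s0 st; have t0 := lt_le_trans s0 st.
have sub : `]s, t] `<=` `]0, +oo[.
  by move=> z /=; rewrite !in_itv/= andbT => /andP[/(lt_trans s0)].
have Ecst (c : R) : (\int[lebesgue_measure]_(z in `]s, t]) c%:E = (c * (t - s))%:E)%E.
  rewrite integral_cst//= lebesgue_measure_itv/= lte_fin.
  by move: st; rewrite le_eqVlt => /orP[/eqP->|->]; rewrite ?ltxx ?subrr ?mulr0 ?mule0.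
rewrite -!Ecst; apply/andP; split; apply: ge0_le_integral => //.
- by move=> z _; rewrite lee_fin ltW// tail_density_gt0.
- exact: mh.
- move=> z; rewrite /= in_itv/= => /andP[sz zt]; rewrite lee_fin tail_density_le//.
  exact: lt_trans sz.
- by move=> z /sub; exact: h0.
- exact: mh.
- move=> z; rewrite /= in_itv/= => /andP[sz zt]; rewrite lee_fin tail_density_le//.
  exact: ltW.
Qed.

Lemma integral_tail_split s t : 0 < s -> s <= t ->
  G m g s = (\int[lebesgue_measure]_(z in `]s, t]) (h z)%:E + G m g t)%E.
Proof.
move=> s0 st; rewrite /G -ge0_integral_setU//.
- congr (integral _ _ _); apply/seteqP; split => z /=; rewrite !in_itv/= !andbT.
    by move=> sz; rewrite sz/=; case: (leP z t); [left|right].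
  by move=> [/andP[]//|]; exact: le_lt_trans.
- apply: mh => z [|] /=; rewrite !in_itv/= !andbT.
    by move=> /andP[/(lt_trans s0)].
  by apply: lt_trans; exact: lt_le_trans st.
- move=> z zst; apply: h0; rewrite in_itv/= andbT; move: zst => [|] /=; rewrite !in_itv/= ?andbT.
    by move=> /andP[/(lt_trans s0)].
  by apply: lt_trans; exact: lt_le_trans st.
- apply/disj_setPS => z [] /=; rewrite !in_itv/= !andbT => /andP[_ zt].
  by rewrite ltNge zt.
Qed.

Lemma G_ge0 s : 0 <= s -> (0 <= G m g s)%E.
Proof.
move=> s0; apply: integral_ge0 => z /=; rewrite in_itv/= andbT => sz; apply: h0.
by rewrite in_itv/= andbT (le_lt_trans s0).
Qed.

Lemma G_fin_num s : 0 < s -> G m g s \is a fin_num.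
Proof.
move=> s0.
have G1 : (G m g 1 < +oo)%E.
  apply: le_lt_trans hgint; apply: ge0_subset_integral => //.
  - by apply: mh => z /=; rewrite !in_itv/= !andbT; exact: lt_le_trans.
  - move=> z /=; rewrite !in_itv/= !andbT => z1; apply: h0.
    by rewrite in_itv/= andbT (lt_le_trans _ z1).
  - by move=> z /=; rewrite !in_itv/= !andbT; exact: ltW.
rewrite ge0_fin_numE ?G_ge0 ?(ltW s0)//; have [s1|s1] := leP s 1.
  rewrite (integral_tail_split s0 s1) lte_add_pinfty//.
  have /andP[_ /le_lt_trans] := integral_tail_density_itv s0 s1; apply.
  exact: ltry.
apply: le_lt_trans G1; rewrite (integral_tail_split ltr01 (ltW s1)) leeDr//.
apply: integral_ge0 => z /=; rewrite in_itv/= => /andP[z1 _]; apply: h0.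
by rewrite in_itv/= andbT (lt_trans _ z1).
Qed.

Let Gr s : R := fine (G m g s).

Lemma GE s : 0 < s -> G m g s = (Gr s)%:E.
Proof. by move=> s0; rewrite fineK// G_fin_num. Qed.

Lemma fine_G_ge0 s : 0 < s -> 0 <= Gr s.
Proof. by move=> s0; rewrite fine_ge0// G_ge0// ltW. Qed.

Lemma fine_G_sub s t : 0 < s -> s <= t ->
  h t * (t - s) <= Gr s - Gr t <= h s * (t - s).
Proof.
move=> s0 st; have t0 := lt_le_trans s0 st.
have := integral_tail_density_itv s0 st.
have := integral_tail_split s0 st; rewrite !GE//.
case: (\int[_]_(_ in _) _)%E => [r||]//=.
by rewrite -EFinD => -[->]; rewrite !lee_fin addrK.
Qed.

Lemma fine_G_lt s t : 0 < s -> s < t -> Gr t < Gr s.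
Proof.
move=> s0 st; have /andP[+ _] := fine_G_sub s0 (ltW st).
have := mulr_gt0 (tail_density_gt0 (lt_trans s0 st)) (_ : 0 < t - s).
rewrite subr_gt0 => /(_ st); lra.
Qed.

Lemma fine_G_small e : 0 < e -> exists2 t, 0 < t & Gr t < e.
Proof.
move=> e0; pose E (i : nat) : set (measurableTypeR R) := `]i.+1%:R, +oo[%classic.
have [||||||i iP] := @integral_shrinking_lt _ (measurableTypeR R) R
    lebesgue_measure (EFin \o h) E e _ _ _ _ _ _ e0.
- by move=> i; exact: measurable_itv.
- move=> i j ij z; rewrite /E /= !in_itv/= !andbT; apply: le_lt_trans.
  by rewrite ler_nat ltnS.
- apply/seteqP; split => // z zE; have := zE (Num.bound `|z|) I.
  rewrite /E /= in_itv/= andbT => /ltW; rewrite leNgt => /negP; apply.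
  apply: (le_lt_trans (ler_norm z)); apply: (lt_trans (archi_boundP (normr_ge0 z))).
  by rewrite ltr_nat.
- apply: mh => z; rewrite /E /= !in_itv/= !andbT; exact: lt_trans.
- move=> z; rewrite /E /= !in_itv/= !andbT => z1; apply: h0.
  by rewrite in_itv/= andbT (lt_trans _ z1).
- by have := G_fin_num (@ltr01 R); rewrite ge0_fin_numE ?G_ge0.
- exists i.+1%:R; first by rewrite ltr0n.
  by rewrite -lte_fin -GE ?ltr0n.
Qed.

(** The bound [y <= Gr s] keeps [y] in the range of [G], where ['pinv_] is a true inverse and not
    its default value. Since [G] tends to 0, some [T] with [Gr T < y] is the other end point for the
    intermediate value theorem. *)
Lemma Ginv_ge s y : 0 < s -> 0 < y -> y <= Gr s ->
  exists2 t, s <= t & Ginv m g y%:E = t%:E.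
Proof.
move=> s0 y0 ys; have [T T0 Ty] := fine_G_small y0.
have sT : s <= T.
  by rewrite leNgt; apply/negP => /(fine_G_lt T0); lra.
have cG : {within `[s, T], continuous Gr}.
  apply/subspace_continuousP => x /=; rewrite in_itv/= => /andP[sx xT].
  have hs := tail_density_gt0 s0.
  apply/cvgrPdist_lt => e e0; apply/nbhs_ballP; exists (e / h s) => /=.
    by rewrite divr_gt0.
  move=> z; rewrite /ball/= ltr_pdivlMr// => xz; rewrite in_itv/= => /andP[sz _].
  apply: le_lt_trans xz; rewrite mulrC.
  have [xz|zx] := leP x z.
    rewrite [X in _ <= _ * X]distrC (ger0_norm (_ : 0 <= z - x)) ?subr_ge0//.
    have /andP[l u] := fine_G_sub (lt_le_trans s0 sx) xz.
    rewrite ger0_norm; last first.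
      apply: le_trans l; rewrite mulr_ge0 ?subr_ge0// ltW// tail_density_gt0//.
      exact: lt_le_trans sz.
    by apply: (le_trans u); rewrite ler_wpM2r ?subr_ge0// tail_density_le.
  rewrite (ger0_norm (_ : 0 <= x - z)) ?subr_ge0 ?(ltW zx)//.
  have /andP[l u] := fine_G_sub (lt_le_trans s0 sz) (ltW zx).
  rewrite distrC ger0_norm; last first.
    apply: le_trans l; rewrite mulr_ge0 ?subr_ge0 ?(ltW zx)// ltW// tail_density_gt0//.
    exact: lt_le_trans sx.
  by apply: (le_trans u); rewrite ler_wpM2r ?subr_ge0 ?(ltW zx)// tail_density_le.
have [|t] := IVT sT cG (v := y).
  rewrite ge_min le_max ys/= (ltW Ty) orbT//.
rewrite in_itv/= => /andP[st _] Gt; have t0 := lt_le_trans s0 st.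
exists t => //; rewrite /Ginv ifF; last by apply/negbTE; rewrite eqe gt_eqF.
congr (_%:E); rewrite -Gt -GE//.
apply: pinvKV; last by rewrite inE/= in_itv/= andbT.
move=> x z; rewrite !inE/= !in_itv/= !andbT => x0 z0; rewrite !GE// => -[xz].
by have [/(fine_G_lt x0)|/(fine_G_lt z0)|//] := ltgtP x z; rewrite xz ltxx.
Qed.

(** As [q z / z] decreases, each term [q x] is at most twice its integral over []x / 2, x]]. These
    dyadic intervals are adjacent and start at [s / 2], which explains the argument of [G]. *)
Lemma sum_growth_ratio s N : 0 < s ->
  \sum_(j < N) q (2 ^+ j * s) <= 2 * Gr (s / 2).
Proof.
move=> s0.
have p0 j : 0 < 2 ^+ j * s by rewrite mulr_gt0 ?exprn_gt0.
suff : \sum_(j < N) q (2 ^+ j * s) <= 2 * (Gr (s / 2) - Gr (2 ^+ N * s / 2)).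
  by have := @fine_G_ge0 (2 ^+ N * s / 2) (divr_gt0 (p0 N) (ltr0Sn _ 1)); lra.
elim: N => [|N IH]; first by rewrite big_ord0 mul1r subrr mulr0.
rewrite big_ord_recr/=; set x := 2 ^+ N * s in IH *.
have -> : 2 ^+ N.+1 * s / 2 = x by rewrite /x exprS; field.
have x0 : 0 < x by exact: p0.
have x20 : 0 < x / 2 by rewrite divr_gt0.
have xx : x / 2 <= x by lra.
have /andP[+ _] := fine_G_sub x20 xx; rewrite tail_densityE//.
have -> : q x / x * (x - x / 2) = q x / 2 by field; rewrite gt_eqF.
lra.
Qed.

(** A bound on g' would make [g] at most linear and [q] bounded below, so the dyadic sums of [q]
    would exceed the finite value of [G]. The level 2 is an arbitrary starting point. The lemma
    makes g' map onto [g'(0), +oo[. *)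
Lemma derive_nonlinearity_unbounded L : exists2 s, 0 < s & L < g' s.
Proof.
apply: contrapT => nex.
have gL s : 0 < s -> g' s <= L.
  by move=> s0; rewrite leNgt; apply/negP => Ls; apply: nex; exists s.
have L0 : 0 < L by exact: lt_le_trans (derive_nonlinearity_gt0 ltr01) (gL 1 ltr01).
pose c : R := L^-1 `^ m%:R^-1; have c0 : 0 < c by rewrite powR_gt0// invr_gt0.
have qc s : 0 < s -> c <= q s.
  move=> s0; have gs := nonlinearity_gt0 s0.
  apply: ge0_ler_powR; rewrite ?nnegrE ?divr_ge0 ?invr_ge0 ?(ltW L0) ?(ltW s0) ?(ltW gs)//.
  rewrite ler_pdivlMr// mulrC ler_pdivrMr//.
  by apply: (le_trans (nonlinearity_le_derive (ltW s0))); rewrite ler_wpM2l ?gL ?ltW.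
pose N := Num.bound (2 * Gr (2 / 2) / c).
have G0 : 0 <= Gr (2 / 2) by rewrite fine_G_ge0// divr_gt0.
have := archi_boundP (divr_ge0 (mulr_ge0 (ler0n R 2) G0) (ltW c0)).
rewrite -/N ltr_pdivrMr//; apply/negP; rewrite -leNgt.
apply: le_trans (sum_growth_ratio N (ltr0Sn _ 1)).
rewrite -[N in N%:R]card_ord mulr_natl -sumr_const; apply: ler_sum => j _.
by apply: qc; rewrite mulr_gt0 ?exprn_gt0.
Qed.

End nonlinearity_theory.

(** * Legendre transform *)

Section young.
Variables (R : realType) (g : R -> R).
Hypothesis hg : nonlinearity g.
Hypothesis g'_unbounded : forall L, exists2 s, 0 < s & L < derive_ge0 g s.
Local Notation g' := (derive_ge0 g).
Local Notation p := ('pinv_(fun=> 0) `[0, +oo[ g').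

Lemma pinv_deriveK s : 0 <= s -> p (g' s) = s.
Proof.
move=> s0; apply: pinvKV; last by rewrite inE/= in_itv/= andbT.
move=> x y; rewrite !inE/= !in_itv/= !andbT => x0 y0 xy.
have [/(derive_nonlinearity_lt hg x0)|/(derive_nonlinearity_lt hg y0)|//] := ltgtP x y;
  by rewrite xy ltxx.
Qed.

Lemma derive_nonlinearity_surj z : g' 0 <= z -> exists2 s, 0 <= s & g' s = z.
Proof.
move=> z0; have [t t0 zt] := g'_unbounded z.
have [[_ d2 _] _ _ _] := hg.
have [|s] := IVT (ltW t0) (derivable_ge0_continuous (b := t) (lexx 0) d2) (v := z).
  by rewrite ge_min z0/= le_max (ltW zt) orbT.
by rewrite in_itv/= => /andP[s0 _] <-; exists s.
Qed.

Lemma pinv_derive_ge s z : 0 <= s -> g' s <= z -> s <= p z.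
Proof.
move=> s0 sz; have [|t t0 tz] := @derive_nonlinearity_surj z.
  exact: le_trans (derive_nonlinearity_le hg (lexx 0) s0) sz.
rewrite -tz pinv_deriveK// leNgt; apply/negP => /(derive_nonlinearity_lt hg t0).
by rewrite tz ltNge sz.
Qed.

Lemma measurable_pinv_derive (D : set (measurableTypeR R)) : measurable D ->
  D `<=` `[g' 0, +oo[ -> measurable_fun D (EFin \o p).
Proof.
move=> mD D0; apply/measurable_EFinP.
(* Clamping at [g' 0] keeps the argument off the default value of ['pinv_] and makes the function
   monotone on the whole line. *)
apply: (eq_measurable_fun (fun z => p (Num.max (g' 0) z))).
  move=> z; rewrite inE => /D0; rewrite /= in_itv/= andbT => z0.
  by rewrite (max_idPr z0).
apply: nondecreasing_measurable => // x y xy.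
have [|s s0 sx] := @derive_nonlinearity_surj (Num.max (g' 0) x).
  by rewrite le_max lexx.
rewrite -sx pinv_deriveK//; apply: pinv_derive_ge => //.
by rewrite sx ge_max !le_max lexx xy orbT.
Qed.

(* Summation of the one-step bound [p >= g'^-1 (left end point)] over a partition
   of mesh [d] of [0, k d]. *)
Lemma integral_pinv_derive_ge (d : R) k : 0 <= d ->
  ((k%:R * d * g' (k%:R * d) - g (k%:R * d) - d * (g' (k%:R * d) - g' 0))%:E <=
   \int[lebesgue_measure]_(z in `[g' 0, g' (k%:R * d)]) (p z)%:E)%E.
Proof.
move=> d0; elim: k => [|k IH].
  rewrite !mul0r (nonlinearity0 hg) subr0 subrr mulr0 subr0.
  apply: integral_ge0 => z; rewrite /= in_itv/= => /andP[z0 _].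
  by rewrite lee_fin pinv_derive_ge.
have t0 (i : nat) : 0 <= i%:R * d by rewrite mulr_ge0.
have ts : k%:R * d <= k.+1%:R * d by rewrite ler_wpM2r// ler_nat.
set s := k%:R * d in IH ts *; set t := k.+1%:R * d in ts *.
have s0 : 0 <= s by exact: t0.
have t0' : 0 <= t by exact: t0.
have std : t = s + d by rewrite /t /s -natr1; ring.
have g0s := derive_nonlinearity_le hg (lexx 0) s0.
have gst := derive_nonlinearity_le hg s0 ts.
have -> : `[g' 0, g' t]%classic = `[g' 0, g' s]%classic `|` `]g' s, g' t]%classic.
  apply/seteqP; split => z /=; rewrite !in_itv/=.
    by move=> /andP[-> ->]; rewrite andbT/=; case: (leP z (g' s)); [left|right].
  move=> [/andP[-> zs]|/andP[sz ->]]; first by rewrite (le_trans zs).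
  by rewrite andbT ltW// (le_lt_trans g0s).
have sub1 : `[g' 0, g' s] `<=` `[g' 0, +oo[.
  by move=> z /=; rewrite !in_itv/= andbT => /andP[].
have sub2 : `]g' s, g' t] `<=` `[g' 0, +oo[.
  by move=> z /=; rewrite !in_itv/= andbT => /andP[/ltW/(le_trans g0s)].
rewrite ge0_integral_setU//.
- have : ((s * (g' t - g' s))%:E <=
      \int[lebesgue_measure]_(z in `]g' s, g' t]) (p z)%:E)%E.
    have -> : ((s * (g' t - g' s))%:E =
        \int[lebesgue_measure]_(z in `]g' s, g' t]) s%:E)%E.
      rewrite integral_cst//= lebesgue_measure_itv/= lte_fin.
      move: gst; rewrite le_eqVlt => /orP[/eqP->|->] //.
      by rewrite ltxx subrr mulr0 mule0.
    apply: ge0_le_integral => //.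
      exact: measurable_pinv_derive.
    move=> z; rewrite /= in_itv/= => /andP[/ltW sz _].
    by rewrite lee_fin pinv_derive_ge.
  move=> /(leeD IH); apply: le_trans; rewrite -EFinD lee_fin.
  (* After cancellation the inductive step is exactly [g s + d * g' s <= g t], the tangent
     inequality at [s]. *)
  have := nonlinearity_tangent hg t0' s0.
  move: std; move: (g' t) (g' s) (g' 0) (g t) (g s) => a b c e f ->.
  nra.
- by apply: measurable_pinv_derive; [exact: measurableU|rewrite subUset].
- move=> z zst; rewrite lee_fin pinv_derive_ge//.
  have : `[g' 0, +oo[%classic z by case: zst => [/sub1|/sub2].
  by rewrite /= in_itv/= andbT.
- apply/disj_setPS => z [] /=; rewrite !in_itv/= => /andP[_ zs] /andP[sz _].
  by rewrite ltNge zs in sz.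
Qed.

(** Above [g' 0], the left side is largest at the [t] with [g' t = xi], by the tangent inequality at
    [t]. For this [t] the lower sums of mesh [t / k] bound the integral up to an error
    [t * (g' t - g' 0) / k], which tends to 0. For [xi <= g' 0] the tangent at 0 suffices. *)
Lemma young_legendre (s xi : R) : 0 <= s ->
  ((s * xi - g s)%:E <= legendre g xi)%E.
Proof.
move=> s0; rewrite /legendre; case: ifPn => [gxi|]; last first.
  rewrite -leNgt => xig; rewrite lee_fin.
  have := nonlinearity_tangent hg s0 (lexx 0); rewrite (nonlinearity0 hg) add0r subr0.
  have := ler_wpM2l s0 xig; lra.
have [t t0 txi] := derive_nonlinearity_surj (ltW gxi).
suff : ((t * xi - g t)%:E <=
    \int[lebesgue_measure]_(z in `[g' 0, xi]) (p z)%:E)%E.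
  apply: le_trans; rewrite lee_fin -txi.
  have := nonlinearity_tangent hg s0 t0; lra.
rewrite -txi; case E : (\int[_]_(_ in _) _)%E => [r||].
- rewrite lee_fin; apply/ler_addgt0Pl => e e0.
  pose D := t * (g' t - g' 0).
  have D0 : 0 <= D by rewrite mulr_ge0 ?subr_ge0 ?derive_nonlinearity_le.
  pose k := (Num.bound (D / e)).+1.
  have k0 : (0 : R) < k%:R by rewrite ltr0n.
  have kE : k%:R * (t / k%:R) = t by field; rewrite gt_eqF.
  have := @integral_pinv_derive_ge (t / k%:R) k (divr_ge0 t0 (ltW k0)).
  rewrite kE E lee_fin => h.
  suff : t / k%:R * (g' t - g' 0) <= e by lra.
  rewrite mulrAC ler_pdivrMr// -/D [leRHS]mulrC -ler_pdivrMr//.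
  apply: ltW; apply: (lt_trans (archi_boundP (divr_ge0 D0 (ltW e0)))).
  by rewrite ltr_nat.
- by rewrite leey.
- have : (0 <= \int[lebesgue_measure]_(z in `[g' 0, g' t]) (p z)%:E)%E.
    apply: integral_ge0 => z; rewrite /= in_itv/= => /andP[z0 _].
    by rewrite lee_fin pinv_derive_ge.
  by rewrite E.
Qed.

(** Young's inequality at [y^-1], multiplied by [y]. It will be read with [y = f x] and [s] the
    absolute value of [u]. *)
Lemma young_gamma_inv (s y : R) : 0 <= s -> 0 <= y ->
  ((s - y * g s)%:E <= gamma_inv g y)%E.
Proof.
move=> s0 y0; rewrite /gamma_inv; case: eqVneq => [_|yn0]; first by rewrite leey.
have {yn0}y0 : 0 < y by rewrite lt_neqAle eq_sym yn0.
rewrite /gamma invrK.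
have -> : ((s - y * g s)%:E = (s * y^-1 - g s)%:E * y%:E)%E.
  by rewrite -EFinM; congr (_%:E); field; rewrite gt_eqF.
by rewrite lee_pmul2r ?lte_fin//; exact: young_legendre.
Qed.

End young.

(** * Keller-Osserman iteration *)

Section keller_osserman.
Variables (R : realType) (g : R -> R) (m : nat).
Hypothesis hg : nonlinearity g.
Hypothesis m0 : (0 < m)%N.
Hypothesis hgint : (\int[lebesgue_measure]_(z in `[1%R, +oo[)
  (g z `^ (- m%:R^-1) * z `^ (m%:R^-1 - 1))%:E < +oo)%E.
(** [J r] models the integral of f g(|u|) over the shell between [r] and the fixed outer radius
    [R0], and [I r1 r2] that of |u| over the shell between [r1] and [r2]. *)
Variables (J : R -> R) (I : R -> R -> R) (R0 K K0 : R).
Hypotheses (K_gt0 : 0 < K) (K0_gt0 : 0 < K0) (R0_gt0 : 0 < R0).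
Hypothesis J_ge0 : forall r, 0 < r -> 0 <= J r.
Hypothesis J_le : forall r1 r2, 0 < r1 -> r1 <= r2 -> r2 <= R0 -> J r2 <= J r1.
Hypothesis JI : forall r1 r2, 0 < r1 -> r1 < r2 -> r2 <= R0 ->
  J r2 <= K * I r1 r2 / (r2 - r1) ^+ m + K0.

(* Each time [J] reaches [F^m M g(s)], it reaches [F^m M g(2 s)] after a further
   decrease of the radius by [(4 K s / (F^m g s))^(1/m)]; the sum of these steps is
   at most a multiple of [G (s / 2) / F]. *)
Lemma keller_osserman_step (r F M s : R) :
  0 < r -> r <= R0 -> 0 < F -> 0 < M -> 0 < s -> 2 * K0 <= J r ->
  (forall r1 r2 t, 0 < r1 -> r1 < r2 -> r2 <= r -> 0 <= t -> t * M <= I r1 r2 ->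
     F ^+ m * M * g t <= J r1 - J r2) ->
  s * M <= I (r / 2) r ->
  r * F / (4 * (4 * K) `^ m%:R^-1) <= fine (G m g (s / 2)).
Proof.
move=> r0 rR F0 M0 s0 Jr jen sI; rewrite leNgt; apply/negP => lt.
set kap := (4 * K) `^ m%:R^-1 in lt.
have kap0 : 0 < kap by rewrite powR_gt0// mulr_gt0.
have mn0 : m%:R != 0 :> R by rewrite pnatr_eq0 -lt0n.
have powm (x : R) : 0 <= x -> (x `^ m%:R^-1) ^+ m = x.
  by move=> x0; rewrite -powR_mulrn ?powR_ge0// -powRrM mulVf// powRr1.
pose S N := \sum_(j < N) growth_ratio g m (2 ^+ j * s).
(* [rho N] is the radius after [N] steps starting from [r / 2]. Its lower bound [rhoi] comes from
   [sum_growth_ratio] and is positive precisely by the negated conclusion. *)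
pose rho N := r / 2 - kap / F * S N.
pose rhoi := r / 2 - kap / F * (2 * fine (G m g (s / 2))).
have rhoi0 : 0 < rhoi.
  rewrite /rhoi subr_gt0.
  have -> : kap / F * (2 * fine (G m g (s / 2))) =
     fine (G m g (s / 2)) * (4 * kap) / F / 2 by field; rewrite gt_eqF.
  by rewrite ltr_pM2r ?invr_gt0// ltr_pdivrMr// -ltr_pdivlMr// mulr_gt0.
have rhoP N : rhoi <= rho N.
  rewrite lerD2l lerN2 ler_pM2l ?divr_gt0//.
  exact: (sum_growth_ratio hg hgint).
have rho_gt0 N : 0 < rho N by exact: lt_le_trans (rhoP N).
have sj0 j : 0 < 2 ^+ j * s by rewrite mulr_gt0 ?exprn_gt0.
have rhoS N : rho N.+1 = rho N - kap / F * growth_ratio g m (2 ^+ N * s).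
  by rewrite /rho /S big_ord_recr/=; ring.
have tau0 N : 0 < kap / F * growth_ratio g m (2 ^+ N * s).
  by rewrite mulr_gt0 ?divr_gt0//; exact: growth_ratio_gt0.
have rho_le N : rho N <= r / 2.
  elim: N => [|N IH]; first by rewrite /rho /S big_ord0 mulr0 subr0.
  by rewrite rhoS; have := tau0 N; lra.
have Jrho N : F ^+ m * M * g (2 ^+ N * s) <= J (rho N).
  elim: N => [|N IH].
    rewrite /rho /S big_ord0 mulr0 subr0 mul1r.
    have r20 : 0 < r / 2 by rewrite divr_gt0.
    have := jen (r / 2) r s r20 _ (lexx r) (ltW s0) sI.
    have -> : r / 2 < r by lra.
    by move=> /(_ isT); have := J_ge0 r0; lra.
  have g0 := nonlinearity_gt0 hg (sj0 N).
  set x := 2 ^+ N * s in IH g0 *.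
  have x0 : 0 < x by exact: sj0.
  have lt' : rho N.+1 < rho N by rewrite rhoS; have := tau0 N; lra.
  have rNR : rho N <= R0 by have := rho_le N; lra.
  (* [K0] is thus at most half of J, and absorbing it in the left side of [JI] only doubles the
     other term. *)
  have JN : 2 * K0 <= J (rho N).
    apply: (le_trans Jr); apply: J_le => //.
    by have := rho_le N; lra.
  have := JI (rho_gt0 N.+1) lt' rNR.
  (* In the constant [4 * K], one factor 2 pays for the absorption of [K0] and the other for the
     doubling of [x]. *)
  have -> : (rho N - rho N.+1) ^+ m = 4 * K / F ^+ m * (x / g x).
    rewrite rhoS opprB addrC subrK -/x !exprMn exprVn /growth_ratio.
    rewrite (powm (x / g x)) ?divr_ge0 ?(ltW x0) ?(ltW g0)//.
    by rewrite /kap powm// mulr_ge0 ?(ltW K_gt0).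
  set i := I _ _; set Fm := F ^+ m in IH *.
  have Fm0 : 0 < Fm by rewrite exprn_gt0.
  have -> : K * i / (4 * K / Fm * (x / g x)) = i * (Fm * g x) / (4 * x).
    by field; rewrite !gt_eqF.
  move=> h; have {}h : J (rho N) <= i * (Fm * g x) / (2 * x).
    have -> : i * (Fm * g x) / (2 * x) = 2 * (i * (Fm * g x) / (4 * x)).
      by field; rewrite gt_eqF.
    lra.
  (* The step is so short that keeping J at the level [Fm * M * g x] forces |u| to have mean at
     least [2 * x] relative to [M] on this shell; Jensen's inequality then gives the next level. *)
  have iM : 2 * x * M <= i.
    move: (le_trans IH h); rewrite ler_pdivlMr ?mulr_gt0//.
    have -> : Fm * M * g x * (2 * x) = (2 * x * M) * (Fm * g x) by ring.
    by rewrite ler_pM2r ?mulr_gt0.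
  have := jen _ _ (2 * x) (rho_gt0 N.+1) lt' _ _ iM.
  have -> : 2 ^+ N.+1 * s = 2 * x by rewrite /x exprS mulrA.
  have -> : rho N <= r by have := rho_le N; lra.
  have -> : 0 <= 2 * x by rewrite mulr_ge0 ?ltW.
  by move=> /(_ isT isT); rewrite -/Fm; have := J_ge0 (rho_gt0 N); lra.
pose A := F ^+ m * M * g s.
have A0 : 0 < A by rewrite !mulr_gt0 ?exprn_gt0// nonlinearity_gt0.
have rhoiR : rhoi <= R0 by have := rhoP 0%N; have := rho_le 0%N; lra.
(* [N] exceeds [J rhoi / A], while the [N]-th level is at least [2 ^+ N * A] by superlinearity,
   hence at least [N * A]. *)
pose N := Num.bound (J rhoi / A).
have := archi_boundP (divr_ge0 (J_ge0 rhoi0) (ltW A0)).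
rewrite -/N ltr_pdivrMr//; apply/negP; rewrite -leNgt.
have rNR : rho N <= R0 by have := rho_le N; lra.
apply: le_trans (J_le rhoi0 (rhoP N) rNR).
apply: le_trans (Jrho N).
apply: (@le_trans _ _ (2 ^+ N * A)).
  by rewrite ler_pM2r// -natrX ler_nat ltnW// ltn_expl.
by rewrite /A mulrCA ler_pM2l ?mulr_gt0 ?exprn_gt0//; apply: nonlinearity_pow2 => //; exact: ltW.
Qed.

Variables (e D : R).
Hypothesis D_gt0 : 0 < D.
(** The first alternative stands for null shells, over which the essential infimum is +oo. In the
    second, [F ^+ m] is a lower bound of [f], [D * r ^ e] an upper bound of the measure of the
    shell, and the middle inequality is Jensen's. *)
Hypothesis hG : forall C, 0 < C -> exists B d, 0 < d /\ forall r, 0 < r -> r < d ->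
  (forall r1 r2, 0 < r1 -> r1 < r2 -> r2 <= r -> I r1 r2 <= 0) \/
  exists F, [/\ 0 < F,
    forall r1 r2 t, 0 < r1 -> r1 < r2 -> r2 <= r -> 0 <= t ->
      t * (D * r `^ e) <= I r1 r2 ->
      F ^+ m * (D * r `^ e) * g t <= J r1 - J r2
    & ((r `^ (e - m%:R))%:E * Ginv m g (C * r * F)%:E <= B%:E)%E].

(** Unless [J r] is below [2 * K0], the iteration bounds [G (s / 2)] from below, where [s] is I(r /
    2, r) divided by [M]. The growth condition turns this into an upper bound for [s] which says
    that I(r / 2, r) is O(r^m), and one more use of [JI] on the shell from [r / 2] to [r] bounds
    [J r]. *)
Lemma keller_osserman_bounded :
  exists B, forall r, 0 < r -> r <= R0 -> J r <= B.
Proof.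
pose kap := (4 * K) `^ m%:R^-1.
have kap0 : 0 < kap by rewrite powR_gt0// mulr_gt0.
(* This [C] makes the argument of [Ginv] equal to the lower bound for [G (s / 2)] in
   [keller_osserman_step]. *)
have C0 : 0 < (4 * kap)^-1 by rewrite invr_gt0 mulr_gt0.
have [B [d [d0 dP]]] := hG C0.
pose B1 := 2 * K0 + K * (2 * `|B| * D) * 2 ^+ m.
have B1K : K0 <= B1 /\ 2 * K0 <= B1 /\ K * (2 * `|B| * D) * 2 ^+ m + K0 <= B1.
  have : 0 <= K * (2 * `|B| * D) * 2 ^+ m by rewrite !mulr_ge0 ?exprn_ge0 ?(ltW K_gt0) ?(ltW D_gt0).
  rewrite /B1; move: (K * _ * _) => X X0; have K0' := K0_gt0; split; [|split]; lra.
have small r : 0 < r -> r < d -> r <= R0 -> J r <= B1.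
  move=> r0 rd rR.
  have [Jr|Jr] := leP (2 * K0) (J r); last by case: B1K => _ []; lra.
  have r20 : 0 < r / 2 by rewrite divr_gt0.
  have r2r : r / 2 < r by lra.
  have := JI r20 r2r rR.
  have -> : r - r / 2 = r / 2 by field.
  have rm0 : 0 < (r / 2) ^+ m by rewrite exprn_gt0.
  have [I0|I0] := leP (I (r / 2) r) 0.
    have : K * I (r / 2) r / (r / 2) ^+ m <= 0.
      by rewrite pmulr_lle0 ?invr_gt0// pmulr_rle0.
    by case: B1K; lra.
  case: (dP r r0 rd) => [nI|[F [F0 jen GB]]].
    by have := nI _ _ r20 r2r (lexx _); lra.
  set M := D * r `^ e in jen.
  have M0 : 0 < M by rewrite mulr_gt0 ?powR_gt0.
  pose s := I (r / 2) r / M; have s0 : 0 < s by rewrite divr_gt0.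
  have sM : s * M = I (r / 2) r by rewrite divfK ?gt_eqF.
  have := keller_osserman_step r0 rR F0 M0 s0 Jr jen.
  rewrite sM => /(_ (lexx _)) => GF.
  have y0 : 0 < (4 * kap)^-1 * r * F by rewrite !mulr_gt0.
  have s20 : 0 < s / 2 by rewrite divr_gt0.
  have [|t st tE] := Ginv_ge hg hgint s20 y0.
    apply: le_trans GF; rewrite le_eqVlt; apply/orP; left; apply/eqP.
    by rewrite -/kap; field; rewrite gt_eqF.
  move: GB; rewrite tE -EFinM lee_fin => GB.
  have IB : I (r / 2) r <= 2 * `|B| * D * r ^+ m.
    rewrite -sM /M.
    have -> : r `^ e = r `^ (e - m%:R) * r ^+ m.
      by rewrite -powR_mulrn ?(ltW r0)// -powRD ?subrK// (gt_eqF r0) implybT.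
    have -> : s * (D * (r `^ (e - m%:R) * r ^+ m)) =
        (r `^ (e - m%:R) * (s / 2)) * (2 * D * r ^+ m) by field.
    have -> : 2 * `|B| * D * r ^+ m = `|B| * (2 * D * r ^+ m) by ring.
    rewrite ler_wpM2r ?mulr_ge0 ?exprn_ge0 ?(ltW D_gt0) ?(ltW r0)//.
    apply: le_trans (ler_norm B); apply: le_trans GB.
    by rewrite ler_wpM2l ?powR_ge0.
  move=> /le_trans; apply.
  apply: (@le_trans _ _ (K * (2 * `|B| * D) * 2 ^+ m + K0)); last by case: B1K => _ [].
  rewrite lerD2r -!mulrA ler_wpM2l ?(ltW K_gt0)//.
  rewrite ler_pdivrMr// expr_div_n !mulrA [X in _ <= X](_ : _ = 2 * `|B| * D * r ^+ m)//.
  by field; rewrite expf_neq0.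
pose d' := Num.min (d / 2) R0.
have d'0 : 0 < d' by rewrite lt_min divr_gt0.
exists B1 => r r0 rR.
have [rd|dr] := leP r d'.
  apply: small => //; move: rd; rewrite /d' le_min => /andP[+ _]; lra.
apply: (le_trans (J_le d'0 (ltW dr) rR)); apply: small => //.
  rewrite /d' gt_min; apply/orP; left; lra.
by rewrite /d' ge_min lexx orbT.
Qed.

End keller_osserman.

(** * Shells around the singular set *)

Section geometry.
Variables (R : realType) (n : nat).
Implicit Types (S : set 'rV[R]_n).

Lemma compact_tube_subset S (Omega : set 'rV[R]_n) : compact S -> open Omega ->
  S `<=` Omega -> exists2 r, 0 < r & tube S r `<=` Omega.
Proof.
move=> /compact_near_coveringP cS oO SO.
have /cS : forall x, S x -> \forall x' \near x & r \near 0^'+,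
    forall y, euclid_dist y x' < r -> Omega y.
  move=> x /SO Ox.
  have /nbhs_ballP[e /= e0 xeO] : nbhs x Omega by exact: open_nbhs_nbhs.
  have e20 : 0 < e / 2 by rewrite divr_gt0.
  exists (ball x (e / 2), [set r | r < e / 2]); first split => /=.
  - exact: nbhsx_ballx.
  - exact: nbhs_right_lt.
  move=> [x' r] [/= xx' re] y yx'; apply: xeO; split => // i j.
  rewrite ord1; have := coord_le_euclid_dist y x' j.
  case: xx' => _ /(_ ord0 j); rewrite /ball/= => h1 h2.
  have := ler_normD (x ord0 j - x' ord0 j) (x' ord0 j - y ord0 j).
  rewrite addrA subrK [`|x' _ _ - _|]distrC; lra.
move=> nr; have : \forall r \near 0^'+, 0 < r /\ (S `<=` fun x' =>
    forall y, euclid_dist y x' < r -> Omega y).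
  near=> r; split; near: r; [exact: nbhs_right_gt|exact: nr].
move=> /filter_ex[r [r0 rP]]; exists r => // y /tubeP[x Sx]; exact: rP.
Unshelve. all: by end_near. Qed.

(** A point of [S] nearest to [x] is not interior: [q t], slightly closer to [x], would still belong
    to [S]. Hence the dimension of the boundary controls the shells even when [S] has interior
    points. *)
Lemma tube_boundary S (r : R) : compact S -> tube S r `\` S `<=` tube (boundary S) r.
Proof.
move=> cS x [/tubeP[y Sy xy] nSx].
have S0 : S !=set0 by exists y.
have c : {within S, continuous (fun z : 'rV[R]_n => euclid_dist z x)}.
  exact/continuous_subspaceT/continuous_euclid_dist.
have [p] := compact_EVT_min S0 cS c; rewrite inE => Sp pmin.
apply/tubeP; exists p; last first.
  apply: le_lt_trans xy; rewrite euclid_distC [leRHS]euclid_distC.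
  by apply: pmin; rewrite inE.
split; first exact: subset_closure.
move=> ip.
have px0 : 0 < euclid_dist p x.
  rewrite lt_neqAle euclid_dist_ge0 andbT; apply/negP => /eqP px.
  apply: nSx; suff <- : p = x by [].
  apply/rowP => i; have := coord_le_euclid_dist p x i.
  by rewrite -px normr_le0 subr_eq0 => /eqP.
pose q (t : R) : 'rV[R]_n := p + t *: (x - p).
have cq : q t @[t --> 0^'+] --> p.
  apply: cvg_at_right_filter.
  have c1 : t *: (x - p) @[t --> (0 : R)] --> (0 : R) *: (x - p).
    by apply: cvgZr_tmp; exact: cvg_id.
  have pE : p + (0 : R) *: (x - p) = p by rewrite scale0r addr0.
  rewrite -[X in _ --> X]pE; exact: (cvgD (cvg_cst p) c1).
have := cq _ ip; rewrite /= => near_q.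
have : \forall t \near 0^'+, [/\ 0 < t, t < 1 & S (q t)].
  have lt1 : \forall t \near (0 : R)^'+, t < 1 by exact: nbhs_right_lt.
  near=> t; split; near: t => //; first exact: nbhs_right_gt.
move=> /filter_ex[t [t0 t1 Sq]].
have := pmin (q t); rewrite inE => /(_ Sq); apply/negP; rewrite -ltNge.
have -> : euclid_dist (q t) x = (1 - t) * euclid_dist p x.
  rewrite /euclid_dist -[1 - t]ger0_norm; last lra.
  rewrite -sqrtr_sqr -sqrtrM ?sqr_ge0// mulr_sumr; congr Num.sqrt.
  by apply: eq_bigr => i _; rewrite /q !mxE; ring.
by rewrite gtr_pMl// ltrBlDr ltrDl.
Unshelve. all: by end_near. Qed.

Lemma subset_tube_compl S (x : 'rV[R]_n) : closed S -> ~ S x ->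
  exists i : nat, ~ tube S i.+1%:R^-1 x.
Proof.
move=> cS nSx.
have : nbhs x (~` S) by apply: open_nbhs_nbhs; split => //; exact: closed_openC.
move=> /nbhs_ballP[e /= e0 xeS].
have [i _ iP] := near_infty_natSinv_lt (PosNum e0).
exists i => /tubeP[y Sy xy]; apply: (xeS y) => //; split => // j l; rewrite ord1 /ball/=.
apply: le_lt_trans (coord_le_euclid_dist x y l) _.
by apply: lt_trans xy (iP i _) => /=.
Qed.

Lemma closure_tube S (r1 r2 : R) : r1 < r2 -> closure (tube S r1) `<=` tube S r2.
Proof.
move=> r12 x xc.
have d0 : euclid_dist x x < r2 - r1 by rewrite euclid_distxx subr_gt0.
have := @continuous_euclid_dist R n x x => /cvgr_lt /(_ _ d0) /xc.
move=> [y [/tubeP[z Sz yz] /= yx]]; apply/tubeP; exists z => //.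
by have := euclid_dist_triangle x y z; rewrite (euclid_distC x y); lra.
Qed.

Lemma coord_bounded_compact (A : set 'rV[R]_n) (M : R) : closed A ->
  (forall x i, A x -> `|x ord0 i| <= M) -> compact A.
Proof.
move=> cA AM; apply: (@subclosed_compact _ _
  [set x : 'rV[R]_n | forall i, `[- M, M]%classic (x ord0 i)]) => //.
  by apply: (@rV_compact _ _ (fun=> `[- M, M]%classic)) => i; exact: segment_compact.
by move=> x Ax i; rewrite /= in_itv/= -ler_norml AM.
Qed.

Lemma tube_coord_bounded S (r M : R) : (forall y i, S y -> `|y ord0 i| <= M) ->
  forall x i, tube S r x -> `|x ord0 i| <= M + r.
Proof.
move=> SM x i /tubeP[y Sy xy]; have := SM y i Sy.
have := coord_le_euclid_dist x y i.
have := ler_normD (x ord0 i - y ord0 i) (y ord0 i); rewrite subrK; lra.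
Qed.

End geometry.

(** * One-sided upper and lower limits, essential infima *)

Section limits_at_zero.
Variables (R : realType) (f : R -> \bar R).

Lemma limf_esup_right_lty : (limf_esup f 0^'+ < +oo)%E ->
  exists B d, 0 < d /\ forall r, 0 < r -> r < d -> (f r <= B%:E)%E.
Proof.
rewrite /limf_esup => /ereal_inf_lt[_ [V /= V0 <-]] VB.
have /nbhs_ballP[d /= d0 dV] := V0.
exists (fine (ereal_sup [set f x | x in V])), d; split => // r r0 rd.
have fr : (f r <= ereal_sup [set f x | x in V])%E.
  apply: ereal_sup_ubound; exists r => //; apply: dV => //.
  by rewrite /ball/= sub0r normrN gtr0_norm.
case: (ereal_sup _) VB fr => [s| |] //= _ fr.
by apply: (le_trans fr); rewrite leNye.
Qed.

Lemma limf_einf_right_gt0 : (0 < limf_einf f 0^'+)%E ->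
  exists c d, [/\ 0 < c, 0 < d & forall r, 0 < r -> r < d -> (c%:E <= f r)%E].
Proof.
rewrite limf_einfE => /ereal_sup_gt[_ [V /= V0 <-]] V0'.
have /nbhs_ballP[d /= d0 dV] := V0.
have fr r : 0 < r -> r < d -> (ereal_inf [set f x | x in V] <= f r)%E.
  move=> r0 rd; apply: ereal_inf_lbound; exists r => //; apply: dV => //.
  by rewrite /ball/= sub0r normrN gtr0_norm.
case: (ereal_inf _) V0' fr => [c| |//] /= c0 fr.
  by exists c, d; split.
by exists 1, d; split => // r r0 rd; apply: le_trans (fr r r0 rd); rewrite leey.
Qed.

End limits_at_zero.

Section essential_infimum_on.
Variables (R : realType) (n : nat).
Variables (D : set (rV_leb R n)) (f : rV_leb R n -> R).
Hypothesis mD : measurable D.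

Lemma essinf_on_le : {ae @mes R n, forall x, D x -> (essinf_on D f <= (f x)%:E)%E}.
Proof.
have := ess_inf_le (@mes R n) (patch (fun=> +oo%E) D (EFin \o f)).
by apply: filterS => x + Dx; rewrite /patch mem_set.
Qed.

Lemma essinf_on_ge0 : (forall x, D x -> 0 <= f x) -> (0 <= essinf_on D f)%E.
Proof.
move=> f0; apply/ess_infP; apply: nearW => x; rewrite /patch.
by case: ifPn => [|_]; [rewrite inE => Dx; rewrite lee_fin f0|rewrite leey].
Qed.

(** As [f] takes real values, every point of [D] lies in the exceptional null set. *)
Lemma essinf_on_eqy : essinf_on D f = +oo%E -> mes D = 0%E.
Proof.
move=> /ess_inf_eqyP [N [mN N0 DN]]; apply: (subset_measure0 mD mN _ N0).
by move=> x Dx; apply: DN => /=; rewrite /patch mem_set.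
Qed.

End essential_infimum_on.

(** * Jensen's inequality with a weight bounded below *)

Section jensen.
Context d (T : measurableType d) (R : realType) (mu : {measure set T -> \bar R}).
Variable g : R -> R.
Hypothesis hg : nonlinearity g.

(** The tangent inequality at [t] is multiplied by the lower bound [c] of the weight and integrated
    over [D]. An upper bound [M] may replace the measure of [D], because the constant [b]
    multiplying it is nonnegative. *)
Lemma jensen_weighted (D : set T) (f v : T -> R) (c M t : R) :
  measurable D -> measurable_fun D v -> measurable_fun D (fun x => f x * g `|v x|) ->
  (forall x, D x -> 0 <= f x) ->
  {ae mu, forall x, D x -> c <= f x} -> 0 <= c -> (mu D <= M%:E)%E -> 0 <= t ->
  ((t * M)%:E <= \int[mu]_(x in D) `|v x|%:E)%E ->
  ((c * M * g t)%:E <= \int[mu]_(x in D) (f x * g `|v x|)%:E)%E.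
Proof.
move=> mD mv mw f0 cf c0 muM t0 tM.
have g0 x : 0 <= g `|v x| by exact: nonlinearity_ge0.
have w0 x : D x -> 0 <= f x * g `|v x| by move=> Dx; rewrite mulr_ge0 ?f0.
have W0 : (0 <= \int[mu]_(x in D) (f x * g `|v x|)%:E)%E.
  by apply: integral_ge0 => x Dx; rewrite lee_fin w0.
have [E|W] := eqVneq (\int[mu]_(x in D) (f x * g `|v x|)%:E)%E +oo%E.
  by rewrite E leey.
have M0 : 0 <= M by have := le_trans (measure_ge0 mu D) muM; rewrite lee_fin.
move: t0; rewrite le_eqVlt => /orP[/eqP t0|t0].
  by rewrite -t0 (nonlinearity0 hg) mulr0.
have gt0 := derive_nonlinearity_gt0 hg t0.
(* The constant part of the tangent is moved to the other side, so that both integrands below are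
   nonnegative and integrability of [v] is not at issue. *)
pose b := c * (t * derive_ge0 g t - g t).
have b0 : 0 <= b.
  by rewrite mulr_ge0// subr_ge0; exact: (nonlinearity_le_derive hg (ltW t0)).
have : (\int[mu]_(x in D) ((c * derive_ge0 g t)%:E * `|v x|%:E) <=
    \int[mu]_(x in D) ((f x * g `|v x|)%:E + b%:E))%E.
  apply: ae_ge0_le_integral => //.
  - by move=> x _; rewrite -EFinM lee_fin !mulr_ge0// ltW.
  - apply: measurable_funeM; apply/measurable_EFinP; exact: measurableT_comp.
  - by move=> x Dx; rewrite -EFinD lee_fin addr_ge0// w0.
  - by apply: emeasurable_funD => //; apply/measurable_EFinP.
  apply: filterS cf => x cf Dx; rewrite -EFinM -EFinD lee_fin.
  have := nonlinearity_tangent hg (normr_ge0 (v x)) (ltW t0).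
  move=> /(ler_wpM2l c0); have := ler_wpM2r (g0 x) (cf Dx); rewrite /b; nra.
rewrite ge0_integralZl//; last 2 first.
- by apply/measurable_EFinP; exact: measurableT_comp.
- by rewrite lee_fin mulr_ge0// ltW.
rewrite ge0_integralD//; last exact/measurable_EFinP.
rewrite integral_cst// => le1.
have {le1} : ((c * derive_ge0 g t)%:E * (t * M)%:E <=
    \int[mu]_(x in D) (f x * g `|v x|)%:E + b%:E * M%:E)%E.
  apply: le_trans (le_trans le1 _).
    by rewrite lee_wpmul2l// lee_fin mulr_ge0// ltW.
  by rewrite leeD2l// lee_wpmul2l// lee_fin.
case: (\int[mu]_(x in D) _)%E W W0 => [r| |]//= _ _.
rewrite -!EFinM -EFinD !lee_fin /b; nra.
Qed.

End jensen.

(** * Weak inequalities tested with cutoffs *)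

Section test_functions.
Variables (R : realType) (n : nat).
Implicit Types (U : set 'rV[R]_n) (phi : 'rV[R]_n -> R).

Lemma partials_out_of_support phi s x :
  ~ closure [set x | phi x != 0] x -> partials s phi x = 0.
Proof.
move=> nx; rewrite (@partials_eq_open _ _ (~` closure [set x | phi x != 0])
  phi (fun=> 0) s x) //.
- by rewrite (smooth_cst _ _).2; case: s.
- exact/closed_openC/closed_closure.
- move=> y ny; apply/eqP; apply: contrapT => /negP y0; apply: ny.
  exact: subset_closure.
Qed.

Lemma test_function_partials_out U phi s x :
  test_function U phi -> ~ U x -> partials s phi x = 0.
Proof.
by move=> [_ _ sU] nUx; apply: partials_out_of_support => /sU.
Qed.

Lemma test_function_partials_bounded U phi s : test_function U phi ->
  exists B, 0 <= B /\ forall x, `|partials s phi x| <= B.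
Proof.
move=> [sphi csupp _]; set K := closure _ in csupp.
have [K0|K0] := pselect (K !=set0); last first.
  exists 0; split => // x; rewrite partials_out_of_support ?normr0// => Kx.
  by apply: K0; exists x.
have c : {within K, continuous (fun x => `|partials s phi x|)}.
  apply: continuous_subspaceT => x.
  by apply: (continuous_comp (@smooth_continuous _ _ phi s sphi x));
     exact: (@norm_continuous R R^o).
have [z _ zP] := compact_EVT_max K0 csupp c.
exists `|partials s phi z|; split => // x; have [Kx|Kx] := pselect (K x).
  by apply: zP; rewrite inE.
by rewrite partials_out_of_support// normr0.
Qed.

Lemma partials_cst_on_open U phi (c : R) s x : open U ->
  (forall y, U y -> phi y = c) -> U x -> s != [::] -> partials s phi x = 0.
Proof.
move=> oU phic Ux s0; rewrite (partials_eq_open s oU (g := fun=> c) phic Ux).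
by rewrite (smooth_cst _ _).2; case: s s0.
Qed.

End test_functions.

Section integrals_of_patches.
Context d (T : measurableType d) (R : realType) (mu : {measure set T -> \bar R}).
Local Open Scope ereal_scope.

Lemma measurable_fun_patch (D E : set T) (h : T -> R) : measurable D ->
  measurable E -> measurable_fun D h -> measurable_fun D (h \_ E).
Proof.
move=> mD mE mh; apply/(measurable_restrict _ mE mD).
by apply: measurable_funS mh => //; exact: subIsetl.
Qed.

Lemma integral_patch2 (D E1 E2 : set T) (h1 h2 : T -> R) (c1 c2 : R) :
  measurable D -> measurable E1 -> measurable E2 -> E1 `<=` D -> E2 `<=` D ->
  measurable_fun D h1 -> measurable_fun D h2 ->
  (forall x, D x -> 0 <= h1 x)%R -> (forall x, D x -> 0 <= h2 x)%R ->
  (0 <= c1)%R -> (0 <= c2)%R ->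
  \int[mu]_(x in D) (c1 * (h1 \_ E1) x + c2 * (h2 \_ E2) x)%:E =
  c1%:E * \int[mu]_(x in E1) (h1 x)%:E + c2%:E * \int[mu]_(x in E2) (h2 x)%:E.
Proof.
move=> mD mE1 mE2 E1D E2D mh1 mh2 h10 h20 c10 c20.
have one (E : set T) (h : T -> R) : measurable E -> E `<=` D -> measurable_fun D h ->
    (forall x, D x -> 0 <= h x)%R ->
    [/\ measurable_fun D (h \_ E), forall x, D x -> (0 <= (h \_ E) x)%R &
     \int[mu]_(x in D) ((h \_ E) x)%:E = \int[mu]_(x in E) (h x)%:E].
  move=> mE ED mh h0; split.
  - exact: measurable_fun_patch.
  - by move=> x Dx; rewrite patchE; case: ifPn => // _; exact: h0.
  - rewrite -[in RHS](setIidr ED) [RHS]integral_mkcondr; apply: eq_integral => x _.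
    by rewrite !patchE; case: ifPn.
have [m1 p1 <-] := one _ _ mE1 E1D mh1 h10.
have [m2 p2 <-] := one _ _ mE2 E2D mh2 h20.
under eq_integral do rewrite EFinD !EFinM.
rewrite ge0_integralD//.
- by rewrite !ge0_integralZl//; apply/measurable_EFinP.
- by move=> x Dx; rewrite -EFinM lee_fin mulr_ge0// p1.
- by apply: measurable_funeM; apply/measurable_EFinP.
- by move=> x Dx; rewrite -EFinM lee_fin mulr_ge0// p2.
- by apply: measurable_funeM; apply/measurable_EFinP.
Qed.

End integrals_of_patches.

Section weak_solutions.
Variables (R : realType) (m n : nat).
Hypothesis m_gt0 : (0 < m)%N.
Variables (Omega S : set 'rV[R]_n).
Hypotheses (oOmega : open Omega) (cS : compact S) (SOmega : S `<=` Omega).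
Variable a : multi_index m n -> 'rV[R]_n -> R -> R.
Hypothesis ha : forall alpha : multi_index m n, mi_order alpha = m ->
  caratheodory_function Omega (a alpha).
Variable A : R.
Hypothesis A_gt0 : 0 < A.
Hypothesis haA : forall alpha : multi_index m n, mi_order alpha = m ->
  {ae @mes R n, forall x, Omega x -> forall z : R, `|a alpha x z| <= A * `|z|}.
Variable f : 'rV[R]_n -> R.
Hypothesis f_ge0 : forall x, Omega x -> 0 <= f x.
Variable g : R -> R.
Hypothesis hg : nonlinearity g.
Variable u : 'rV[R]_n -> R.
Hypothesis hu : weak_solution Omega S a f g u.

Local Notation T := (rV_leb R n).

Definition zero_ext : 'rV[R]_n -> R := u \_ (~` S).
Local Notation v := zero_ext.

Definition source (x : 'rV[R]_n) : R := f x * g `|v x|.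
Local Notation w := source.

Definition principal_form (phi : 'rV[R]_n -> R) (x : 'rV[R]_n) : R :=
  \sum_(alpha : multi_index m n | mi_order alpha == m)
    (-1) ^+ m * a alpha x (v x) * mpartial alpha phi x.
Local Notation H := principal_form.

Lemma zero_ext_in x : S x -> v x = 0.
Proof. by move=> Sx; rewrite /zero_ext patchE ifF//; apply/negbTE/negP; rewrite inE. Qed.

Lemma zero_ext_out x : ~ S x -> v x = u x.
Proof. by move=> nSx; rewrite /zero_ext patchE ifT// inE. Qed.

Lemma source_in x : S x -> w x = 0.
Proof.
by move=> Sx; rewrite /source zero_ext_in// normr0 (nonlinearity0 hg) mulr0.
Qed.

Lemma source_ge0 x : Omega x -> 0 <= w x.
Proof. by move=> Ox; rewrite mulr_ge0 ?f_ge0// (nonlinearity_ge0 hg). Qed.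

Lemma measurable_domain : measurable (Omega : set T).
Proof. exact: open_measurable_rV_leb. Qed.

Lemma measurable_tube (w : set 'rV[R]_n) r : measurable (tube w r : set T).
Proof. exact/open_measurable_rV_leb/open_tube. Qed.

Lemma closed_singular_set : closed S.
Proof. exact: compact_closed cS. Qed.

Lemma measurable_singular_set : measurable (S : set T).
Proof.
rewrite -[S]setCK; apply: measurableC; apply: open_measurable_rV_leb.
exact: closed_openC closed_singular_set.
Qed.

(** A countable exhaustion of [Omega] minus [S] by sets on which a weak solution is integrable by
    definition. *)
Definition away (i : nat) : set T := Omega `\` tube S i.+1%:R^-1.

Lemma measurable_away i : measurable (away i).
Proof. exact: measurableD measurable_domain (measurable_tube _ _). Qed.

Lemma bigcup_away : \bigcup_i away i = Omega `\` S.
Proof.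
apply/seteqP; split => [x [i _ [Ox nx]]|x [Ox nSx]].
  by split=> // Sx; apply: nx; apply: subset_tube.
by have [i nx] := subset_tube_compl closed_singular_set nSx; exists i.
Qed.

Lemma measurable_zero_on_singular (h k : 'rV[R]_n -> R) :
  (forall r, 0 < r -> measurable_fun (Omega `\` tube S r : set T) (h : T -> R)) ->
  (forall x, ~ S x -> k x = h x) -> (forall x, S x -> k x = 0) ->
  measurable_fun (Omega : set T) (k : T -> R).
Proof.
move=> mh kh k0.
have -> : (Omega : set T) = (\bigcup_i away i) `|` S.
  rewrite bigcup_away; apply/seteqP; split => [x Ox|x [[]//|/SOmega//]].
  by have [Sx|nSx] := pselect (S x); [right|left].
apply/measurable_funU.
- by apply: bigcupT_measurable => i; exact: measurable_away.
- exact: measurable_singular_set.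
split.
  apply/measurable_fun_bigcup => i; first exact: measurable_away.
  apply: (eq_measurable_fun (h : T -> R)); last by apply: mh.
  move=> x; rewrite inE => -[Ox nx]; rewrite kh// => Sx; apply: nx.
  exact: subset_tube.
apply: (eq_measurable_fun (cst 0 : T -> R)); last exact: measurable_cst.
by move=> x; rewrite inE => Sx; rewrite k0.
Qed.

Lemma measurable_zero_ext : measurable_fun (Omega : set T) (v : T -> R).
Proof.
apply: (measurable_zero_on_singular (h := u)); last exact: zero_ext_in.
- by move=> r r0; have [iu _] := hu.1 r r0; move/measurable_int: iu => /measurable_EFinP.
- exact: zero_ext_out.
Qed.

Lemma measurable_source : measurable_fun (Omega : set T) (w : T -> R).
Proof.
apply: (measurable_zero_on_singular (h := fun x => f x * g `|u x|)).
- by move=> r r0; have [_ iu] := hu.1 r r0; move/measurable_int: iu => /measurable_EFinP.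
- by move=> x nSx; rewrite /source zero_ext_out.
- exact: source_in.
Qed.

Lemma integral_zero_ext_lty r : 0 < r ->
  (\int[mes]_(x in Omega `\` tube S r) `|v x|%:E < +oo)%E.
Proof.
move=> r0; have [iu _] := hu.1 r r0; move: iu => /integrableP[_].
under eq_integral.
  move=> x; rewrite inE => -[Ox nx].
  rewrite /= -zero_ext_out; last by move=> Sx; apply: nx; exact: subset_tube.
  over.
by [].
Qed.

Lemma integral_source_lty r : 0 < r ->
  (\int[mes]_(x in Omega `\` tube S r) (w x)%:E < +oo)%E.
Proof.
move=> r0; have [_ iu] := hu.1 r r0; move: iu => /integrableP[_].
under eq_integral.
  move=> x; rewrite inE => -[Ox nx].
  rewrite /= -zero_ext_out; last by move=> Sx; apply: nx; exact: subset_tube.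
  rewrite -/(w x) ger0_norm ?source_ge0//.
  over.
by [].
Qed.

(** [S] may have positive measure, but [phi] and all its derivatives vanish there, so the values of
    [u] on [S] do not enter. *)
Lemma weak_inequality_zero_ext phi : test_function (Omega `\` S) phi ->
  (forall x, 0 <= phi x) ->
  (\int[mes]_(x in Omega) (w x * phi x)%:E <= \int[mes]_(x in Omega) (H phi x)%:E)%E.
Proof.
move=> tphi phi0; have := hu.2 phi tphi phi0.
have -> : (\int[mes]_(x in Omega) (f x * g `|u x| * phi x)%:E =
    \int[mes]_(x in Omega) (w x * phi x)%:E)%E.
  apply: eq_integral => x _; congr (_%:E); have [Sx|nSx] := pselect (S x).
    rewrite -[phi x]/(partials [::] phi x).
    by rewrite (test_function_partials_out [::] tphi) ?mulr0// => -[].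
  by rewrite /source zero_ext_out.
have -> : (\int[mes]_(x in Omega) (\sum_(alpha : multi_index m n | mi_order alpha == m)
      (-1) ^+ m * a alpha x (u x) * mpartial alpha phi x)%:E =
    \int[mes]_(x in Omega) (H phi x)%:E)%E.
  apply: eq_integral => x _; congr (_%:E); rewrite /principal_form.
  apply: eq_bigr => alpha _; have [Sx|nSx] := pselect (S x).
    rewrite mpartialE (test_function_partials_out (mi_seq alpha) tphi) ?mulr0//.
    by move=> -[].
  by rewrite zero_ext_out.
by [].
Qed.

Lemma measurable_principal_form phi : smooth phi ->
  measurable_fun (Omega : set T) (H phi : T -> R).
Proof.
move=> sphi; pose F (alpha : multi_index m n) (x : T) : R :=
  if mi_order alpha == m then (-1) ^+ m * a alpha x (v x) * mpartial alpha phi x else 0.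
rewrite (_ : H phi = fun x => \sum_alpha F alpha x); last first.
  by apply/funext => x; rewrite /H big_mkcond.
apply: measurable_sum => alpha; rewrite /F; case: eqP => [am|_]; last first.
  exact: measurable_cst.
apply: measurable_funM.
  apply: measurable_funM; first exact: measurable_cst.
  apply: measurable_caratheodory_comp; [exact: measurable_domain|exact: ha|].
  exact: measurable_zero_ext.
by rewrite mpartialE; apply/continuous_measurable_rV_leb/smooth_continuous.
Qed.

(** The quantifier over [phi] sits inside the almost everywhere statement: the exceptional set
    depends only on the finitely many coefficients. *)
Lemma principal_form_bound : {ae @mes R n, forall x, Omega x -> forall phi,
  `|H phi x| <= A * `|v x| *
    \sum_(alpha : multi_index m n | mi_order alpha == m) `|mpartial alpha phi x|}.
Proof.
have : \forall x \ae @mes R n, forall alpha : multi_index m n,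
    mi_order alpha = m -> Omega x -> forall z : R, `|a alpha x z| <= A * `|z|.
  apply: filter_forall.
  move=> alpha; have [am|am] := eqVneq (mi_order alpha) m.
    apply: filterS (haA am); first exact: (ae_filter_ringOfSetsType (@mes R n)).
    by move=> x h _.
  by apply: nearW => x E; move: am; rewrite E eqxx.
apply: filterS; first exact: (ae_filter_ringOfSetsType (@mes R n)).
move=> x ax Ox phi.
rewrite mulr_sumr; apply: (le_trans (ler_norm_sum _ _ _)).
apply: ler_sum => alpha /eqP am; rewrite normrM ler_wpM2r//.
by rewrite normrM normrX normrN1 expr1n mul1r ax.
Qed.

Lemma principal_form_integral_le phi (B : T -> R) : smooth phi ->
  measurable_fun (Omega : set T) B ->
  (forall x, Omega x -> A * `|v x| *
    \sum_(alpha : multi_index m n | mi_order alpha == m) `|mpartial alpha phi x| <= B x) ->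
  (\int[mes]_(x in Omega) `|H phi x|%:E <= \int[mes]_(x in Omega) (B x)%:E)%E.
Proof.
move=> sphi mB HB; have mH := measurable_principal_form sphi.
apply: ae_ge0_le_integral.
- exact: measurable_domain.
- by move=> x _; rewrite lee_fin.
- by apply/measurable_EFinP; exact: measurableT_comp.
- move=> x Ox; rewrite lee_fin; apply: le_trans (HB x Ox).
  by rewrite !mulr_ge0 ?(ltW A_gt0)// sumr_ge0.
- exact/measurable_EFinP.
apply: filterS principal_form_bound; first exact: (ae_filter_ringOfSetsType (@mes R n)).
move=> x Hx Ox.
by rewrite lee_fin (le_trans (Hx Ox phi)) ?HB.
Qed.

Definition shell_norm (r1 r2 : R) : R :=
  fine (\int[mes]_(x in tube S r2 `\` tube S r1) `|v x|%:E)%E.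

(** The J of the iteration. For positive [r], and [R0] so small that the tube lies in [Omega], the
    integral is finite, so [fine] loses nothing. *)
Definition outer_source (R0 r : R) : R :=
  fine (\int[mes]_(x in tube S R0 `\` tube S r) (w x)%:E)%E.

Lemma shell_integral_fin_num (h : 'rV[R]_n -> R) r1 r2 : 0 < r1 ->
  tube S r2 `<=` Omega -> (forall x, Omega x -> 0 <= h x) ->
  measurable_fun (Omega : set T) (h : T -> R) ->
  (\int[mes]_(x in Omega `\` tube S r1) (h x)%:E < +oo)%E ->
  (\int[mes]_(x in tube S r2 `\` tube S r1) (h x)%:E)%E \is a fin_num.
Proof.
move=> r10 r2O h0 mh hoo; rewrite ge0_fin_numE; last first.
  by apply: integral_ge0 => x [/r2O Ox _]; rewrite lee_fin h0.
apply: le_lt_trans hoo; apply: ge0_subset_integral.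
- exact: measurableD (measurable_tube _ _) (measurable_tube _ _).
- exact: measurableD measurable_domain (measurable_tube _ _).
- apply/measurable_EFinP; apply: measurable_funS mh; [exact: measurable_domain|exact: subDsetl].
- by move=> x [Ox _]; rewrite lee_fin h0.
- exact: setSD.
Qed.

(** The test function [chiR - chi] equals 1 between [r2] and [R0]. Its derivatives of order [m] live
    on two shells: between [r1] and [r2] they give the first term, and beyond [R0], where |u| is
    integrable, the constant [K0]. The cutoff [chiR] ends at [2 * R0], so the tube of radius
    [3 * R0] contains the closed support. *)
Lemma source_estimate R0 : 0 < R0 -> tube S (3 * R0) `<=` Omega ->
  exists K K0, [/\ 0 < K, 0 < K0 & forall r1 r2, 0 < r1 -> r1 < r2 -> r2 <= R0 ->
    outer_source R0 r2 <= K * shell_norm r1 r2 / (r2 - r1) ^+ m + K0].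
Proof.
move=> R0_gt0 R0O.
have [C [C0 cut]] := smooth_cutoff R n.
have [M SM] := compact_coord_bounded cS.
pose CC := \sum_(alpha : multi_index m n | mi_order alpha == m) C (mi_seq alpha).
have CC0 : 0 <= CC by apply: sumr_ge0 => alpha _; exact: C0.
pose X := fine (\int[mes]_(x in Omega `\` tube S R0) `|v x|%:E)%E.
have X0 : 0 <= X by apply/fine_ge0/integral_ge0 => x _; rewrite lee_fin.
have XE : (\int[mes]_(x in Omega `\` tube S R0) `|v x|%:E)%E = X%:E.
  rewrite fineK// ge0_fin_numE ?integral_zero_ext_lty//.
  by apply: integral_ge0 => x _; rewrite lee_fin.
have R02 : R0 < 2 * R0 by lra.
have [chiR [schiR chiR01 chiR1 chiR0 chiRC]] := cut S R0 (2 * R0) M SM R02.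
have twoR : 2 * R0 - R0 = R0 by lra.
(* The two summands 1 only ensure the strict positivity required by the iteration. *)
exists (A * CC + 1), (A * CC / R0 ^+ m * X + 1); split.
- by rewrite ltr_wpDl// mulr_ge0// ltW.
- by rewrite ltr_wpDl// !mulr_ge0 ?invr_ge0 ?exprn_ge0 ?(ltW A_gt0) ?(ltW R0_gt0).
move=> r1 r2 r10 r12 r2R.
have [chi [schi chi01 chi1 chi0 chiC]] := cut S r1 r2 M SM r12.
have chi_out x : ~ tube S r2 x -> chi x = 0 by exact: (chi0 [::]).
have chiR_out x : ~ tube S (2 * R0) x -> chiR x = 0 by exact: (chiR0 [::]).
pose phi x := chiR x + - chi x.
have [sNchi dNchi] := smoothN schi.
have [sphi dphi] := smoothD schiR sNchi.
have r20 : 0 < r2 by exact: lt_trans r12.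
have subO r : r <= 3 * R0 -> tube S r `<=` Omega.
  by move=> /(@tubeS _ _ S) h x /h; exact: R0O.
have phi_tube r x : r <= R0 -> tube S r x -> chiR x = 1.
  by move=> rR Srx; apply: chiR1; apply: tubeS Srx.
have phi0 x : 0 <= phi x.
  rewrite /phi subr_ge0; have [x2|x2] := pselect (tube S r2 x).
    by rewrite (phi_tube r2)//; case/andP: (chi01 x).
  by rewrite (chi_out x x2); case/andP: (chiR01 x).
have supp_sub : [set x | phi x != 0] `<=` tube S (2 * R0) `&` ~` tube S r1.
  move=> x /= px; split.
    apply: contrapT => nx; move: px; rewrite /phi.
    rewrite (chiR_out x nx) (chi_out x) ?subrr ?eqxx//.
    by move=> /tubeS h; apply: nx; apply: h; lra.
  move=> x1; move: px; rewrite /phi (phi_tube r1)//; last lra.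
  by rewrite chi1// subrr eqxx.
have tphi : test_function (Omega `\` S) phi.
  have cl : closure [set x | phi x != 0] `<=` tube S (3 * R0) `&` ~` tube S r1.
    move=> x xc; split.
      apply: (@closure_tube _ _ _ (2 * R0)); first lra.
      by apply: closureS xc => y /supp_sub[].
    have : closed (~` tube S r1) by apply: open_closedC; exact: open_tube.
    move=> /closure_id ->; apply: closureS xc => y /supp_sub[].
    by [].
  split=> //.
    apply: (@coord_bounded_compact _ _ _ (M + 3 * R0)); first exact: closed_closure.
    by move=> x i /cl[/(tube_coord_bounded SM)].
  by move=> x /cl[/R0O Ox nx]; split => // Sx; apply: nx; apply: subset_tube.
have mv := measurable_zero_ext.
have mnv : measurable_fun (Omega : set T) (fun x : T => `|v x|) by exact: measurableT_comp.
have mE1 : measurable (Omega `\` tube S R0 : set T).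
  exact: measurableD measurable_domain (measurable_tube _ _).
have mE2 : measurable (tube S r2 `\` tube S r1 : set T).
  exact: measurableD (measurable_tube _ _) (measurable_tube _ _).
have E2O : tube S r2 `\` tube S r1 `<=` Omega.
  by move=> x [+ _]; apply: subO; lra.
pose c1 := A * CC / R0 ^+ m; pose c2 := A * CC / (r2 - r1) ^+ m.
have d0 : 0 < r2 - r1 by rewrite subr_gt0.
have c10 : 0 <= c1 by rewrite !mulr_ge0 ?invr_ge0 ?exprn_ge0 ?(ltW A_gt0) ?(ltW R0_gt0).
have c20 : 0 <= c2 by rewrite !mulr_ge0 ?invr_ge0 ?exprn_ge0 ?(ltW A_gt0) ?(ltW d0).
pose B (x : T) : R := c1 * ((fun x : T => `|v x|) \_ (Omega `\` tube S R0)) x +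
  c2 * ((fun x : T => `|v x|) \_ (tube S r2 `\` tube S r1)) x.
have mP (E : set T) : measurable E -> measurable_fun (Omega : set T)
    ((fun x : T => `|v x|) \_ E).
  by move=> mE; apply: measurable_fun_patch mnv; [exact: measurable_domain|].
have mB : measurable_fun (Omega : set T) B.
  apply: measurable_funD.
    by apply: (@measurable_funM _ T R _ (cst c1)); [exact: measurable_cst|exact: mP].
  by apply: (@measurable_funM _ T R _ (cst c2)); [exact: measurable_cst|exact: mP].
have HB x : Omega x -> A * `|v x| *
    \sum_(alpha : multi_index m n | mi_order alpha == m) `|mpartial alpha phi x| <= B x.
  move=> Ox.
  pose b1 : R := ((fun _ : T => (1 : R)) \_ (Omega `\` tube S R0)) x.
  pose b2 : R := ((fun _ : T => (1 : R)) \_ (tube S r2 `\` tube S r1)) x.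
  have -> : B x = A * `|v x| * (CC * (b1 / R0 ^+ m + b2 / (r2 - r1) ^+ m)).
    have pt0 : point = 0 :> R by [].
    rewrite /B /b1 /b2 !patchE /c1 /c2 pt0; case: ifP => _; case: ifP => _; ring.
  rewrite ler_wpM2l ?mulr_ge0 ?(ltW A_gt0)// /CC mulr_suml; apply: ler_sum.
  move=> alpha /eqP am; rewrite mpartialE dphi dNchi.
  have sz : size (mi_seq alpha) = m by rewrite size_mi_seq.
  (* Because [m] is positive, at least one derivative is taken, and the terms vanish wherever a
     cutoff is locally constant. *)
  have s0 : mi_seq alpha != [::] by rewrite -size_eq0 sz -lt0n.
  apply: (le_trans (ler_normD _ _)); rewrite normrN mulrDr; apply: lerD.
    have [x1|x1] := pselect (tube S R0 x).
      rewrite (partials_cst_on_open _ chiR1 x1 s0) ?normr0; last exact: open_tube.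
      rewrite mulr_ge0 ?C0// divr_ge0 ?exprn_ge0 ?(ltW R0_gt0)//.
      by rewrite /b1 patchE; case: ifP.
    have -> : b1 = 1 by rewrite /b1 patchE ifT// inE.
    by have := chiRC (mi_seq alpha) x; rewrite sz twoR mul1r.
  have [x2|x2] := pselect ((tube S r2 `\` tube S r1) x).
    have -> : b2 = 1 by rewrite /b2 patchE ifT// inE.
    by have := chiC (mi_seq alpha) x; rewrite sz mul1r.
  have -> : partials (mi_seq alpha) chi x = 0.
    have [y2|y2] := pselect (tube S r2 x); last exact: chi0.
    have [y1|y1] := pselect (tube S r1 x); last by exfalso; exact: x2.
    by rewrite (partials_cst_on_open _ chi1 y1 s0)//; exact: open_tube.
  rewrite normr0 mulr_ge0 ?C0// divr_ge0 ?exprn_ge0 ?(ltW d0)//.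
  by rewrite /b2 patchE; case: ifP.
have IH := principal_form_integral_le sphi mB HB.
have weak := weak_inequality_zero_ext tphi phi0.
have shell_fin : (\int[mes]_(x in tube S r2 `\` tube S r1) `|v x|%:E)%E =
    (shell_norm r1 r2)%:E.
  rewrite fineK// shell_integral_fin_num//; first by apply: subO; lra.
  exact: integral_zero_ext_lty.
have nv0 (x : T) : Omega x -> 0 <= `|v x| by [].
have E1O : Omega `\` tube S R0 `<=` Omega by exact: subDsetl.
have EB := integral_patch2 mes measurable_domain mE1 mE2 E1O E2O mnv mnv nv0 nv0 c10 c20.
rewrite EB XE shell_fin in IH.
have lower : (\int[mes]_(x in tube S R0 `\` tube S r2) (w x)%:E <=
    \int[mes]_(x in Omega) (w x * phi x)%:E)%E.
  rewrite integral_mkcond [leRHS]integral_mkcond.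
  apply: ge0_le_integral_nonmeasurable => x _.
    apply: erestrict_ge0 => {}x [xR _]; rewrite lee_fin source_ge0//.
    by apply: subO xR; lra.
  rewrite !patchE; case: ifPn => [|_]; last first.
    by case: ifPn => //; rewrite inE => Ox; rewrite lee_fin mulr_ge0 ?source_ge0.
  rewrite inE => -[xR x2]; have Ox : Omega x by apply: subO xR; lra.
  rewrite ifT ?inE// /phi chiR1// (chi_out x x2) subr0 mulr1//.
have fin : (\int[mes]_(x in tube S R0 `\` tube S r2) (w x)%:E)%E =
    (outer_source R0 r2)%:E.
  rewrite fineK// shell_integral_fin_num//.
  - by apply: subO; lra.
  - by move=> x; exact: source_ge0.
  - exact: measurable_source.
  - exact: integral_source_lty.
have Hle : (\int[mes]_(x in Omega) (H phi x)%:E <=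
    \int[mes]_(x in Omega) `|H phi x|%:E)%E.
  apply: le_trans (lee_abs _) _; apply: le_abse_integral.
    exact: measurable_domain.
  by apply/measurable_EFinP; exact: measurable_principal_form.
have := le_trans lower (le_trans weak (le_trans Hle IH)).
rewrite fin -!EFinM -EFinD lee_fin /c1 /c2.
have I0 : 0 <= shell_norm r1 r2.
  by apply/fine_ge0/integral_ge0 => x _; rewrite lee_fin.
have -> : (A * CC + 1) * shell_norm r1 r2 / (r2 - r1) ^+ m =
   A * CC / (r2 - r1) ^+ m * shell_norm r1 r2 + shell_norm r1 r2 / (r2 - r1) ^+ m.
  by ring.
have : 0 <= shell_norm r1 r2 / (r2 - r1) ^+ m.
  by rewrite divr_ge0 ?exprn_ge0 ?(ltW d0).
lra.
Qed.

End weak_solutions.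

Lemma eq_fine_sub (R : realType) (x y z : \bar R) : x = (y + z)%E ->
  y \is a fin_num -> z \is a fin_num -> z = (fine x - fine y)%:E.
Proof. by move=> -> yf zf; rewrite fineD// addrAC subrr add0r fineK. Qed.

(** * Removability *)

Section removability.
Variables (R : realType) (m n : nat).
Hypothesis m_gt0 : (0 < m)%N.
Variables (Omega S : set 'rV[R]_n).
Hypotheses (oOmega : open Omega) (cS : compact S) (SOmega : S `<=` Omega).
Variable a : multi_index m n -> 'rV[R]_n -> R -> R.
Hypothesis ha : forall alpha : multi_index m n, mi_order alpha = m ->
  caratheodory_function Omega (a alpha).
Variable A : R.
Hypothesis A_gt0 : 0 < A.
Hypothesis haA : forall alpha : multi_index m n, mi_order alpha = m ->
  {ae @mes R n, forall x, Omega x -> forall z : R, `|a alpha x z| <= A * `|z|}.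
Variable f : 'rV[R]_n -> R.
Hypothesis f_ge0 : forall x, Omega x -> 0 <= f x.
Variable g : R -> R.
Hypothesis hg : nonlinearity g.
Variable u : 'rV[R]_n -> R.
Hypothesis hu : weak_solution Omega S a f g u.

Local Notation T := (rV_leb R n).
Local Notation v := (zero_ext S u).
Local Notation w := (source S f g u).
Local Notation H := (principal_form S a u).

Let mO : measurable (Omega : set T). Proof. exact: measurable_domain. Qed.
Let mS : measurable (S : set T). Proof. exact: measurable_singular_set. Qed.
Let mt r : measurable (tube S r : set T). Proof. exact: measurable_tube. Qed.
Let mv : measurable_fun (Omega : set T) (v : T -> R).
Proof. exact: (measurable_zero_ext oOmega cS SOmega hu). Qed.
Let mw : measurable_fun (Omega : set T) (w : T -> R).
Proof. exact: (measurable_source oOmega cS SOmega hg hu). Qed.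
Let w0 x : Omega x -> 0 <= w x.
Proof. exact: source_ge0. Qed.
Let mnv : measurable_fun (Omega : set T) (fun x : T => `|v x|).
Proof. exact: measurableT_comp. Qed.

Let mwE (E : set T) : E `<=` Omega -> measurable_fun E (EFin \o w).
Proof. by move=> EO; apply/measurable_EFinP; exact: measurable_funS mO EO mw. Qed.
Let mvE (E : set T) : E `<=` Omega -> measurable_fun E (fun x : T => `|v x|%:E).
Proof. by move=> EO; apply/measurable_EFinP; exact: measurable_funS mO EO mnv. Qed.

Lemma integral_off_singular (h : 'rV[R]_n -> R) : (forall x, S x -> h x = 0) ->
  (\int[mes]_(x in Omega) (h x)%:E = \int[mes]_(x in Omega `\` S) (h x)%:E)%E.
Proof.
move=> h0; rewrite integral_mkcond [RHS]integral_mkcond.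
apply: eq_integral => x _; rewrite !patchE.
case: ifPn => [|nO]; last first.
  by rewrite ifF//; apply/negbTE; apply: contra nO; rewrite !inE => -[].
rewrite inE => Ox; case: ifPn => //; rewrite notin_setE => nx.
by rewrite h0//; apply: contrapT => nSx; apply: nx.
Qed.

Lemma jensen_near_singular (E : set T) (r c M t : R) :
  measurable E -> tube S r `<=` Omega -> E `<=` tube S r `\` S ->
  {ae @mes R n, forall x, (tube S r `\` S) x -> c <= f x} -> 0 <= c ->
  (mes (tube S r `\` S) <= M%:E)%E -> 0 <= t ->
  ((t * M)%:E <= \int[mes]_(x in E) `|v x|%:E)%E ->
  ((c * M * g t)%:E <= \int[mes]_(x in E) (w x)%:E)%E.
Proof.
move=> mE rO ES cf c0 ME t0 tM.
have EO : E `<=` Omega by move=> x /ES[/rO].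
apply: (jensen_weighted hg mE _ _ _ _ c0 _ t0 tM).
- exact: measurable_funS mO EO mv.
- exact: measurable_funS mO EO mw.
- by move=> x /EO; exact: f_ge0.
- apply: filterS cf; first exact: (ae_filter_ringOfSetsType (@mes R n)).
  by move=> x h /ES; exact: h.
- apply: le_trans ME; apply: le_measure; rewrite ?inE//.
  exact: measurableD.
Qed.

Lemma outer_source_sub R0 r1 r2 : 0 < r1 -> r1 <= r2 -> r2 <= R0 ->
  tube S R0 `<=` Omega ->
  (\int[mes]_(x in tube S r2 `\` tube S r1) (w x)%:E)%E =
  (outer_source S f g u R0 r1 - outer_source S f g u R0 r2)%:E.
Proof.
move=> r10 r12 r2R RO.
have wfin r r' : 0 < r -> tube S r' `<=` Omega ->
    (\int[mes]_(x in tube S r' `\` tube S r) (w x)%:E)%E \is a fin_num.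
  move=> r0 r'O; apply: (shell_integral_fin_num oOmega r0 r'O w0 mw).
  exact: (integral_source_lty f_ge0 hg hu r0).
have r2O : tube S r2 `<=` Omega by move=> x /(tubeS r2R); exact: RO.
have E : tube S R0 `\` tube S r1 =
    (tube S R0 `\` tube S r2) `|` (tube S r2 `\` tube S r1).
  apply/seteqP; split => [x [xR x1]|x [[xR x2]|[x2 x1]]].
  - by have [x2|x2] := pselect (tube S r2 x); [right|left].
  - by split=> // /(tubeS r12).
  - by split=> //; exact: tubeS x2.
have r20 : 0 < r2 by exact: lt_le_trans r12.
have EQ : (\int[mes]_(x in tube S R0 `\` tube S r1) (w x)%:E =
    \int[mes]_(x in tube S R0 `\` tube S r2) (w x)%:E +
    \int[mes]_(x in tube S r2 `\` tube S r1) (w x)%:E)%E.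
  rewrite [in LHS]E; apply: ge0_integral_setU; rewrite -?E.
  - exact: measurableD.
  - exact: measurableD.
  - by apply: mwE => x [/RO].
  - by move=> x [/RO Ox _]; rewrite lee_fin w0.
  - by apply/disj_setPS => x [[_ nx] [/nx]].
exact: (eq_fine_sub EQ (wfin _ _ r20 RO) (wfin _ _ r10 r2O)).
Qed.

Variables (k D d0 R0 : R).
Hypothesis D_gt0 : 0 < D.
Hypothesis d0_gt0 : 0 < d0.
Hypothesis mes_shell : forall r, 0 < r -> r < d0 ->
  (mes (tube S r `\` S : set T) <= (D * r `^ (n%:R - k))%:E)%E.
Hypothesis R0_gt0 : 0 < R0.
Hypothesis R0_sub : tube S (3 * R0) `<=` Omega.

Let tubeO r : r <= 3 * R0 -> tube S r `<=` Omega.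
Proof. by move=> rR x /(tubeS rR); exact: R0_sub. Qed.

Let shell_sub r1 r2 r : 0 < r1 -> r2 <= r ->
  tube S r2 `\` tube S r1 `<=` tube S r `\` S.
Proof.
move=> r10 r2r x [x2 x1]; split; first exact: tubeS x2.
by move=> Sx; apply: x1; exact: subset_tube.
Qed.

Hypothesis hgint : (\int[lebesgue_measure]_(z in `[1%R, +oo[)
  (g z `^ (- m%:R^-1) * z `^ (m%:R^-1 - 1))%:E < +oo)%E.
Hypothesis hG : forall C : R, 0 < C ->
  (limf_esup (fun r : R => (r `^ (n%:R - k - m%:R))%:E *
     Ginv m g ((C * r)%:E *
       essinf_on (tube S r `\` S) (fun x => (f x `^ m%:R^-1)%R))) 0^'+ < +oo)%E.

Let shell_norm_fin r1 r2 : 0 < r1 -> r2 <= R0 ->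
  (\int[mes]_(x in tube S r2 `\` tube S r1) `|v x|%:E)%E =
  (shell_norm S u r1 r2)%:E.
Proof.
move=> r10 r2R; rewrite fineK//.
apply: (shell_integral_fin_num oOmega r10) => //.
- by apply: tubeO; have := R0_gt0; lra.
- exact: (integral_zero_ext_lty hu r10).
Qed.

Lemma outer_source_bounded :
  exists B, forall r, 0 < r -> r <= R0 -> outer_source S f g u R0 r <= B.
Proof.
have [K [K0 [K_gt0 K0_gt0 JI]]] := source_estimate m_gt0 oOmega cS SOmega ha A_gt0 haA
  f_ge0 hg hu R0_gt0 R0_sub.
have RO : tube S R0 `<=` Omega by apply: tubeO; have := R0_gt0; lra.
have Jsub r1 r2 : 0 < r1 -> r1 <= r2 -> r2 <= R0 ->
    (\int[mes]_(x in tube S r2 `\` tube S r1) (w x)%:E)%E =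
    (outer_source S f g u R0 r1 - outer_source S f g u R0 r2)%:E.
  by move=> r10 r12 r2R; exact: outer_source_sub.
apply: (@keller_osserman_bounded _ g m hg m_gt0 hgint (outer_source S f g u R0)
  (shell_norm S u) R0 K K0 K_gt0 K0_gt0 R0_gt0 _ _ JI (n%:R - k) D D_gt0).
- move=> r r0; apply/fine_ge0/integral_ge0 => x [/RO Ox _].
  by rewrite lee_fin w0.
- move=> r1 r2 r10 r12 r2R; rewrite -subr_ge0 -lee_fin -Jsub//.
  apply: integral_ge0 => x [x2 _]; rewrite lee_fin w0//.
  by apply: RO; exact: tubeS x2.
move=> C C0; have [B [d1 [d10 dP]]] := limf_esup_right_lty (hG C0).
exists B, (Num.min d1 (Num.min d0 R0)); split; first by rewrite !lt_min d10 d0_gt0.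
move=> r r0; rewrite !lt_min => /andP[rd1 /andP[rd0 rR]].
have rO : tube S r `<=` Omega by apply: tubeO; have := R0_gt0; lra.
have mE : measurable (tube S r `\` S : set T) by exact: measurableD.
have := dP r r0 rd1.
have := @essinf_on_le _ _ (tube S r `\` S) (fun x => (f x `^ m%:R^-1)%R).
have := @essinf_on_ge0 _ _ (tube S r `\` S) (fun x => (f x `^ m%:R^-1)%R).
have := @essinf_on_eqy _ _ (tube S r `\` S) (fun x => (f x `^ m%:R^-1)%R) mE.
case: (essinf_on _ _) => [F|/(_ erefl) E0 _ _ _|_ /(_ _)]; last 2 first.
(* Essential infimum +oo: the punctured tube is null and |u| has zero integral over every shell. *)
- left=> r1 r2 r10 r12 r2r; rewrite -lee_fin -shell_norm_fin//; last lra.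
  have mW : measurable (tube S r2 `\` tube S r1 : set T) by exact: measurableD.
  rewrite (null_set_integral mW (mvE _) _)//.
    by move=> x /(shell_sub r10 r2r)[/rO].
  exact: subset_measure0 mW mE (shell_sub r10 r2r) E0.
- have -> : (0 <= -oo :> \bar R)%E = false by [].
  by move=> /(_ (fun x _ => powR_ge0 _ _)).
move=> _ /(_ (fun x _ => powR_ge0 _ _)); rewrite lee_fin le_eqVlt => /orP[/eqP<- _|F0].
  (* Essential infimum 0: the convention gives [Ginv] the value +oo, against the bound from the
     upper limit. Hence [F] is positive from here on. *)
  rewrite mule0 /Ginv eqxx gt0_muley; last by rewrite lte_fin powR_gt0.
  by rewrite leye_eq.
move=> Ff GB; right; exists F; split => //.
move=> r1 r2 t r10 r12 r2r t0 tI.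
rewrite -lee_fin -Jsub ?(ltW r12)//; last lra.
apply: (@jensen_near_singular _ r) => //.
- exact: measurableD.
- exact: shell_sub.
- apply: filterS Ff => x h Dx; have := h Dx; rewrite lee_fin => {h}Ff.
  have f0 : 0 <= f x by case: Dx => /rO /f_ge0.
  have mn0 : m%:R != 0 :> R by rewrite pnatr_eq0 -lt0n.
  have <- : (f x `^ m%:R^-1) ^+ m = f x.
    by rewrite -powR_mulrn ?powR_ge0// -powRrM mulVf// powRr1.
  by rewrite lerXn2r ?nnegrE ?powR_ge0 ?(ltW F0).
- by rewrite exprn_ge0 ?(ltW F0).
- exact: mes_shell.
- by rewrite shell_norm_fin ?lee_fin//; lra.
Qed.

(** Monotone convergence along [away]: each integral splits at [R0] into a value of [outer_source],
    bounded uniformly, and a fixed finite part. *)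
Lemma source_integral_lty : (\int[mes]_(x in Omega) (w x)%:E < +oo)%E.
Proof.
rewrite (integral_off_singular (h := w)); last exact: source_in.
rewrite -(bigcup_away Omega cS).
have [B BP] := outer_source_bounded.
pose X := (\int[mes]_(x in Omega `\` tube S R0) (w x)%:E)%E.
have Xoo : (X < +oo)%E by exact: (integral_source_lty f_ge0 hg hu R0_gt0).
have ma i : measurable (away Omega S i) by exact: measurable_away.
have cv := @ge0_nondecreasing_set_cvg_integral _ T R (away Omega S) (EFin \o w) mes _ ma.
apply: (@le_lt_trans _ _ (B%:E + X)%E); last by rewrite lte_add_pinfty// ltry.
apply: (cvge_to_le (cv _ _ _)).
- move=> i j ij; apply/subsetPset => x [Ox nx]; split => // xj; apply: nx.
  by apply: tubeS xj; rewrite lef_pV2 ?posrE ?ltr0n// ler_nat.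
- move=> i; apply/measurable_EFinP; apply: measurable_funS mO _ mw; exact: subDsetl.
- by move=> i x [Ox _]; rewrite lee_fin w0.
near=> i.
have iR : i.+1%:R^-1 < R0.
  by near: i; exact: (near_infty_natSinv_lt (PosNum R0_gt0)).
have i0 : 0 < i.+1%:R^-1 :> R by rewrite invr_gt0.
have RO : tube S R0 `<=` Omega by apply: tubeO; have := R0_gt0; lra.
have mE1 : measurable (tube S R0 `\` tube S i.+1%:R^-1 : set T) by exact: measurableD.
have mE2 : measurable (Omega `\` tube S R0 : set T) by exact: measurableD.
have E : away Omega S i = (tube S R0 `\` tube S i.+1%:R^-1) `|` (Omega `\` tube S R0).
  apply/seteqP; split => [x [Ox x1]|x [[/RO Ox x1]//|[Ox xR]]].
    by have [xR|xR] := pselect (tube S R0 x); [left|right].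
  by split=> // /(tubeS (ltW iR)).
rewrite E ge0_integral_setU//= -?E.
- rewrite leeD2r//; apply: le_trans (_ : (outer_source S f g u R0 i.+1%:R^-1)%:E <= _)%E.
    rewrite fineK//; apply: (shell_integral_fin_num oOmega i0 RO w0 mw).
    exact: (integral_source_lty f_ge0 hg hu i0).
  by rewrite lee_fin BP// ltW.
- apply/measurable_EFinP; apply: measurable_funS mO _ mw; exact: subDsetl.
- by move=> x [[/RO Ox _]|[Ox _]]; rewrite lee_fin w0.
- by apply/disj_setPS => x [[xR _] [_]].
Unshelve. all: by end_near. Qed.

Hypothesis hgamma : (\int[@mes R n]_(x in Omega `\` S) gamma_inv g (f x) < +oo)%E.

Lemma zero_ext_integral_lty : (\int[mes]_(x in Omega) `|v x|%:E < +oo)%E.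
Proof.
rewrite (integral_off_singular (h := fun x => `|v x|)); last first.
  by move=> x Sx; rewrite zero_ext_in// normr0.
have mOS : measurable (Omega `\` S : set T) by exact: measurableD.
have woo : (\int[mes]_(x in Omega `\` S) (w x)%:E < +oo)%E.
  rewrite -(integral_off_singular (h := w)); last exact: source_in.
  exact: source_integral_lty.
have sub : Omega `\` S `<=` Omega by exact: subDsetl.
have m1 : measurable_fun (Omega `\` S : set T) (fun x : T => Num.max (`|v x| - w x) 0).
  apply: measurable_funS mO sub _; apply: measurable_maxr; last exact: measurable_cst.
  exact: measurable_funB.
have m2 : measurable_fun (Omega `\` S : set T) (w : T -> R).
  exact: measurable_funS mO sub mw.
(* The positive part of |v| - w is a measurable intermediary: the integral is split first, and only
   then compared with [gamma_inv g (f x)] by Young's inequality. *)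
apply: (@le_lt_trans _ _ (\int[mes]_(x in Omega `\` S)
    ((Num.max (`|v x| - w x) 0)%:E + (w x)%:E))%E).
  apply: ge0_le_integral_nonmeasurable => x [Ox _]; rewrite lee_fin//.
  by rewrite -lerBlDr le_max lexx.
rewrite (ge0_integralD _ mOS); first last.
- exact/measurable_EFinP.
- by move=> x [Ox _]; rewrite lee_fin w0.
- exact/measurable_EFinP.
- by move=> x _; rewrite lee_fin le_max lexx orbT.
apply: lte_add_pinfty woo; apply: le_lt_trans hgamma.
apply: ge0_le_integral_nonmeasurable => x [Ox nSx].
  by rewrite lee_fin le_max lexx orbT.
have unb L := derive_nonlinearity_unbounded hg hgint L.
have yg s : 0 <= s -> ((s - f x * g s)%:E <= gamma_inv g (f x))%E.
  by move=> s0; apply: young_gamma_inv => //; exact: f_ge0.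
rewrite EFin_max ge_max yg//=.
by have := yg 0 (lexx 0); rewrite (nonlinearity0 hg) mulr0 subrr.
Qed.

Lemma source_shell_small e : 0 < e -> exists2 d, 0 < d &
  forall r, 0 < r -> r < d -> (\int[mes]_(x in tube S r `\` S) (w x)%:E < e%:E)%E.
Proof.
move=> e0; pose E (i : nat) : set T := tube S (R0 * i.+1%:R^-1) `\` S.
have mE i : measurable (E i) by exact: measurableD.
have EO i : E i `<=` Omega.
  move=> x [+ _]; apply: tubeO; rewrite mulrC ler_wpM2r ?(ltW R0_gt0)//.
  by rewrite (@le_trans _ _ 1) ?invf_le1 ?ler1n.
have [|||||i iP] := @integral_shrinking_lt _ T R mes (EFin \o w) E e mE _ _ _ _ _ e0.
- move=> i j ij x [xj nSx]; split => //; apply: tubeS xj.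
  by rewrite ler_pM2l// lef_pV2 ?posrE ?ltr0n// ler_nat.
- apply/seteqP; split => // x xE; have [_ nSx] := xE 0%N I.
  have [i nx] := subset_tube_compl (closed_singular_set cS) nSx.
  pose j := Num.bound (R0 * i.+1%:R).
  have [xj _] := xE j I; apply: nx; apply: tubeS xj.
  rewrite ler_pdivrMr ?ltr0n// ler_pdivlMl ?ltr0n//.
  have := archi_boundP (mulr_ge0 (ltW R0_gt0) (ler0n R i.+1)); rewrite -/j mulrC => /ltW.
  by move=> /le_trans; apply; rewrite ler_nat.
- exact: mwE.
- by move=> x /EO Ox; rewrite lee_fin w0.
- apply: le_lt_trans source_integral_lty.
  by apply: ge0_subset_integral_nonmeasurable => // x Ox; rewrite lee_fin w0.
exists (R0 * i.+1%:R^-1); first by rewrite mulr_gt0// invr_gt0.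
move=> r r0 ri; apply: le_lt_trans iP; apply: ge0_subset_integral_nonmeasurable.
- by move=> x [xr nSx]; split => //; apply: tubeS xr; exact: ltW.
- by move=> x /EO Ox; rewrite lee_fin w0.
Qed.

Hypothesis hmu : forall C : R, 0 < C ->
  (0 < limf_einf (fun r : R =>
     (r ^+ m * mu g (C * r `^ (m%:R - n%:R + k)))%:E *
     essinf_on (tube S r `\` S) f) 0^'+)%E.

Lemma mu_le xi t : 0 < xi -> xi <= t -> mu g xi <= g t / t.
Proof.
move=> xi0 xit; apply: ge_inf; last by exists t => //=; rewrite in_itv/= andbT.
exists 0 => _ [s + <-]; rewrite /= in_itv/= andbT => xis.
have s0 := lt_le_trans xi0 xis.
by rewrite divr_ge0 ?(nonlinearity_ge0 hg) ?ltW.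
Qed.

(** If the integral [X] exceeded [e * r ^+ m], then [X / M] would be at least [xi], so [mu g xi]
    would bound [g (X / M) / (X / M)] from below. Jensen's inequality and the lower limit would then
    give the source a mass of at least [c * e] on the punctured tube, which is excluded for small
    [r]. *)
Lemma zero_ext_shell_small e : 0 < e -> exists2 d, 0 < d &
  forall r, 0 < r -> r < d ->
    (\int[mes]_(x in tube S r `\` S) `|v x|%:E <= (e * r ^+ m)%:E)%E.
Proof.
(* The constant [e / D] is the one for which [xi] times the measure bound [M] equals
   [e * r ^+ m]. *)
move=> e0; have C0 : 0 < e / D by rewrite divr_gt0.
have [c [d1 [c0 d10 cP]]] := limf_einf_right_gt0 (hmu C0).
have [d2 d20 wP] := source_shell_small (mulr_gt0 c0 e0).
exists (Num.min (Num.min d1 d2) (Num.min d0 R0)).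
  by rewrite !lt_min d10 d20 d0_gt0.
move=> r r0; rewrite !lt_min => /andP[/andP[rd1 rd2] /andP[rd0 rR]].
have rO : tube S r `<=` Omega by apply: tubeO; have := R0_gt0; lra.
have mE : measurable (tube S r `\` S : set T) by exact: measurableD.
have EO : tube S r `\` S `<=` Omega by move=> x [/rO].
have V0 : (0 <= \int[mes]_(x in tube S r `\` S) `|v x|%:E)%E.
  by apply: integral_ge0 => x _; rewrite lee_fin.
have W0 : (0 <= \int[mes]_(x in tube S r `\` S) (w x)%:E)%E.
  by apply: integral_ge0 => x /EO Ox; rewrite lee_fin w0.
have Vfin : (\int[mes]_(x in tube S r `\` S) `|v x|%:E)%E \is a fin_num.
  rewrite ge0_fin_numE//; apply: le_lt_trans zero_ext_integral_lty.
  by apply: ge0_subset_integral_nonmeasurable => // x _; rewrite lee_fin.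
rewrite leNgt; apply/negP; rewrite -(fineK Vfin) lte_fin.
set X := fine _ => eX.
have rm0 : 0 < r ^+ m by rewrite exprn_gt0.
have X0 : 0 < X by apply: lt_trans eX; rewrite mulr_gt0.
pose M := D * r `^ (n%:R - k); have M0 : 0 < M by rewrite mulr_gt0// powR_gt0.
pose xi := e / D * r `^ (m%:R - n%:R + k).
have xi0 : 0 < xi by rewrite mulr_gt0// powR_gt0.
have xiE : xi * M = e * r ^+ m.
  rewrite /xi /M.
  have -> : e / D * r `^ (m%:R - n%:R + k) * (D * r `^ (n%:R - k)) =
    e * (r `^ (m%:R - n%:R + k) * r `^ (n%:R - k)) by field; rewrite gt_eqF.
  rewrite -powRD; last by rewrite (gt_eqF r0) implybT.
  by rewrite -powR_mulrn ?(ltW r0)//; congr (_ * _ `^ _); ring.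
have xiX : xi <= X / M by rewrite ler_pdivlMr// xiE ltW.
have := cP r r0 rd1; rewrite -/xi.
have := @essinf_on_le _ _ (tube S r `\` S) f.
have := @essinf_on_ge0 _ _ (tube S r `\` S) f.
have := @essinf_on_eqy _ _ (tube S r `\` S) f mE.
case: (essinf_on _ _) => [F|/(_ erefl) E0 _ _ _|_ /(_ (fun x Ex => f_ge0 (EO x Ex)))//].
  move=> _ /(_ (fun x Ex => f_ge0 (EO x Ex))); rewrite lee_fin => F0 Ff.
  rewrite -EFinM lee_fin => cle.
  have := @jensen_near_singular (tube S r `\` S) r F M (X / M) mE rO (subset_refl _)
    _ F0 (mes_shell r0 rd0) (ltW (divr_gt0 X0 M0)).
  rewrite -(fineK Vfin) -/X lee_fin divfK ?gt_eqF// => jen.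
  have {}jen cf := jen (@subset_refl _ _) cf (lexx X).
  have := wP r r0 rd2; apply/negP; rewrite -leNgt.
  apply: le_trans (jen _); last first.
    by apply: filterS Ff => x h Ex; have := h Ex; rewrite lee_fin.
  rewrite lee_fin.
  have mle := mu_le xi0 xiX.
  have : c <= r ^+ m * (g (X / M) / (X / M)) * F.
    by apply: (le_trans cle); rewrite ler_wpM2r// ler_pM2l.
  have -> : r ^+ m * (g (X / M) / (X / M)) * F = r ^+ m * (F * M * g (X / M)) / X.
    by field; rewrite !gt_eqF.
  rewrite ler_pdivlMr// => cX.
  have {}cX : c * (e * r ^+ m) <= r ^+ m * (F * M * g (X / M)).
    by apply: le_trans cX; rewrite ler_pM2l// ltW.
  by move: cX; rewrite mulrA mulrC ler_pM2l.
by move: X0; rewrite /X (null_set_integral mE (mvE EO) E0) ltxx.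
Qed.

Lemma measurable_smooth_mul (h phi : 'rV[R]_n -> R) : smooth phi ->
  measurable_fun (Omega : set T) (h : T -> R) ->
  measurable_fun (Omega : set T) ((fun x => h x * phi x) : T -> R).
Proof.
move=> sphi mh; apply: measurable_funM => //.
exact: (continuous_measurable_rV_leb (@smooth_continuous _ _ phi [::] sphi)).
Qed.

(** The inequality is tested with [phi * (1 - chi)], where [chi] cuts off a small tube. Two errors
    appear: the source over the punctured tube, and the principal form of [phi * chi], of order
    r^(-m) times the integral of |u| there. Each is made at most [e / 2]. *)
Lemma weak_inequality_extends : weak_inequality Omega a f g Omega v.
Proof.
move=> phi tphi phi0; rewrite -/(H phi).
change ((\int[mes]_(x in Omega) (w x * phi x)%:E <=
  \int[mes]_(x in Omega) (H phi x)%:E)%E).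
have /choice[Bphi BphiP] := fun s => test_function_partials_bounded s tphi.
have [sphi csupp suppO] := tphi.
have [C [C0 cut]] := smooth_cutoff R n.
have [M SM] := compact_coord_bounded cS.
have Bphi0 s : 0 <= Bphi s by case: (BphiP s).
(* By the Leibniz rule, [C'] divided by [(r / 2) ^+ m] will bound the sum of the derivatives of
   order [m] of [phi * chi]. *)
pose C' := \sum_(alpha : multi_index m n | mi_order alpha == m)
  \sum_(p <- splits (mi_seq alpha)) Bphi p.1 * C p.2.
have C'0 : 0 <= C'.
  by apply: sumr_ge0 => alpha _; apply: sumr_ge0 => p _; rewrite mulr_ge0.
have mH psi : smooth psi -> measurable_fun (Omega : set T) (H psi : T -> R).
  move=> spsi; exact: (measurable_principal_form oOmega cS SOmega ha hu).
pose B1 := \sum_(alpha : multi_index m n | mi_order alpha == m) Bphi (mi_seq alpha).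
have B10 : 0 <= B1 by apply: sumr_ge0.
have Hint : (@mes R n).-integrable Omega (EFin \o H phi).
  apply/integrableP; split; first exact/measurable_EFinP/mH.
  have mB : measurable_fun (Omega : set T) (fun x : T => A * B1 * `|v x|).
    by apply: (@measurable_funM _ T R _ (cst (A * B1))); first exact: measurable_cst.
  have := principal_form_integral_le oOmega cS SOmega ha A_gt0 haA hu sphi mB.
  move=> /(_ _) le1; apply: (le_lt_trans (le1 _)).
    move=> x Ox; rewrite mulrAC ler_wpM2r// ler_wpM2l ?(ltW A_gt0)//.
    apply: ler_sum => alpha _; rewrite mpartialE; exact: (BphiP _).2.
  under eq_integral do rewrite EFinM.
  rewrite (ge0_integralZl mes mO (mvE (@subset_refl _ _))); first last.
  - by rewrite lee_fin mulr_ge0 ?(ltW A_gt0).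
  - by move=> x _; rewrite lee_fin.
  rewrite lte_mul_pinfty ?lee_fin ?mulr_ge0 ?(ltW A_gt0)//.
  exact: zero_ext_integral_lty.
have Hfin := integrable_fin_num mO Hint.
apply/lee_addgt0Pr => e e0.
have e20 : 0 < e / 2 by rewrite divr_gt0.
(* The factor [2 ^+ m] is the quotient of [r ^+ m] by [(r / 2) ^+ m], as the cutoff varies over a
   width [r / 2]; the summand 1 avoids a division by zero. *)
pose e1 := e / 2 / (A * C' * 2 ^+ m + 1).
have den0 : 0 < A * C' * 2 ^+ m + 1.
  by rewrite ltr_wpDl// !mulr_ge0 ?exprn_ge0 ?(ltW A_gt0).
have e10 : 0 < e1 by rewrite divr_gt0.
have b0 : 0 < Bphi [::] + 1 by rewrite ltr_wpDl.
have [d1 d10 vP] := zero_ext_shell_small e10.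
have [d2 d20 wP] := source_shell_small (divr_gt0 e20 b0).
pose r := Num.min (Num.min d1 d2) (Num.min 1 R0) / 2.
have [r0 [rd1 [rd2 [r1 rR]]]] : 0 < r /\ r < d1 /\ r < d2 /\ r < 1 /\ r < R0.
  have q0 : 0 < Num.min (Num.min d1 d2) (Num.min 1 R0).
    by rewrite !lt_min d10 d20 ltr01 R0_gt0.
  have : r < Num.min (Num.min d1 d2) (Num.min 1 R0) by rewrite /r; lra.
  rewrite !lt_min => /andP[/andP[-> ->] /andP[-> ->]].
  by split => //; rewrite divr_gt0.
have rO : tube S r `<=` Omega by apply: tubeO; have := R0_gt0; lra.
have mE : measurable (tube S r `\` S : set T) by exact: measurableD.
have EO : tube S r `\` S `<=` Omega by move=> x [/rO].
have r20 : 0 < r / 2 by rewrite divr_gt0.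
have r2r : r / 2 < r by lra.
have [chi [schi chi01 chi1 chi0 chiC]] := cut S (r / 2) r M SM r2r.
have rr2 : r - r / 2 = r / 2 by field.
have [spc dpc] := smoothM sphi schi.
have [sNpc dNpc] := smoothN spc.
pose psi x := phi x + - (phi x * chi x).
have [spsi dpsi] := smoothD sphi sNpc.
have psiE x : psi x = phi x * (1 - chi x) by rewrite /psi; ring.
have psi0 x : 0 <= psi x.
  by rewrite psiE mulr_ge0// subr_ge0; case/andP: (chi01 x).
have chi_out x : ~ tube S r x -> chi x = 0 by exact: (chi0 [::]).
have tpsi : test_function (Omega `\` S) psi.
  have cl1 : closure [set x | psi x != 0] `<=` closure [set x | phi x != 0].
    by apply: closureS => x /=; rewrite psiE mulf_eq0 negb_or => /andP[].
  have cl2 : closure [set x | psi x != 0] `<=` ~` tube S (r / 2).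
    have cc : closed (~` tube S (r / 2)) by apply: open_closedC; exact: open_tube.
    rewrite [X in _ `<=` X](closure_id _).1//; apply: closureS => x /=.
    by rewrite psiE => + x1; rewrite chi1// subrr mulr0 eqxx.
  split=> //.
    by apply: (subclosed_compact _ csupp) => //; exact: closed_closure.
  move=> x xc; split; first exact/suppO/cl1.
  by move=> Sx; apply: (cl2 x xc); exact: subset_tube.
have weak := weak_inequality_zero_ext hu tpsi psi0.
have Hpsi x : H psi x = H phi x - H (fun x => phi x * chi x) x.
  rewrite /principal_form -sumrB; apply: eq_bigr => alpha _.
  by rewrite !mpartialE dpsi dNpc; ring.
pose c := A * (C' / (r / 2) ^+ m).
have c0 : 0 <= c.
  by rewrite !mulr_ge0 ?invr_ge0 ?exprn_ge0 ?(ltW A_gt0) ?(ltW r20).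
pose V := (fun x : T => `|v x|) \_ (tube S r `\` S).
have mV : measurable_fun (Omega : set T) V by exact: measurable_fun_patch.
have mB : measurable_fun (Omega : set T) (fun x : T => c * V x).
  by apply: (@measurable_funM _ T R _ (cst c)); first exact: measurable_cst.
have HB x : Omega x -> A * `|v x| *
    \sum_(alpha : multi_index m n | mi_order alpha == m)
      `|mpartial alpha (fun x => phi x * chi x) x| <= c * V x.
  move=> Ox; rewrite /V patchE; case: ifPn => [|]; last first.
    rewrite notin_setE => nx; have pt0 : point = 0 :> R by [].
    rewrite pt0 mulr0.
    have [Sx|nSx] := pselect (S x).
      by rewrite zero_ext_in// normr0 mulr0 mul0r.
    have xr : ~ tube S r x by move=> xr; exact: nx.
    rewrite big1 ?mulr0// => alpha _; rewrite mpartialE dpc big1 ?normr0// => p _.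
    by rewrite chi0// mulr0.
  rewrite inE => -[xr nSx]; rewrite /c [leLHS]mulrAC ler_wpM2r//.
  rewrite ler_wpM2l ?(ltW A_gt0)//.
  rewrite /C' mulr_suml; apply: ler_sum => alpha /eqP am.
  rewrite mpartialE dpc mulr_suml; apply: (le_trans (ler_norm_sum _ _ _)).
  rewrite big_seq [leRHS]big_seq; apply: ler_sum => p ps.
  rewrite normrM -mulrA; apply: ler_pM => //; first exact: (BphiP _).2.
  apply: (le_trans (chiC p.2 x)); rewrite rr2 ler_wpM2l//.
  (* Only part of the [m] derivatives may fall on [chi]; since [r < 1], the lower negative powers of
     [r / 2] are dominated by the [m]-th. *)
  rewrite lef_pV2 ?posrE ?exprn_gt0// ler_wiXn2l ?(ltW r20)//; first lra.
  by rewrite -[leqRHS]am -size_mi_seq -(size_splits ps) leq_addl.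
have IH := principal_form_integral_le oOmega cS SOmega ha A_gt0 haA hu spc mB HB.
have cV : (\int[mes]_(x in Omega) (c * V x)%:E <= (e / 2)%:E)%E.
  have -> : (\int[mes]_(x in Omega) (c * V x)%:E =
      c%:E * \int[mes]_(x in tube S r `\` S) `|v x|%:E)%E.
    under eq_integral do rewrite EFinM.
    have mVE : measurable_fun (Omega : set T) (EFin \o V) by exact/measurable_EFinP.
    rewrite (ge0_integralZl mes mO mVE).
    - rewrite -[in RHS](setIidr EO) [in RHS]integral_mkcondr; congr (_ * _)%E.
      by apply: eq_integral => x _; rewrite /= /V !patchE; case: ifPn.
    - by move=> x _; rewrite lee_fin /V patchE; case: ifPn.
    - by rewrite lee_fin.
  apply: (@le_trans _ _ (c%:E * (e1 * r ^+ m)%:E)%E).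
    by rewrite lee_wpmul2l ?lee_fin// vP.
  rewrite -EFinM lee_fin /c.
  have -> : A * (C' / (r / 2) ^+ m) * (e1 * r ^+ m) = A * C' * 2 ^+ m * e1.
    by rewrite expr_div_n; field; rewrite !expf_neq0 ?gt_eqF.
  rewrite /e1 mulrCA -[leRHS]mulr1 ler_wpM2l ?(ltW e20)//.
  by rewrite ler_pdivrMr// mul1r lerDl.
have upper : (\int[mes]_(x in Omega) (H psi x)%:E <=
    \int[mes]_(x in Omega) (H phi x)%:E + (e / 2)%:E)%E.
  apply: le_trans (leeD2l _ (le_trans IH cV)).
  have mHpc := mH _ spc.
  have fin2 : (\int[mes]_(x in Omega) `|H (fun x => phi x * chi x) x|%:E < +oo)%E.
    exact: le_lt_trans (le_trans IH cV) (ltry _).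
  have int2 : (@mes R n).-integrable Omega (EFin \o H (fun x => phi x * chi x)).
    by apply/integrableP; split => //; exact/measurable_EFinP.
  have int2' : (@mes R n).-integrable Omega
      (fun x => `|H (fun x => phi x * chi x) x|%:E).
    exact: (integrable_abse int2).
  have intpsi : (@mes R n).-integrable Omega (EFin \o H psi).
    have := integrableB mO Hint int2; apply: eq_integrable; first exact: mO.
    move=> x _.
    by rewrite /= Hpsi EFinB.
  rewrite -(integralD mO Hint int2').
  apply: (le_integral mO intpsi (integrableD mO Hint int2')).
  move=> x _; rewrite /= Hpsi -EFinD lee_fin lerD2l.
  by rewrite -normrN ler_norm.
have lower : (\int[mes]_(x in Omega) (w x * phi x)%:E <=
    \int[mes]_(x in Omega) (w x * psi x)%:E + (e / 2)%:E)%E.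
  pose W := w \_ (tube S r `\` S).
  have mW : measurable_fun (Omega : set T) (W : T -> R).
    exact: (measurable_fun_patch (T := T)).
  have W0 x : Omega x -> 0 <= W x by rewrite /W patchE; case: ifPn => // _ Ox; exact: w0.
  have bW0 x : Omega x -> (0 <= (Bphi [::] * W x)%:E)%E.
    by move=> Ox; rewrite lee_fin mulr_ge0// W0.
  have wpsi0 x : Omega x -> (0 <= (w x * psi x)%:E)%E.
    by move=> Ox; rewrite lee_fin mulr_ge0// w0.
  have le1 : (\int[mes]_(x in Omega) (w x * phi x)%:E <=
      \int[mes]_(x in Omega) ((w x * psi x)%:E + (Bphi [::] * W x)%:E))%E.
    apply: ge0_le_integral_nonmeasurable => x Ox.
      by rewrite lee_fin mulr_ge0// w0.
    rewrite -EFinD lee_fin -lerBlDl.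
    have -> : w x * phi x - w x * psi x = phi x * chi x * w x.
      by rewrite psiE; ring.
    rewrite /W patchE; case: ifPn => [_|].
      rewrite ler_wpM2r ?w0//; apply: le_trans (_ : phi x <= _).
        by rewrite ler_piMr//; case/andP: (chi01 x).
      exact: le_trans (ler_norm _) ((BphiP [::]).2 x).
    rewrite notin_setE => nx; have pt0 : point = 0 :> R by [].
    have [Sx|nSx] := pselect (S x); first by rewrite source_in// ?pt0 !mulr0.
    rewrite chi_out ?mulr0 ?mul0r ?pt0 ?mulr0//.
    by move=> xr; exact: nx.
  have mwpsi : measurable_fun (Omega : set T) (fun x : T => (w x * psi x)%:E).
    by apply/measurable_EFinP; exact: measurable_smooth_mul.
  have mbW : measurable_fun (Omega : set T) (fun x : T => (Bphi [::] * W x)%:E).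
    apply/measurable_EFinP.
    by apply: (@measurable_funM _ T R _ (cst (Bphi [::]))); first exact: measurable_cst.
  apply: (le_trans le1); rewrite (ge0_integralD mes mO wpsi0 mwpsi bW0 mbW).
  apply: leeD2l; under eq_integral do rewrite EFinM.
  have mWE : measurable_fun (Omega : set T) (EFin \o W) by exact/measurable_EFinP.
  have WE0 x : Omega x -> (0 <= (EFin \o W) x)%E by move=> Ox; rewrite lee_fin W0.
  rewrite (ge0_integralZl mes mO mWE WE0); last by rewrite lee_fin.
  have -> : (\int[mes]_(x in Omega) (W x)%:E =
      \int[mes]_(x in tube S r `\` S) (w x)%:E)%E.
    rewrite -[in RHS](setIidr EO) [in RHS]integral_mkcondr.
    by apply: eq_integral => x _; rewrite /= /W !patchE; case: ifPn.
  apply: (@le_trans _ _ ((Bphi [::])%:E * (e / 2 / (Bphi [::] + 1))%:E)%E).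
    by rewrite lee_wpmul2l ?lee_fin// ltW// wP.
  rewrite -EFinM lee_fin mulrCA -[leRHS]mulr1 ler_wpM2l ?(ltW e20)//.
  by rewrite ler_pdivrMr// mul1r lerDl.
apply: (le_trans lower); apply: (le_trans (leeD2r _ (le_trans weak upper))).
rewrite -addeA -EFinD; apply: leeD2l; rewrite lee_fin; lra.
Qed.

Lemma removable_of_bounds : removable Omega S a f g u.
Proof.
split.
- apply/integrableP; split; first exact/measurable_EFinP.
  exact: zero_ext_integral_lty.
- apply/integrableP; split; first exact/measurable_EFinP.
  apply: le_lt_trans source_integral_lty.
  by apply: ge0_le_integral_nonmeasurable => x Ox //=; rewrite ger0_norm// w0.
- exact: weak_inequality_extends.
Qed.

End removability.

Theorem theorem2p2 (R : realType) (m n : nat) (hm : (0 < m)%N) (hn : (0 < n)%N)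
    (Omega S : set 'rV[R]_n)
    (hOmega : bounded_domain Omega) (hS : compact S) (hSOmega : S `<=` Omega)
    (a : multi_index m n -> 'rV[R]_n -> R -> R)
    (ha : forall alpha : multi_index m n, mi_order alpha = m ->
      caratheodory_function Omega (a alpha))
    (A : R) (hA : 0 < A)
    (haA : forall alpha : multi_index m n, mi_order alpha = m ->
      {ae @mes R n, forall x, Omega x -> forall z : R,
        `|a alpha x z| <= A * `|z|})
    (f : 'rV[R]_n -> R) (hf0 : forall x, Omega x -> 0 <= f x)
    (hf : measurable_fun (Omega : set (rV_leb R n)) f)
    (g : R -> R) (hg : nonlinearity g)
    (hgint : (\int[lebesgue_measure]_(z in `[1%R, +oo[)
      (g z `^ (- m%:R^-1) * z `^ (m%:R^-1 - 1))%:E < +oo)%E)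
    (hgamma : (\int[@mes R n]_(x in Omega `\` S) gamma_inv g (f x) < +oo)%E)
    (k : R) (hk : finite_dimension k (boundary S))
    (hG : forall C : R, 0 < C ->
      (limf_esup (fun r : R =>
         (r `^ (n%:R - k - m%:R))%:E *
         Ginv m g ((C * r)%:E *
           essinf_on (tube S r `\` S) (fun x => (f x `^ m%:R^-1)%R)))
       0^'+ < +oo)%E)
    (hmu : forall C : R, 0 < C ->
      (0 < limf_einf (fun r : R =>
         (r ^+ m * mu g (C * r `^ (m%:R - n%:R + k)))%:E *
         essinf_on (tube S r `\` S) f)
       0^'+)%E)
    (u : 'rV[R]_n -> R) (hu : weak_solution Omega S a f g u) :
  removable Omega S a f g u.
Proof.
have [_ oO _ _] := hOmega.
have [R1 R10 R1O] := compact_tube_subset hS oO hSOmega.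
have R30 : 0 < R1 / 3 by rewrite divr_gt0.
have R3O : tube S (3 * (R1 / 3)) `<=` Omega.
  by have -> : 3 * (R1 / 3) = R1 by field.
have [B [d [d0 dP]]] := limf_esup_right_lty hk.
(* The bound [B] from the upper limit is an arbitrary real number, whereas the measure constant must
   be positive. *)
have D0 : 0 < `|B| + 1 by rewrite ltr_wpDl.
apply: (removable_of_bounds hm oO hS hSOmega ha hA haA hf0 hg hu D0 d0 _ R30 R3O hgint
  hG hgamma hmu).
move=> r r0 rd; have p0 : 0 < r `^ (n%:R - k) by rewrite powR_gt0.
apply: (@le_trans _ _ (mes (tube (boundary S) r))).
  apply: le_measure; rewrite ?inE; last exact: tube_boundary.
    by apply: measurableD; [exact: measurable_tube|exact: measurable_singular_set].
  exact: measurable_tube.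
have := dP r r0 rd; rewrite lee_pdivrMr//.
move/le_trans; apply; rewrite -EFinM lee_fin ler_wpM2r ?(ltW p0)//.
by apply: (le_trans (ler_norm _)); rewrite lerDl.
Qed.
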